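(* Let $\{X(t): t \in [0,\infty)\}$ be a centered stationary Gaussian process with almost surely continuous sample paths and covariance function $r(t) := \mathrm{Cov}(X(s), X(s+t))$ satisfying: (A1) $r(t) = 1 - C|t|^\alpha + o(|t|^\alpha)$ as $t \to 0$, for some $\alpha \in (0,2]$ and $C > 0$; (A2) $r(t) < 1$ for all $t > 0$; (A3) $r(t)\log(t) \to 0$ as $t \to \infty$. Let $T$ be a nonnegative random variable, independent of $\{X(t)\}$, such that $\mathbb{P}(T > t) = L(t)$ for some function $L$ slowly varying at $\infty$. Then, as $u \to \infty$, \[ \mathbb{P}\Big(\sup_{s \in [0,T]} X(s) > u\Big) = L\Big(u^{\frac{\alpha-2}{\alpha}} \exp(u^2/2)\Big)(1+o(1)). \] *)

(* Defs.v *)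
From HB Require Import structures.
From mathcomp Require Import all_boot all_order all_algebra.
From mathcomp Require Import all_classical all_reals all_analysis.
Set Implicit Arguments. Unset Strict Implicit. Unset Printing Implicit Defensive.
Import Order.TTheory GRing.Theory Num.Theory.
Import numFieldNormedType.Exports.
Local Open Scope classical_set_scope.
Local Open Scope ring_scope.

Definition centered_gaussian {d} {Omega : measurableType d} {R : realType}
  (P : probability Omega R) (Y : Omega -> R) (v : R) : Prop :=
  0 <= v /\ measurable_fun setT Y /\
  forall A : set R, measurable A ->
    P (Y @^-1` A) = if v == 0 then \d_(0:R) A else normal_prob 0 (Num.sqrt v) A.

Definition centered_gaussian_process {d} {Omega : measurableType d} {R : realType}
  (P : probability Omega R) (X : R -> Omega -> R) : Prop :=
  forall (n : nat) (t : 'I_n -> R) (a : 'I_n -> R), (forall i, 0 <= t i) ->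
    exists v : R, centered_gaussian P (fun w => \sum_(i < n) a i * X (t i) w) v.

(* T is independent of the process {X(t) : t >= 0} (independence of sigma(T)
   from the sigma-algebra generated by X, via its generating pi-system of
   finite-dimensional cylinder events) *)
Definition independent_of_process {d} {Omega : measurableType d} {R : realType}
  (P : probability Omega R) (T : Omega -> R) (X : R -> Omega -> R) : Prop :=
  forall (n : nat) (t : 'I_n -> R) (B : 'I_n -> set R) (A : set R),
    (forall i, 0 <= t i) -> (forall i, measurable (B i)) -> measurable A ->
    P (T @^-1` A `&` \bigcap_(i in [set: 'I_n]) (X (t i) @^-1` B i))
    = (P (T @^-1` A) * P (\bigcap_(i in [set: 'I_n]) (X (t i) @^-1` B i)))%E.

Definition slowly_varying {R : realType} (L : R -> R) : Prop :=
  (\forall x \near +oo, 0 < L x) /\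
  forall lam : R, 0 < lam -> (fun x => L (lam * x) / L x) @ +oo --> (1 : R).

(* Main.v *)
(** Since [L] is slowly varying, only the order of magnitude of the first time
    at which [X] exceeds [u] matters, and Pickands' constant plays no role.  Put
    [mu u = u `^ ((alpha - 2) / alpha) * expR (u ^+ 2 / 2)] and
    [h = u `^ (- (2 / alpha))], so that [h / mu u] is the Gaussian tail order
    [u^-1 * expR (- (u ^+ 2 / 2))].

    Upper bound: dyadic chaining bounds the probability of an exceedance in an
    interval of length [h] by [K * (h / mu u)].  Either [T > eps * mu u], or the
    exceedance occurs in a block starting at some [t <= T]; by independence the
    second case contributes at most a constant times
    [\sum_(j <= eps * mu u) L j / mu u], which by Karamata's theorem is
    [O(eps) * L (eps * mu u)].

    Lower bound: by the second moment method the grid [h * nat] up to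
    [M * mu u] is hit above level [u] with probability at least [1 - eps]: lags
    of order [h] contribute a convergent series by (A1), intermediate lags are
    negligible by (A2), and exponentially large lags are asymptotically
    independent by (A3).  Finally [L (c * mu u) / L (mu u)] tends to [1] for
    both constants [c]. *)
Require Import Defs.
From HB Require Import structures.
From mathcomp Require Import all_boot all_order all_algebra.
From mathcomp Require Import all_classical all_reals all_analysis.
From mathcomp Require Import measurable_realfun lra ring zify.
Import Order.TTheory GRing.Theory Num.Theory.
Import numFieldNormedType.Exports.
Set Implicit Arguments. Unset Strict Implicit. Unset Printing Implicit Defensive.
Local Open Scope classical_set_scope.
Local Open Scope ring_scope.

(** * Normal laws *)

(** The hypotheses give joint laws only through linear combinations, and independence of [T] only
    through finitely many times. Joint tails are therefore reduced to the tail of one well-chosen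
    combination. Genuine independence is used for far lags alone, where the bound must be sharp up
    to a factor [1 + o(1)]; it comes from factorising expectations of cosines, which determine
    half-line events. Path continuity turns the event into countable unions of grid events, to which
    independence and bounds uniform in the grid apply. It also yields [r 0 = 1], since (A1) speaks
    only of [t > 0]. Intermediate lags may be exponentially many: where [r <= 1 - gap] each costs a
    factor [expR (- (gap * u ^+ 2 / 4))], so [expR (gap * u ^+ 2 / 8)] of them are harmless. Beyond
    that number [ln t] is at least of order [u ^+ 2], and (A3) becomes [r t * u ^+ 2] tending to 0,
    which is what comparison with an independent pair requires. A large [M] makes the expected
    number of hits large and its relative variance small. In the upper bound, additive constants
    divided by [mu u] must be negligible against [L (mu u)]; this needs [x * L x] to tend to
    infinity. *)

(** The Radon-Nikodym change of variables asks for integrability: the truncations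
    [Num.min (f x) n%:R] are bounded, hence integrable, and monotone convergence removes the
    truncation on both sides. *)
Lemma normal_prob_integral (R : realType) (m s : R) (f : R -> R) :
  measurable_fun setT f -> (forall x, 0 <= f x) ->
  (\int[normal_prob m s]_x (f x)%:E =
   \int[lebesgue_measure]_x (f x * normal_pdf m s x)%:E)%E.
Proof.
move=> mf f0.
have mpdf := measurable_normal_pdf m s.
pose fn (n : nat) x := Num.min (f x) n%:R.
have mfn n : measurable_fun setT (fn n) by exact: measurable_minr.
have fn0 n x : 0 <= fn n x by rewrite /fn le_min f0 ler0n.
have fn_bnd n x : fn n x <= n%:R by rewrite /fn ge_min lexx orbT.
have bnd n : (\int[normal_prob m s]_x (fn n x)%:E =
    \int[lebesgue_measure]_x (fn n x * normal_pdf m s x)%:E)%E.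
  have intf : (normal_prob m s).-integrable setT (EFin \o fn n).
    apply: measurable_bounded_integrable => //.
      by rewrite (le_lt_trans (probability_le1 _ _))// ltry.
    apply: mfn.
    exists n%:R; split; first by rewrite num_real.
    by move=> x nx y _ /=; rewrite ger0_norm// (le_trans (fn_bnd _ _))// ltW.
  have dom := normal_prob_dominates m s.
  rewrite -(Radon_Nikodym_change_of_variables dom)//=.
  apply: ae_eq_integral => //.
  - apply: emeasurable_funM; first exact: (measurable_int (normal_prob m s) intf).
    apply: (measurable_int lebesgue_measure).
    by apply: Radon_Nikodym_integrable; exact: dom.
  - by apply/measurable_EFinP; apply: measurable_funM; [exact: mfn|exact: mpdf].
  - under [X in ae_eq _ _ _ X]eq_fun do rewrite EFinM.
    apply: ae_eqe_mul2l => /=.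
    rewrite Radon_NikodymE//=; case: cid => /= h [h1 h2 h3].
    apply: integral_ae_eq => //=.
    + exact/measurable_EFinP.
    + by move=> E _ mE; rewrite -h3.
have H1 := @cvg_monotone_convergence _ _ R (normal_prob m s) setT measurableT
   (fun n x => (fn n x)%:E).
have H2 := @cvg_monotone_convergence _ _ R lebesgue_measure setT measurableT
   (fun n x => (fn n x * normal_pdf m s x)%:E).
have ndfn x : {homo (fn ^~ x) : n k / (n <= k)%N >-> n <= k}.
  by move=> n k nk; rewrite /fn le_min ge_min lexx/= ge_min ler_nat nk orbT.
have pdf0 x : 0 <= normal_pdf m s x by exact: normal_pdf_ge0.
have fnf x : \forall n \near \oo, fn n x = f x.
  near=> n; rewrite /fn; apply/min_idPl.
  by near: n; exact: nbhs_infty_ger.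
have E1 : (\int[normal_prob m s]_x (f x)%:E =
    \int[normal_prob m s]_x limn (fun n => (fn n x)%:E))%E.
  apply: eq_integral => x _; apply/esym/cvg_lim => //.
  by apply: cvg_near_cst; near do congr EFin.
have E2 : (\int[lebesgue_measure]_x (f x * normal_pdf m s x)%:E =
    \int[lebesgue_measure]_x limn (fun n => (fn n x * normal_pdf m s x)%:E))%E.
  apply: eq_integral => x _; apply/esym/cvg_lim => //.
  by apply: cvg_near_cst; near do congr (_ * _)%:E.
rewrite E1 E2.
have mEfn n : measurable_fun setT (EFin \o fn n) by apply/measurable_EFinP; exact: mfn.
have L1 : (\int[normal_prob m s]_x (fn n x)%:E)%E @[n --> \oo] -->
    (\int[normal_prob m s]_x limn (fun n => (fn n x)%:E))%E.
  apply: H1 => [n|n x _|x _ n k nk].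
  + exact: mEfn.
  + by rewrite lee_fin.
  + by rewrite lee_fin; exact: ndfn.
have L2 : (\int[lebesgue_measure]_x (fn n x * normal_pdf m s x)%:E)%E
    @[n --> \oo] -->
    (\int[lebesgue_measure]_x limn (fun n => (fn n x * normal_pdf m s x)%:E))%E.
  apply: H2 => [n|n x _|x _ n k nk].
  + by apply/measurable_EFinP; apply: measurable_funM; [exact: mfn|exact: mpdf].
  + by rewrite lee_fin mulr_ge0.
  + by rewrite lee_fin ler_wpM2r//; exact: ndfn.
rewrite (funext bnd) in L1.
exact: (cvg_unique _ L1 L2).
Unshelve. all: end_near. Qed.

Lemma gaussian_ge0_integral d (Omega : measurableType d) (R : realType)
  (P : probability Omega R) (Y : Omega -> R) (v : R) (f : R -> R) :
  centered_gaussian P Y v -> 0 < v ->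
  measurable_fun setT f -> (forall x, 0 <= f x) ->
  (\int[P]_w (f (Y w))%:E =
   \int[lebesgue_measure]_x (f x * normal_pdf 0 (Num.sqrt v) x)%:E)%E.
Proof.
move=> [v0 [mY YE]] vpos mf f0; rewrite -normal_prob_integral//.
have mY' : @measurable_fun _ _ Omega (measurableTypeR R) setT Y by exact: mY.
pose Y' : {mfun Omega >-> measurableTypeR R} := @mfun_Sub _ _ Omega (measurableTypeR R) Y (mem_set mY').
have := @ge0_integral_distribution _ _ _ _ _ P Y' (EFin \o f).
move=> <-.
- apply: eq_measure_integral => A mA _.
  by rewrite [LHS]YE// gt_eqF.
- exact/measurable_EFinP.
- by move=> y; rewrite lee_fin.
Qed.

Lemma gaussian_integral d (Omega : measurableType d) (R : realType)
  (P : probability Omega R) (Y : Omega -> R) (v : R) (f : R -> R) :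
  centered_gaussian P Y v -> 0 < v -> measurable_fun setT f ->
  lebesgue_measure.-integrable setT
    (fun x => (f x * normal_pdf 0 (Num.sqrt v) x)%:E) ->
  P.-integrable setT (fun w => (f (Y w))%:E) /\
  \int[P]_w f (Y w) =
  \int[lebesgue_measure]_x (f x * normal_pdf 0 (Num.sqrt v) x).
Proof.
move=> gY v0 mf intf.
have mY : measurable_fun setT Y by case: gY => _ [].
set p := normal_pdf 0 (Num.sqrt v).
have p0 x : 0 <= p x by exact: normal_pdf_ge0.
have intp : lebesgue_measure.-integrable setT (fun x => (f^\+ x * p x)%:E).
  apply: le_integrable intf => //.
    apply/measurable_EFinP/measurable_funM; first exact: measurable_funrpos.
    exact: measurable_normal_pdf.
  move=> x _ /=; rewrite lee_fin !normrM ler_wpM2r//.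
  by rewrite ger0_norm ?funrpos_ge0// /funrpos ge_max normr_ge0 ler_norm.
have intn : lebesgue_measure.-integrable setT (fun x => (f^\- x * p x)%:E).
  apply: le_integrable intf => //.
    apply/measurable_EFinP/measurable_funM; first exact: measurable_funrneg.
    exact: measurable_normal_pdf.
  move=> x _ /=; rewrite lee_fin !normrM ler_wpM2r//.
  by rewrite ger0_norm ?funrneg_ge0// /funrneg ge_max normr_ge0 -normrN ler_norm.
have Ep := gaussian_ge0_integral gY v0 (measurable_funrpos mf) (funrpos_ge0 f).
have En := gaussian_ge0_integral gY v0 (measurable_funrneg mf) (funrneg_ge0 f).
have fin (g : R -> R) : measurable_fun setT g -> (forall x, 0 <= g x) ->
    lebesgue_measure.-integrable setT (fun x => (g x * p x)%:E) ->
    P.-integrable setT (fun w => (g (Y w))%:E).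
  move=> mg g0 ig; apply/integrableP; split.
    by apply/measurable_EFinP; exact: measurableT_comp.
  rewrite (eq_integral (fun w => (g (Y w))%:E)); last first.
    by move=> w _ /=; rewrite ger0_norm.
  rewrite (gaussian_ge0_integral gY)//.
  move/integrableP : ig => [_].
  by under eq_integral => x _ do rewrite /= ger0_norm ?mulr_ge0//.
have ip := fin _ (measurable_funrpos mf) (funrpos_ge0 f) intp.
have ineg := fin _ (measurable_funrneg mf) (funrneg_ge0 f) intn.
have fE : f = (fun x => f^\+ x - f^\- x) by apply/esym; exact: funrposBneg.
split.
  rewrite [X in _.-integrable _ X](_ : _ = (fun w => (f^\+ (Y w))%:E - (f^\- (Y w))%:E)%E).
    exact: integrableB.
  by apply/funext => w; rewrite -EFinB {1}fE.
rewrite {1}fE RintegralB//.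
rewrite /Rintegral Ep En -/p.
transitivity (\int[lebesgue_measure]_x (f^\+ x * p x - f^\- x * p x)).
  by rewrite RintegralB.
by apply: eq_Rintegral => x _; rewrite -mulrBl {3}fE.
Qed.

Lemma is_derive_normal_pdf (R : realType) (s x : R) : s != 0 ->
  is_derive x (1:R) (normal_pdf 0 s) (- (x / s ^+ 2) * normal_pdf 0 s x).
Proof.
move=> s0; rewrite normal_pdfE//.
rewrite (_ : (fun x => _) = (fun x => normal_peak s * expR (- (s ^+ 2 *+ 2)^-1 * x ^+ 2))); last first.
  apply/funext => y; rewrite /normal_fun subr0; congr (_ * expR _).
  by rewrite mulNr mulrC -mulNr.
apply: is_derive_eq.
rewrite /normal_fun subr0 /GRing.scale/= !mulr1.
rewrite (_ : - (s ^+ 2 *+ 2)^-1 * x ^+ 2 = - x ^+ 2 / (s ^+ 2 *+ 2)); last first.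
  by rewrite mulNr mulrC -mulNr.
move: (expR _) (normal_peak _) => e p.
by field.
Qed.

Lemma exp_sqr_bound (R : realType) (c x : R) : 0 < c ->
  1 + `|x| + x ^+ 2 <= (2 + 2 / c) * expR (c * x ^+ 2).
Proof.
move=> c0.
have H1 : `|x| <= 1 + x ^+ 2.
  rewrite -[x ^+ 2]ger0_norm ?sqr_ge0// normrX.
  by have := sqr_ge0 (`|x| - 1); have := normr_ge0 x; nra.
have := expR_ge1Dx (c * x ^+ 2).
have c2 : 0 < 2 / c by rewrite divr_gt0.
have x2 : x ^+ 2 = c^-1 * (c * x ^+ 2) by rewrite mulrA mulVf ?mul1r// gt_eqF.
have : 0 <= c * x ^+ 2 by rewrite mulr_ge0 ?sqr_ge0// ltW.
set t := c * _ in x2 *; rewrite x2 in H1 * => t0 et.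
have ci : 0 < c^-1 by rewrite invr_gt0.
by nra.
Qed.

(** A factor of quadratic growth times the density of variance [s ^+ 2] is dominated by a multiple
    of the density of variance [2 * s ^+ 2]. The constant [c] is the difference of the two
    exponents, and [exp_sqr_bound] absorbs the polynomial into [expR (c * x ^+ 2)]. *)
Lemma stein_integrable (R : realType) (s K : R) (g g' : R -> R) : 0 < s ->
  measurable_fun setT g -> measurable_fun setT g' ->
  (forall x, `|g x| <= K * (1 + `|x|)) -> (forall x, `|g' x| <= K) ->
  lebesgue_measure.-integrable setT
   (fun x => ((g' x - x / s ^+ 2 * g x) * normal_pdf 0 s x)%:E).
Proof.
move=> s0 mg mg' gK g'K.
have K0 : 0 <= K by rewrite (le_trans _ (g'K 0)).
have s20 : 0 < s * Num.sqrt 2 by rewrite mulr_gt0 ?sqrtr_gt0.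
pose c := (s ^+ 2 *+ 4)^-1.
have c0 : 0 < c by rewrite invr_gt0 mulrn_wgt0// exprn_gt0.
pose M := K * (1 + (s ^+ 2)^-1) * (2 + 2 / c) * normal_peak s
   * (normal_peak (s * Num.sqrt 2))^-1.
have s2 : 0 < s ^+ 2 by rewrite exprn_gt0.
have M0 : 0 <= M.
  rewrite /M !mulr_ge0 ?invr_ge0 ?normal_peak_ge0// addr_ge0// ?invr_ge0 ?(ltW s2)//.
  by rewrite divr_ge0// ltW.
have iN : lebesgue_measure.-integrable setT
    (fun x => (M * normal_pdf 0 (s * Num.sqrt 2) x)%:E).
  under eq_fun do rewrite EFinM.
  by apply: integrableZl => //; exact: integrable_normal_pdf.
apply: le_integrable iN => //.
- apply/measurable_EFinP; apply: measurable_funM; last exact: measurable_normal_pdf.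
  apply: measurable_funB => //; apply: measurable_funM => //.
  exact: measurable_funM.
- move=> x _ /=; rewrite lee_fin.
  rewrite [leRHS]ger0_norm; last by rewrite mulr_ge0 ?normal_pdf_ge0.
  rewrite !normal_pdfE ?gt_eqF// normrM (@ger0_norm _ (_ * normal_fun _ _ _)); last first.
    by rewrite mulr_ge0 ?normal_peak_ge0 ?normal_fun_ge0.
  rewrite /M -!mulrA (mulrA (normal_peak _)^-1) mulVf ?mul1r; last first.
    by rewrite gt_eqF// normal_peak_gt0// gt_eqF.
  rewrite [leLHS]mulrCA ![in leRHS]mulrA [leRHS]mulrAC [leRHS]mulrC.
  rewrite ler_wpM2l ?normal_peak_ge0//.
  have -> : normal_fun 0 s x = normal_fun 0 (s * Num.sqrt 2) x * expR (- (c * x ^+ 2)).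
    rewrite /normal_fun -expRD subr0 exprMn sqr_sqrtr//; congr expR.
    by rewrite /c; field; rewrite gt_eqF.
  rewrite mulrCA [leRHS]mulrC ler_wpM2l ?normal_fun_ge0// expRN ler_pdivrMr ?expR_gt0//.
  apply: (@le_trans _ _ (K * (1 + (s ^+ 2)^-1) * (1 + `|x| + x ^+ 2))).
    rewrite (le_trans (ler_normB _ _))// mulrA !normrM (@ger0_norm _ (s ^+ 2)^-1) ?invr_ge0 ?(ltW s2)//.
    have := g'K x; have := gK x; rewrite -[x ^+ 2]ger0_norm ?sqr_ge0// normrX.
    have : 0 < (s ^+ 2)^-1 by rewrite invr_gt0.
    move: (normr_ge0 x) (normr_ge0 (g x)).
    move: (s ^+ 2)^-1 `|x| `|g x| `|g' x| => a b e f b0 e0 a0 H1 H2.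
    have : b * a * e <= b * a * (K * (1 + b)) by rewrite ler_wpM2l// mulr_ge0// ltW.
    nra.
  rewrite -[leRHS]mulrA ler_wpM2l ?exp_sqr_bound//.
  by rewrite mulr_ge0// addr_ge0// invr_ge0 ltW.
Qed.


(** The integrand is the derivative of [g * normal_pdf 0 s], because the density has logarithmic
    derivative [- x / s ^+ 2]. Its integral over growing symmetric intervals reduces to boundary
    terms that vanish. *)
Lemma stein_identity (R : realType) (s K : R) (g g' : R -> R) : 0 < s ->
  continuous g' -> (forall x, is_derive x (1:R) g (g' x)) ->
  (forall x, `|g x| <= K * (1 + `|x|)) -> (forall x, `|g' x| <= K) ->
  \int[lebesgue_measure]_x ((g' x - x / s ^+ 2 * g x) * normal_pdf 0 s x) = 0.
Proof.
move=> s0 cg' dg gK g'K.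
have cg : continuous g.
  by move=> x; apply: differentiable_continuous; apply/derivable1_diffP; exact: (@ex_derive _ _ _ _ _ _ _ (dg x)).
have mg : measurable_fun setT g by exact: continuous_measurable_fun.
have mg' : measurable_fun setT g' by exact: continuous_measurable_fun.
have K0 : 0 <= K by rewrite (le_trans _ (g'K 0)).
have s2 : 0 < s ^+ 2 by rewrite exprn_gt0.
have intf := stein_integrable s0 mg mg' gK g'K.
set f := fun x => (g' x - x / s ^+ 2 * g x) * normal_pdf 0 s x.
pose F x := g x * normal_pdf 0 s x.
have dF x : is_derive x (1:R) F (f x).
  have dn := is_derive_normal_pdf x (lt0r_neq0 s0).
  have dgx := dg x.
  apply: is_derive_eq.
  rewrite /f /GRing.scale/=.
  by ring.
have cf : continuous f.
  move=> x; apply: cvgM; last first.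
    by apply: continuous_normal_pdf; rewrite gt_eqF.
  apply: cvgB; first exact: cg'.
  by apply: cvgM; [apply: cvgM; [exact: cvg_id|exact: cvg_cst]|exact: cg].
have FTC (n : nat) : (\int[lebesgue_measure]_(x in `[(- n.+1%:R)%R, n.+1%:R]) (f x)%:E =
    (F n.+1%:R)%:E - (F (- n.+1%:R))%:E)%E.
  apply: continuous_FTC2.
  - by rewrite (@lt_trans _ _ 0)// ?oppr_lt0.
  - exact: continuous_subspaceT.
  - have cF x : {for x, continuous F}.
      by apply: differentiable_continuous; apply/derivable1_diffP; exact: (@ex_derive _ _ _ _ _ _ _ (dF x)).
    split.
    + by move=> x _; exact: (@ex_derive _ _ _ _ _ _ _ (dF x)).
    + by apply: cvg_at_right_filter; exact: cF.
    + by apply: cvg_at_left_filter; exact: cF.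
  - by move=> x _; rewrite derive1E; exact: (@derive_val _ _ _ _ _ _ _ (dF x)).
pose D n : set R := `[(- n.+1%:R)%R, n.+1%:R]%classic.
have L1 : (\int[lebesgue_measure]_x ((f \_ (D n)) x)%:E)%E @[n --> \oo] -->
   (\int[lebesgue_measure]_x (f x)%:E)%E.
  apply: (dominated_cvg measurableT _ _ _ (integrable_abse intf)).
  - move=> n; apply/measurable_EFinP.
    apply/(measurable_restrictT _ _).1 => //.
      exact: measurable_itv.
    by apply: measurable_funS (continuous_measurable_fun cf).
  - move=> x _; apply: cvg_near_cst; near=> n.
    congr EFin; rewrite patchE mem_set//.
    rewrite /D/= in_itv/= -ler_norml.
    rewrite (@le_trans _ _ n%:R)// ?ler_nat//.
    by near: n; exact: nbhs_infty_ger.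
  - by [].
  - move=> n x _ /=; rewrite lee_fin patchE; case: ifPn => // _.
    by rewrite normr0.
have L2 : (\int[lebesgue_measure]_x ((f \_ (D n)) x)%:E)%E @[n --> \oo] --> 0%E.
  have E n : (\int[lebesgue_measure]_x ((f \_ (D n)) x)%:E)%E =
      (F n.+1%:R - F (- n.+1%:R))%:E.
    rewrite EFinB -FTC [RHS]integral_mkcond.
    by apply: eq_integral => x _; rewrite restrict_EFin.
  rewrite (funext E); apply: cvg_EFin; first by apply: nearW.
  rewrite /comp/=.
  pose c := (s ^+ 2 *+ 2)^-1.
  have c0 : 0 < c by rewrite invr_gt0 mulrn_wgt0.
  pose B := 4 * K * normal_peak s / c ^+ 2.
  (* From [expR y >= y ^+ 2 / 2] with [y = c * N ^+ 2], the boundary term is of order [N * N ^- 4];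
     the rate [N^-1] retained here is enough. *)
  have Fb (x : R) (n : nat) : `|x| = n.+1%:R -> `|F x| <= B * n.+1%:R^-1.
    move=> xn; rewrite normrM (ger0_norm (normal_pdf_ge0 _ _ _)).
    set N : R := n.+1%:R in xn *.
    have N1 : 1 <= N by rewrite /N ler1n.
    have N0 : 0 < N by rewrite (lt_le_trans _ N1).
    apply: (@le_trans _ _ (K * (2 * N) * normal_peak s * (c ^+ 2 * N ^+ 4 / 2)^-1)).
      rewrite normal_pdfE ?gt_eqF// [leLHS]mulrA.
      apply: ler_pM; rewrite ?mulr_ge0 ?normal_peak_ge0 ?normal_fun_ge0//.
        rewrite ler_wpM2r ?normal_peak_ge0// (le_trans (gK x))// xn.
        by rewrite ler_wpM2l// mulr_natl mulr2n lerD2r.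
      rewrite /normal_fun subr0 mulNr expRN lef_pV2 ?posrE ?expR_gt0 ?divr_gt0 ?mulr_gt0 ?exprn_gt0//.
      rewrite -/c -[x ^+ 2]ger0_norm ?sqr_ge0// normrX xn.
      have t0 : 0 <= N ^+ 2 * c by rewrite mulr_ge0 ?sqr_ge0// ltW.
      apply: le_trans (expR_ge1Dxn 1 t0).
      rewrite /= (_ : 2`!%:R = 2 :> R)//.
      by rewrite (_ : c ^+ 2 * N ^+ 4 / 2 = (N ^+ 2 * c) ^+ 2 / 2) ?lerDr//; field.
    have -> : K * (2 * N) * normal_peak s * (c ^+ 2 * N ^+ 4 / 2)^-1 =
       B * N^-1 * (N ^+ 2)^-1.
      by rewrite /B; field; rewrite ?gt_eqF.
    rewrite ler_piMr ?mulr_ge0 ?invr_ge0 ?normal_peak_ge0 ?sqr_ge0 ?(ltW N0)//.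
    by rewrite invf_le1 ?exprn_gt0// expr_ge1.
  apply: norm_cvg0.
  apply: (@squeeze_cvgr _ _ _ _ (cst 0) (fun n => 2 * B * harmonic n)).
  - apply: nearW => n; rewrite normr_ge0/= (le_trans (ler_normB _ _))//.
    rewrite /harmonic/= -mulrA mulr_natl mulr2n.
    by rewrite lerD ?Fb ?normrN// ger0_norm.
  - exact: cvg_cst.
  - rewrite -(mulr0 (2 * B)); apply: cvgM; first exact: cvg_cst.
    exact: cvg_harmonic.
have := cvg_unique _ L1 L2.
by rewrite /Rintegral => ->.
Unshelve. all: end_near.
Qed.

(** Stein's identity for [g = id] gives the second moment of a nondegenerate law. For [v = 0] the
    law is a Dirac mass, so [Y] vanishes almost everywhere. *)
Lemma gaussian_second_moment d (Omega : measurableType d) (R : realType)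
  (P : probability Omega R) (Y : Omega -> R) (v : R) :
  centered_gaussian P Y v ->
  P.-integrable setT (fun w => (Y w ^+ 2)%:E) /\
  \int[P]_w (Y w ^+ 2) = v.
Proof.
move=> gY; have [v0 [mY YE]] := gY.
have [v00|vn0] := eqVneq v 0.
  have ae0 : ae_eq P setT (fun w => (Y w ^+ 2)%:E) (cst 0%E).
    exists (Y @^-1` (~` [set 0])); split.
    - by rewrite -[_ @^-1` _]setTI; apply: mY => //; apply: measurableC.
    - have := YE (~` [set 0]) (measurableC (measurable_set1 0)).
      by rewrite v00 eqxx diracE memNset//= => H; exact: H.
    - move=> w /= H /= Y0; apply: H => _ /=.
      by rewrite Y0 expr0n.
  have mY2 : measurable_fun setT (fun w => (Y w ^+ 2)%:E).
    by apply/measurable_EFinP; exact: measurable_funX.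
  split.
    apply/integrableP; split => //.
    under eq_integral => w _ do rewrite gee0_abs ?lee_fin ?sqr_ge0//.
    by rewrite (ae_eq_integral (cst 0%E))// integral0.
  by rewrite /Rintegral (ae_eq_integral (cst 0%E))//= integral0 v00.
have vpos : 0 < v by rewrite lt_neqAle eq_sym vn0.
set s := Num.sqrt v.
have s0 : 0 < s by rewrite sqrtr_gt0.
have ss : s ^+ 2 = v by rewrite sqr_sqrtr.
have gK (x : R) : `|x| <= 1 * (1 + `|x|) by rewrite mul1r lerDr.
have g'K (x : R) : `|(cst 1 x : R)| <= 1 by rewrite normr1.
have i1 := @stein_integrable R s 1 id (cst 1) s0 (@measurable_id _ _ _) (measurable_cst _) gK g'K.
have e1 := @stein_identity R s 1 id (cst 1) s0 (fun x => cvg_cst _) _ gK g'K.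
have i0 := @integrable_normal_pdf R 0 s.
have mX2 : measurable_fun setT (fun x : R => x ^+ 2) by exact: measurable_funX.
have i2 := integrableB measurableT i0 i1.
have X2E (x : R) : x ^+ 2 * normal_pdf 0 s x =
    v * (normal_pdf 0 s x - (cst 1 x - x / s ^+ 2 * id x) * normal_pdf 0 s x).
  by rewrite /cst/= -ss; field; rewrite gt_eqF.
have iX : lebesgue_measure.-integrable setT (fun x => (x ^+ 2 * normal_pdf 0 s x)%:E).
  have i3 := integrableZl measurableT v i2.
  rewrite [X in _.-integrable _ X](_ : _ = (fun x => v%:E * ((normal_pdf 0 s x)%:E -
    ((cst 1 x - x / s ^+ 2 * id x) * normal_pdf 0 s x)%:E))%E)//.
  by apply/funext => x; rewrite X2E.
have [H1 H2] := gaussian_integral gY vpos mX2 iX.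
split => //; rewrite H2 -/s.
under eq_Rintegral do rewrite X2E.
rewrite RintegralZl// RintegralB// e1 /Rintegral integral_normal_pdf/=.
by rewrite subr0 mulr1.
Qed.

(** [Y] and [- Y] have the same law, so the expectation of an odd function equals its opposite. It
    serves for [id], to centre the process, and for [sin]. *)
Lemma gaussian_mean d (Omega : measurableType d) (R : realType)
  (P : probability Omega R) (Y : Omega -> R) (v : R) (f : R -> R) :
  centered_gaussian P Y v -> centered_gaussian P (fun w => - Y w) v ->
  measurable_fun setT f -> (forall x, `|f x| <= 1 + `|x|) ->
  (forall x, f (- x) = - f x) ->
  P.-integrable setT (fun w => (f (Y w))%:E) /\ \int[P]_w f (Y w) = 0.
Proof.
move=> gY gNY mf fb fN.
have [v0 [mY YE]] := gY; have [_ [mNY NYE]] := gNY.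
have [i2 _] := gaussian_second_moment gY.
have mfY : measurable_fun setT (f \o Y) by exact: measurableT_comp.
have i1 : P.-integrable setT (fun w => (1 + (1 + Y w ^+ 2))%:E).
  rewrite (_ : (fun w => _) = (cst 2%:E \+ (fun w => (Y w ^+ 2)%:E))%E); last first.
    by apply/funext => w /=; rewrite -EFinD addrA.
  by apply: integrableD => //; exact: finite_measure_integrable_cst.
have iF : P.-integrable setT (fun w => (f (Y w))%:E).
  apply: le_integrable i1 => //; first exact/measurable_EFinP.
  move=> w _ /=; rewrite lee_fin (le_trans (fb _))// [leRHS]ger0_norm ?addr_ge0 ?sqr_ge0//.
  rewrite lerD2l -[Y w ^+ 2]ger0_norm ?sqr_ge0// normrX.
  by have := sqr_ge0 (`|Y w| - 1); have := normr_ge0 (Y w); nra.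
split => //.
have mY' : @measurable_fun _ _ Omega (measurableTypeR R) setT Y by exact: mY.
pose Y1 : {mfun Omega >-> measurableTypeR R} :=
  @mfun_Sub _ _ Omega (measurableTypeR R) Y (mem_set mY').
have mNY' : @measurable_fun _ _ Omega (measurableTypeR R) setT (fun w => - Y w) by exact: mNY.
pose Y2 : {mfun Omega >-> measurableTypeR R} :=
  @mfun_Sub _ _ Omega (measurableTypeR R) (fun w => - Y w) (mem_set mNY').
have mEf : measurable_fun setT (EFin \o f) by exact/measurable_EFinP.
have E1 := @integral_distribution _ _ _ _ _ P Y1 (EFin \o f) mEf iF.
have iF2 : P.-integrable setT ((EFin \o f) \o Y2).
  rewrite (_ : _ \o _ = (fun w => - (f (Y w))%:E)%E); first exact: integrableN.
  by apply/funext => w /=; rewrite fN.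
have E2 := @integral_distribution _ _ _ _ _ P Y2 (EFin \o f) mEf iF2.
have E3 : (\int[distribution P Y1]_y (EFin \o f) y =
           \int[distribution P Y2]_y (EFin \o f) y)%E.
  by apply: eq_measure_integral => A mA _; rewrite [LHS]YE// [RHS]NYE.
have : \int[P]_w f (Y w) = - \int[P]_w f (Y w).
  rewrite {1}/Rintegral -[X in fine X]/(\int[P]_w ((EFin \o f) \o Y1) w)%E -E1 E3 E2.
  rewrite -/(Rintegral P setT (fun w => f (- Y w))).
  under eq_Rintegral do rewrite fN -mulN1r.
  by rewrite RintegralZl// mulN1r.
by move/eqP; rewrite -subr_eq0 opprK -mulr2n mulrn_eq0 => /eqP.
Qed.

Lemma Rintegral_prob_cst d (Omega : measurableType d) (R : realType)
  (P : probability Omega R) (c : R) : \int[P]_w c = c.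
Proof.
have := @Rintegral_cst _ _ _ P setT measurableT c.
move=> ->; rewrite (_ : fine _ = 1) ?mulr1//.
exact: (congr1 fine (probability_setT P)).
Qed.

(** Differentiation under the integral and Stein's identity for [sin (a * x)] show that [F a], the
    expectation of [cos (a * Y)], solves [F' = - a F]. Hence [F a * expR (a ^+ 2 / 2)] is constant,
    with value 1 at 0. *)
Lemma gaussian_cos d (Omega : measurableType d) (R : realType)
  (P : probability Omega R) (Y : Omega -> R) (t : R) :
  centered_gaussian P Y 1 ->
  \int[P]_w cos (t * Y w) = expR (- (t ^+ 2 / 2)).
Proof.
move=> gY; have [_ [mY YE]] := gY.
have [i2 _] := gaussian_second_moment gY.
pose f (a : R) w := cos (a * Y w).
pose G w := 1 + Y w ^+ 2.
have iG : P.-integrable setT (EFin \o G).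
  rewrite (_ : EFin \o G = (cst 1%:E \+ (fun w => (Y w ^+ 2)%:E))%E)//.
  by apply: integrableD => //; exact: finite_measure_integrable_cst.
have mf a : measurable_fun setT (f a).
  apply: (@measurableT_comp _ _ _ _ _ _ cos); first exact: continuous_measurable_fun (@continuous_cos R).
  exact: measurable_funM.
have if_ a : P.-integrable setT (EFin \o f a).
  apply: (@le_integrable _ _ _ _ _ measurableT _ (cst 1%:E)) => //.
  - exact/measurable_EFinP.
  - by move=> w _ /=; rewrite lee_fin normr1 ler_norml cos_geN1 cos_le1.
  - exact: finite_measure_integrable_cst.
have df a w : is_derive a (1:R) (f ^~ w) (- (Y w * sin (a * Y w))).
  rewrite /f; apply: is_derive_eq.
  by rewrite scaler0 add0r /GRing.scale/= mulr1 mulNr mulrC.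
have d1f a w : partial1of2 f a w = - (Y w * sin (a * Y w)).
  by rewrite partial1of2E; exact: (@derive_val _ _ _ _ _ _ _ (df a w)).
pose F a := \int[P]_w f a w.
have iYs a : P.-integrable setT (EFin \o (fun w => Y w * sin (a * Y w))).
  apply: le_integrable iG => //.
    apply/measurable_EFinP; apply: measurable_funM => //.
    apply: (@measurableT_comp _ _ _ _ _ _ sin); first exact: continuous_measurable_fun (@continuous_sin R).
    exact: measurable_funM.
  move=> w _ /=; rewrite lee_fin [leRHS]ger0_norm; last by rewrite addr_ge0// sqr_ge0.
  rewrite normrM /G -[Y w ^+ 2]ger0_norm ?sqr_ge0// normrX.
  have s1 : `|sin (a * Y w)| <= 1 by rewrite ler_norml sin_geN1 sin_le1.
  by have := sqr_ge0 (`|Y w| - 1); have := normr_ge0 (Y w); have := normr_ge0 (sin (a * Y w)); nra.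
have stein a : \int[P]_w (Y w * sin (a * Y w)) = a * F a.
  pose g' x : R := a * cos (a * x).
  pose g x : R := sin (a * x).
  have dg (x : R) : is_derive x (1:R) g (g' x).
    rewrite /g; apply: is_derive_eq.
    by rewrite /GRing.scale/= mulr1 mulrC.
  have ca : continuous (fun x : R => a * x) by move=> x; apply: cvgM; [exact: cvg_cst|exact: cvg_id].
  have cg' : continuous g'.
    move=> x; apply: cvgM; first exact: cvg_cst.
    by apply: continuous_comp; [exact: ca|exact: continuous_cos].
  have cg : continuous g.
    by move=> x; apply: continuous_comp; [exact: ca|exact: continuous_sin].
  have mg := continuous_measurable_fun cg; have mg' := continuous_measurable_fun cg'.
  have gK (x : R) : `|g x| <= (1 + `|a|) * (1 + `|x|).
    have : `|g x| <= 1 by rewrite ler_norml sin_geN1 sin_le1.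
    by have := normr_ge0 x; have := normr_ge0 a; nra.
  have g'K (x : R) : `|g' x| <= 1 + `|a|.
    have : `|cos (a * x)| <= 1 by rewrite ler_norml cos_geN1 cos_le1.
    by rewrite normrM; have := normr_ge0 (cos (a * x)); have := normr_ge0 a; nra.
  have i1 := stein_integrable ltr01 mg mg' gK g'K.
  have e1 := stein_identity ltr01 cg' dg gK g'K.
  pose k x := g' x - x / Num.sqrt 1 ^+ 2 * g x.
  have mk : measurable_fun setT k.
    by apply: measurable_funB => //; apply: measurable_funM => //; exact: measurable_funM.
  rewrite -(@sqrtr1 R) in i1 e1.
  have [_] := gaussian_integral gY ltr01 mk i1.
  rewrite e1 /k /g' /g.
  under eq_Rintegral do rewrite sqrtr1 expr1n divr1.
  have ic : P.-integrable setT (EFin \o (fun w => a * cos (a * Y w))).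
    by apply: (integrableZl measurableT a (if_ a)).
  rewrite RintegralB// RintegralZl//; last exact: (if_ a).
  by move/eqP; rewrite subr_eq0 => /eqP ->.
have dF a : is_derive a (1:R) F (- (a * F a)).
  have Ha : `]a - 1, (a + 1)[%classic a by rewrite /= in_itv/= ltrBlDr ltrDl ltr01.
  have G0 w : 0 <= G w by rewrite addr_ge0// sqr_ge0.
  have Gub x y : `]a - 1, (a + 1)[%classic x -> setT y -> `|partial1of2 f x y| <= G y.
    move=> _ _; rewrite d1f normrN normrM /G -[Y y ^+ 2]ger0_norm ?sqr_ge0// normrX.
    have s1 : `|sin (x * Y y)| <= 1 by rewrite ler_norml sin_geN1 sin_le1.
    have := sqr_ge0 (`|Y y| - 1); have := normr_ge0 (Y y); have := normr_ge0 (sin (x * Y y)); nra.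
  have D1 := derivable_under_integral measurableT Ha (fun x _ => if_ x)
    (fun x w _ _ => @ex_derive _ _ _ _ _ _ _ (df x w)) G0 iG Gub.
  have D2 := differentiation_under_integral measurableT Ha (fun x _ => if_ x)
    (fun x w _ _ => @ex_derive _ _ _ _ _ _ _ (df x w)) G0 iG Gub.
  apply: DeriveDef => //.
  rewrite -derive1E D2 -stein.
  under eq_Rintegral do rewrite d1f -mulN1r.
  by rewrite RintegralZl ?mulN1r//; exact: iYs.
pose H a := F a * expR (a ^+ 2 / 2).
have dH (a : R^o) : is_derive a (1:R) H 0.
  have dFa := dF a.
  apply: is_derive_eq.
  rewrite /GRing.scale/=.
  rewrite !mulr0 !mulr1 add0r; move: (F a) (expR _) => x y.
  by field.
have := is_derive_0_is_cst t 0 dH.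
rewrite /H /F /f expr0n/= mul0r expR0 mulr1.
under [X in _ = X -> _]eq_Rintegral do rewrite mul0r cos0.
rewrite Rintegral_prob_cst => E.
apply: (mulIf (lt0r_neq0 (expR_gt0 (t ^+ 2 / 2)))).
by rewrite E -expRD addNr expR0.
Qed.

(** * Independence of uncorrelated Gaussian variables *)

Lemma bounded_integrable d (Omega : measurableType d) (R : realType)
  (P : probability Omega R) (f : Omega -> R) (K : R) :
  measurable_fun setT f -> (forall w, `|f w| <= K) ->
  P.-integrable setT (EFin \o f).
Proof.
move=> mf fK; apply: (@le_integrable _ _ _ _ _ measurableT _ (cst K%:E)).
- exact/measurable_EFinP.
- by move=> w _ /=; rewrite lee_fin (le_trans (fK w))// ler_norm.
- exact: finite_measure_integrable_cst.
Qed.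

Lemma bounded_cvg_Rintegral d (Omega : measurableType d) (R : realType)
  (P : probability Omega R) (f_ : nat -> Omega -> R) (f : Omega -> R) (K : R) :
  (forall n, measurable_fun setT (f_ n)) -> (forall n w, `|f_ n w| <= K) ->
  (forall w, f_ n w @[n --> \oo] --> f w) ->
  \int[P]_w f_ n w @[n --> \oo] --> \int[P]_w f w.
Proof.
move=> mf fK fl.
apply: fine_cvg; rewrite fineK.
  apply: (@dominated_cvg _ _ _ P setT measurableT (fun n w => (f_ n w)%:E) _ (cst K%:E)) => //.
  - by move=> n; apply/measurable_EFinP.
  - by move=> w _; apply: cvg_EFin; [exact: nearW|exact: fl].
  - exact: finite_measure_integrable_cst.
  - by move=> n w _; rewrite lee_fin.
have mfl : measurable_fun setT f by exact: (measurable_fun_cvg mf (fun w _ => fl w)).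
have iF : P.-integrable setT (EFin \o f); last exact: (integrable_fin_num measurableT iF).
apply: (@bounded_integrable _ _ _ _ _ K) => // w.
by apply: (ler_cvg_to (cvg_norm (fl w)) (@cvg_cst _ K _ _ _)); exact: nearW.
Qed.

Lemma bernoulli_inequality (R : realDomainType) (x : R) n : -1 <= x ->
  1 + n%:R * x <= (1 + x) ^+ n.
Proof.
move=> x1; have x10 : 0 <= 1 + x by rewrite -lerBlDl sub0r.
elim: n => [|n IH]; first by rewrite mul0r addr0 expr0.
rewrite exprS (le_trans _ (ler_wpM2l x10 IH))// -natr1.
have : 0 <= n%:R * x ^+ 2 by rewrite mulr_ge0// sqr_ge0.
by nra.
Qed.

Lemma cvg_natmul_expr (R : realType) (q : R) : 0 <= q < 1 ->
  (n%:R * q ^+ n) @[n --> \oo] --> (0 : R).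
Proof.
move=> /andP[]; rewrite le_eqVlt => /predU1P[<- _|q0 q1].
  apply: cvg_near_cst; near=> n; rewrite expr0n.
  suff -> : (n == 0)%N = false by rewrite mulr0.
  by apply/negbTE; rewrite -lt0n; near: n; exact: nbhs_infty_gt.
(* Writing [q = p * p], one factor [p ^+ n] compensates [n], by Bernoulli's inequality for [p^-1],
   and the other tends to 0. *)
pose p := Num.sqrt q.
have p0 : 0 < p by rewrite sqrtr_gt0.
have p1 : p < 1 by rewrite -sqrtr1 ltr_sqrt.
have qp : q = p * p by rewrite -expr2 sqr_sqrtr// ltW.
pose K := (p^-1 - 1)^-1.
have K0 : 0 < p^-1 - 1 by rewrite subr_gt0 invf_gt1.
have npn n : n%:R * p ^+ n <= K.
  have pV1 : -1 <= p^-1 - 1 by rewrite (le_trans _ (ltW K0))// lerNl oppr0.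
  have := bernoulli_inequality n pV1; rewrite [1 + (_ - _)]addrC subrK exprVn => H.
  rewrite /K -[leRHS]mul1r ler_pdivlMr// mulrAC -ler_pdivlMr ?exprn_gt0// div1r.
  by rewrite (le_trans _ H)// lerDr.
apply: (@squeeze_cvgr _ _ _ _ (cst 0) (fun n => K * p ^+ n)).
- apply: nearW => n; rewrite mulr_ge0 ?exprn_ge0 ?(ltW q0)//=.
  by rewrite qp exprMn mulrA ler_wpM2r ?npn// exprn_ge0// ltW.
- exact: cvg_cst.
- rewrite -(mulr0 K); apply: cvgM; first exact: cvg_cst.
  by apply: cvg_expr; rewrite ger0_norm// ltW.
Unshelve. all: end_near. Qed.

(** The quantity that decides is [n * 2 ^ n * s ^+ n]: by Bernoulli's inequality the power tends to
    1 when this tends to 0, and by [1 - x <= expR (- x)] it tends to 0 when this is at least [n].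
    The extra factor [n] in the exponent settles the boundary case [s = 2^-1]. *)
Lemma step_cvg (R : realType) (s : R) : 0 <= s <= 1 ->
  (1 - s ^+ n) ^+ (n * 2 ^ n) @[n --> \oo] --> ((s < 2^-1)%R%:R : R).
Proof.
move=> /andP[s0 s1].
have sn0 n : 0 <= s ^+ n by rewrite exprn_ge0.
have sn1 n : s ^+ n <= 1 by rewrite exprn_ile1.
have [slt|sge] := ltP s 2^-1.
- apply: (@squeeze_cvgr _ _ _ _ (fun n => 1 - n%:R * (2 * s) ^+ n) (cst 1)).
  + apply: nearW => n; rewrite /cst exprn_ile1 ?subr_ge0//; last by rewrite lerBlDr lerDl.
    have sn1' : -1 <= - s ^+ n by rewrite lerN2.
    rewrite andbT (le_trans _ (bernoulli_inequality _ sn1'))// natrM natrX mulrN.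
    by rewrite exprMn mulrA.
  + rewrite -[X in _ --> X]subr0; apply: cvgB; first exact: cvg_cst.
    apply: cvg_natmul_expr; rewrite mulr_ge0//=.
    by rewrite mulrC -ltr_pdivlMr// div1r.
  + exact: cvg_cst.
- apply: (@squeeze_cvgr _ _ _ _ (cst 0) harmonic).
  + apply: nearW => n; rewrite exprn_ge0 ?subr_ge0//=.
    apply: (@le_trans _ _ (expR (- (s ^+ n)) ^+ (n * 2 ^ n))).
      apply: lerXn2r; rewrite ?nnegrE ?subr_ge0 ?expR_ge0//.
      exact: expR_ge1Dx.
    rewrite -expRM_natl mulrN expRN lef_pV2 ?posrE ?expR_gt0//.
    apply: le_trans (expR_ge1Dx _); rewrite -natr1 addrC lerD2l.
    rewrite natrM -mulrA ler_peMr// natrX -exprMn.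
    rewrite exprn_ege1//.
    by rewrite -ler_pdivrMl// mulr1.
  + exact: cvg_cst.
  + exact: cvg_harmonic.
Qed.

Lemma cos_mulsin (R : realType) (A B : R) :
  sin A * cos B = 2^-1 * cos (A + B - pi / 2) + 2^-1 * cos (A - B - pi / 2).
Proof.
rewrite !(cosB _ (pi / 2)) cos_pihalf sin_pihalf !mulr0 !mulr1 !add0r.
by rewrite sinD sinB; field.
Qed.

Lemma cos_mulcos (R : realType) (A B : R) :
  cos A * cos B = 2^-1 * cos (A + B) + 2^-1 * cos (A - B).
Proof. by rewrite cosD cosB; field. Qed.

Lemma measurable_lt_set d (Omega : measurableType d) (R : realType)
  (f g : Omega -> R) : measurable_fun setT f -> measurable_fun setT g ->
  measurable [set w | f w < g w].
Proof.
move=> mf mg; rewrite -[X in measurable X]setTI.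
have := measurable_fun_ltr mf mg measurableT (Y := [set true]).
by apply.
Qed.

Lemma measurable_lt_indicator d (Omega : measurableType d) (R : realType)
  (f g : Omega -> R) : measurable_fun setT f -> measurable_fun setT g ->
  measurable_fun setT (fun w => (f w < g w)%R%:R : R).
Proof.
move=> mf mg; rewrite (_ : (fun w => _) = \1_[set w | f w < g w]); last first.
  apply/funext => w; rewrite indicE; congr (_%:R); congr nat_of_bool.
  by apply/idP/idP; rewrite inE.
by apply: measurable_indic; exact: measurable_lt_set.
Qed.

(* The powers of [s = (1 + sin (a * X + e)) / 2] are trigonometric polynomials in
   [X], hence [V] is orthogonal to [(1 - s ^+ n) ^+ (n * 2 ^ n)], which tends to
   the indicator of [s < 2^-1], i.e. of [sin (a * X + e) < 0].  With
   [e = - a * u] and [a] small this is the half-line [X < u]. *)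
Section trig_determination.
Variables (d : measure_display) (Omega : measurableType d) (R : realType).
Variables (P : probability Omega R) (X V : Omega -> R) (K : R).
Hypothesis mX : measurable_fun setT X.
Hypothesis mV : measurable_fun setT V.
Hypothesis VK : forall w, `|V w| <= K.
Hypothesis cosV : forall b c : R, \int[P]_w (cos (b * X w + c) * V w) = 0.

Let mcos b c : measurable_fun setT (fun w => cos (b * X w + c)).
Proof.
apply: (@measurableT_comp _ _ _ _ _ _ cos); first exact: continuous_measurable_fun (@continuous_cos R).
by apply: measurable_funD => //; exact: measurable_funM.
Qed.

Let s (a e : R) w := (1 + sin (a * X w + e)) / 2.

Let ms a e : measurable_fun setT (s a e).
Proof.
apply: measurable_funM => //; apply: measurable_funD => //.
apply: (@measurableT_comp _ _ _ _ _ _ sin); first exact: continuous_measurable_fun (@continuous_sin R).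
by apply: measurable_funD => //; exact: measurable_funM.
Qed.

Let s01 a e w : 0 <= s a e w <= 1.
Proof.
rewrite /s; have := sin_geN1 (a * X w + e); have := sin_le1 (a * X w + e).
by move: (sin _) => y; lra.
Qed.

Let intV (f : Omega -> R) : measurable_fun setT f -> (forall w, `|f w| <= 1) ->
  P.-integrable setT (EFin \o (fun w => f w * V w)).
Proof.
move=> mf f1; apply: (@bounded_integrable _ _ _ _ _ K) => [|w].
  exact: measurable_funM.
by rewrite normrM (le_trans _ (VK w))// ler_piMl.
Qed.

Let spow_cos n a e b c : \int[P]_w (s a e w ^+ n * cos (b * X w + c) * V w) = 0.
Proof.
have ic m b' c' : P.-integrable setT
    (EFin \o (fun w => s a e w ^+ m * cos (b' * X w + c') * V w)).
  apply: (@intV (fun w => s a e w ^+ m * cos (b' * X w + c'))).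
    by apply: measurable_funM; [exact: measurable_funX|exact: mcos].
  move=> w; rewrite normrM.
  have /andP[s0 s1] := s01 a e w.
  have sm : `|s a e w ^+ m| <= 1 by rewrite normrX exprn_ile1// ger0_norm.
  have c1 : `|cos (b' * X w + c')| <= 1 by rewrite ler_norml cos_geN1 cos_le1.
  by rewrite mulr_ile1.
elim: n b c => [|n IH] b c.
  by under eq_Rintegral do rewrite expr0 mul1r.
transitivity (\int[P]_w (2^-1 * (s a e w ^+ n * cos (b * X w + c) * V w) +
   (4^-1 * (s a e w ^+ n * cos ((a + b) * X w + (e + c - pi / 2)) * V w) +
    4^-1 * (s a e w ^+ n * cos ((a - b) * X w + (e - c - pi / 2)) * V w)))).
  apply: eq_Rintegral => w _; rewrite exprSr.
  have -> : s a e w ^+ n * s a e w * cos (b * X w + c) * V w =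
     s a e w ^+ n * V w * (2^-1 * cos (b * X w + c) +
       2^-1 * (sin (a * X w + e) * cos (b * X w + c))).
    by rewrite {2}/s; field.
  rewrite cos_mulsin.
  have -> : a * X w + e + (b * X w + c) - pi / 2 = (a + b) * X w + (e + c - pi / 2) by ring.
  have -> : a * X w + e - (b * X w + c) - pi / 2 = (a - b) * X w + (e - c - pi / 2) by ring.
  by field.
have i1 := integrableZl measurableT 2^-1 (ic n b c).
have i2 := integrableZl measurableT 4^-1 (ic n (a + b) (e + c - pi / 2)).
have i3 := integrableZl measurableT 4^-1 (ic n (a - b) (e - c - pi / 2)).
rewrite RintegralD//; last exact: (integrableD measurableT i2 i3).
rewrite RintegralD// !RintegralZl//; [|exact: ic..].
by rewrite !IH !mulr0 !addr0.
Qed.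

(** The free exponent [k] makes the induction on [m] close: one more factor [1 - s ^+ n] yields the
    terms with exponents [k] and [k + n]. *)
Let poly_s m n k a e :
  \int[P]_w ((1 - s a e w ^+ n) ^+ m * s a e w ^+ k * V w) = 0.
Proof.
have ic m' k' : P.-integrable setT
    (EFin \o (fun w => (1 - s a e w ^+ n) ^+ m' * s a e w ^+ k' * V w)).
  apply: (@intV (fun w => (1 - s a e w ^+ n) ^+ m' * s a e w ^+ k')).
    apply: measurable_funM; last exact: measurable_funX.
    apply: measurable_funX; apply: measurable_funB => //.
    exact: measurable_funX.
  move=> w; have /andP[s0 s1] := s01 a e w.
  have sn0 : 0 <= s a e w ^+ n by rewrite exprn_ge0.
  have sn1 : s a e w ^+ n <= 1 by rewrite exprn_ile1.
  rewrite ger0_norm; last by rewrite mulr_ge0// exprn_ge0// subr_ge0.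
  rewrite mulr_ile1// ?exprn_ge0 ?exprn_ile1 ?subr_ge0//.
  by rewrite lerBlDr lerDl.
elim: m k => [|m IH] k.
  rewrite -[RHS](spow_cos k a e 0 0).
  apply: eq_Rintegral => w _; rewrite expr0 mul1r mul0r addr0 cos0.
  by rewrite mulr1.
transitivity (\int[P]_w ((1 - s a e w ^+ n) ^+ m * s a e w ^+ k * V w -
    (1 - s a e w ^+ n) ^+ m * s a e w ^+ (k + n) * V w)).
  by apply: eq_Rintegral => w _; rewrite exprSr exprD; ring.
by rewrite RintegralB// !IH subr0.
Qed.

Let step_s a e : \int[P]_w ((s a e w < 2^-1)%R%:R * V w) = 0.
Proof.
have H : \int[P]_w ((1 - s a e w ^+ n) ^+ (n * 2 ^ n) * s a e w ^+ 0 * V w)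
    @[n --> \oo] --> \int[P]_w ((s a e w < 2^-1)%R%:R * V w).
  apply: (@bounded_cvg_Rintegral _ _ _ _ _ _ K).
  - move=> n; apply: measurable_funM => //; apply: measurable_funM; last exact: measurable_funX.
    by apply: measurable_funX; apply: measurable_funB => //; exact: measurable_funX.
  - move=> n w; have /andP[s0 s1] := s01 a e w.
    have sn0 : 0 <= s a e w ^+ n by rewrite exprn_ge0.
    have sn1 : s a e w ^+ n <= 1 by rewrite exprn_ile1.
    rewrite expr0 mulr1 normrM (le_trans _ (VK w))// ler_piMl// ger0_norm.
      by rewrite exprn_ile1 ?subr_ge0// lerBlDr lerDl.
    by rewrite exprn_ge0// subr_ge0.
  - move=> w; apply: cvgM; last exact: cvg_cst.
    under eq_fun do rewrite expr0 mulr1.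
    exact: step_cvg.
rewrite -(cvg_lim _ H)//.
under eq_fun do rewrite poly_s.
exact: lim_cst.
Qed.

Lemma trig_determination (u : R) : \int[P]_w ((X w < u)%R%:R * V w) = 0.
Proof.
have H : \int[P]_w ((s n.+1%:R^-1 (- u / n.+1%:R) w < 2^-1)%R%:R * V w)
    @[n --> \oo] --> \int[P]_w ((X w < u)%R%:R * V w).
  apply: (@bounded_cvg_Rintegral _ _ _ _ _ _ K).
  - move=> n; apply: measurable_funM => //.
    by apply: measurable_lt_indicator => //; exact: ms.
  - move=> n w; rewrite normrM (le_trans _ (VK w))// ler_piMl//.
    by case: (_ < _)%R; rewrite ?normr1 ?normr0.
  - move=> w; apply: cvgM; last exact: cvg_cst.
    apply: cvg_near_cst; near=> n; congr (_%:R); congr (nat_of_bool _).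
    rewrite /s; set y := (X in sin X).
    have n0 : (0 : R) < n.+1%:R by rewrite ltr0n.
    have yE : y = (X w - u) / n.+1%:R by rewrite /y; field; rewrite gt_eqF.
    have ypi : `|y| < pi.
      rewrite yE normrM normfV (@ger0_norm _ n.+1%:R)// ltr_pdivrMr//.
      rewrite mulrC -ltr_pdivrMr ?pi_gt0//.
      apply: (@le_lt_trans _ _ n%:R); last by rewrite ltr_nat.
      by near: n; exact: nbhs_infty_ger.
    rewrite ltr_pdivrMr// mulVf// -ltrBrDl subrr.
    move: ypi; rewrite ltr_norml => /andP[ypi1 ypi2].
    have [Xu|uX] := ltP (X w) u.
      apply/idP; rewrite -oppr_gt0 -sinN sin_gt0_pi//.
      by rewrite ltrNl ypi1 yE -mulNr opprB divr_gt0// subr_gt0.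
    apply/negbTE; rewrite -leNgt sin_ge0_pi// (ltW ypi2) andbT.
    by rewrite yE divr_ge0// subr_ge0.
rewrite -(cvg_lim _ H)//.
under eq_fun do rewrite step_s.
exact: lim_cst.
Unshelve. all: end_near. Qed.

End trig_determination.

Lemma Rintegral_indicator d (Omega : measurableType d) (R : realType)
  (P : probability Omega R) (f : Omega -> bool) :
  measurable [set w | f w] ->
  \int[P]_w ((f w)%:R : R) = fine (P [set w | f w]).
Proof.
move=> mA; rewrite /Rintegral; congr fine.
rewrite -[in RHS](setIT [set w | f w]) -integral_indic//.
apply: eq_integral => w _; rewrite indicE; congr ((nat_of_bool _)%:R%:E).
by apply/idP/idP; rewrite inE.
Qed.

(** [trig_determination] is applied twice. With [V] the centred cosine of [Y] it replaces the cosine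
    of [X] by the indicator of [X < u]; with [V] that indicator, centred, it replaces the cosine of
    [Y] by the indicator of [Y < v]. *)
Lemma cos_factor_independent d (Omega : measurableType d) (R : realType)
  (P : probability Omega R) (X Y : Omega -> R) (u v : R) :
  measurable_fun setT X -> measurable_fun setT Y ->
  (forall a b c e : R, \int[P]_w (cos (a * X w + c) * cos (b * Y w + e)) =
     \int[P]_w cos (a * X w + c) * \int[P]_w cos (b * Y w + e)) ->
  fine (P ([set w | u <= X w] `&` [set w | v <= Y w])) =
  fine (P [set w | u <= X w]) * fine (P [set w | v <= Y w]).
Proof.
move=> mX mY H.
have mcos (Z : Omega -> R) b c : measurable_fun setT Z ->
    measurable_fun setT (fun w => cos (b * Z w + c)).
  move=> mZ; apply: (@measurableT_comp _ _ _ _ _ _ cos); first exact: continuous_measurable_fun (@continuous_cos R).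
  by apply: measurable_funD => //; exact: measurable_funM.
have cos1 (x : R) : `|cos x| <= 1 by rewrite ler_norml cos_geN1 cos_le1.
have icos (Z : Omega -> R) b c : measurable_fun setT Z ->
    P.-integrable setT (EFin \o (fun w => cos (b * Z w + c))).
  by move=> mZ; apply: (@bounded_integrable _ _ _ _ _ 1) => //; exact: mcos.
have Icos (Z : Omega -> R) b c : measurable_fun setT Z ->
    `|\int[P]_w cos (b * Z w + c)| <= 1.
  move=> mZ; apply: le_trans (le_normr_Rintegral _ _) _ => //; first exact: icos.
  rewrite -[leRHS](Rintegral_prob_cst P 1); apply: le_Rintegral => //.
    by apply: (integrable_norm (icos _ _ _ mZ)).
  by apply: (@bounded_integrable _ _ _ _ _ 1) => // w; rewrite normr1.
pose I w : R := (X w < u)%R%:R.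
pose J w : R := (Y w < v)%R%:R.
have mI : measurable_fun setT I by exact: measurable_lt_indicator.
have mJ : measurable_fun setT J by exact: measurable_lt_indicator.
have I1 w : `|I w| <= 1 by rewrite /I; case: (_ < _)%R; rewrite ?normr1 ?normr0.
have J1 w : `|J w| <= 1 by rewrite /J; case: (_ < _)%R; rewrite ?normr1 ?normr0.
have iI := bounded_integrable P mI I1; have iJ := bounded_integrable P mJ J1.
have mul1 (f g : Omega -> R) : (forall w, `|f w| <= 1) -> (forall w, `|g w| <= 1) ->
    measurable_fun setT f -> measurable_fun setT g ->
    P.-integrable setT (EFin \o (fun w => f w * g w)).
  move=> f1 g1 mf mg; apply: (@bounded_integrable _ _ _ _ _ 1).
    exact: measurable_funM.
  by move=> w; rewrite normrM mulr_ile1.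
have cent (f g : Omega -> R) c : (forall w, `|f w| <= 1) -> (forall w, `|g w| <= 1) ->
    measurable_fun setT f -> measurable_fun setT g ->
    \int[P]_w (f w * (g w - c)) = \int[P]_w (f w * g w) - \int[P]_w f w * c.
  move=> f1 g1 mf mg; under eq_Rintegral do rewrite mulrBr.
  have i_f := bounded_integrable P mf f1.
  rewrite RintegralB ?RintegralZr//; first exact: mul1.
  exact: (integrableZr measurableT c i_f).
have V2 (g : Omega -> R) c w : `|g w| <= 1 -> `|c| <= 1 -> `|g w - c| <= 2.
  by move=> g1 c1; rewrite (le_trans (ler_normB _ _))// [leRHS]mulr2n lerD.
have step1 b e : \int[P]_w (I w * cos (b * Y w + e)) =
    \int[P]_w I w * \int[P]_w cos (b * Y w + e).
  set m := \int[P]_w cos _.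
  apply/eqP; rewrite -subr_eq0 -cent//; last exact: mcos.
  apply/eqP; apply: (@trig_determination _ _ _ P X _ 2 mX) => [|w|a c].
  - by apply: measurable_funB => //; exact: mcos.
  - by apply: (V2 (fun w => cos (b * Y w + e))) => //; exact: Icos.
  - rewrite (cent (fun w => cos (a * X w + c)) (fun w => cos (b * Y w + e)))//; [|exact: mcos..].
    by rewrite H subrr.
have step2 : \int[P]_w (J w * I w) = \int[P]_w J w * \int[P]_w I w.
  set m := \int[P]_w I w.
  have m1 : `|m| <= 1.
    apply: le_trans (le_normr_Rintegral measurableT iI) _.
    rewrite -[leRHS](Rintegral_prob_cst P 1); apply: le_Rintegral => //.
      exact: (integrable_norm iI).
    by apply: (@bounded_integrable _ _ _ _ _ 1) => // w; rewrite normr1.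
  apply/eqP; rewrite -subr_eq0 -cent//.
  apply/eqP; apply: (@trig_determination _ _ _ P Y _ 2 mY) => [|w|b e].
  - exact: measurable_funB.
  - exact: V2.
  - rewrite (cent (fun w => cos (b * Y w + e)) I)//; last exact: mcos.
    under eq_Rintegral do rewrite mulrC.
    by rewrite step1 mulrC subrr.
have mcU (Z : Omega -> R) z : measurable_fun setT Z -> measurable [set w | z <= Z w].
  move=> mZ; rewrite (_ : [set w | _] = ~` [set w | Z w < z]).
    by apply: measurableC; exact: measurable_lt_set.
  by apply/seteqP; split => w /=; rewrite ltNge; [move=> ->|case: (_ <= _)%R => // /(_ isT)].
have EX : fine (P [set w | u <= X w]) = 1 - \int[P]_w I w.
  rewrite -(@Rintegral_indicator _ _ _ P (fun w => u <= X w)); last exact: mcU.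
  rewrite -[in RHS](Rintegral_prob_cst P 1) -RintegralB//; last first.
    by apply: (@bounded_integrable _ _ _ _ _ 1) => // w; rewrite normr1.
  by apply: eq_Rintegral => w _; rewrite /I ltNge; case: (_ <= _)%R; rewrite /= ?subr0 ?subrr.
have EY : fine (P [set w | v <= Y w]) = 1 - \int[P]_w J w.
  rewrite -(@Rintegral_indicator _ _ _ P (fun w => v <= Y w)); last exact: mcU.
  rewrite -[in RHS](Rintegral_prob_cst P 1) -RintegralB//; last first.
    by apply: (@bounded_integrable _ _ _ _ _ 1) => // w; rewrite normr1.
  by apply: eq_Rintegral => w _; rewrite /J ltNge; case: (_ <= _)%R; rewrite /= ?subr0 ?subrr.
rewrite EX EY.
have -> : [set w | u <= X w] `&` [set w | v <= Y w] = [set w | (u <= X w) && (v <= Y w)].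
  by apply/seteqP; split => w /=; [move=> [-> ->]|move=> /andP[]].
rewrite -(@Rintegral_indicator _ _ _ P (fun w => (u <= X w) && (v <= Y w))); last first.
  rewrite (_ : [set w | _] = [set w | u <= X w] `&` [set w | v <= Y w]).
    by apply: measurableI; exact: mcU.
  by apply/seteqP; split => w /=; [move=> /andP[]|move=> [-> ->]].
transitivity (\int[P]_w ((1 - I w) * (1 - J w))).
  apply: eq_Rintegral => w _; rewrite /I /J !ltNge.
  by case: (_ <= _)%R; case: (_ <= _)%R; rewrite /= ?subr0 ?subrr ?mulr0 ?mul0r ?mulr1.
have i1 : P.-integrable setT (EFin \o (fun=> 1 : R)).
  by apply: (@bounded_integrable _ _ _ _ _ 1) => // w; rewrite normr1.
transitivity (\int[P]_w ((1 - I w) - (J w - J w * I w))).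
  by apply: eq_Rintegral => w _; ring.
have iJI := mul1 J I J1 I1 mJ mI.
rewrite RintegralB//; last 2 first.
- exact: (integrableB measurableT i1 iI).
- exact: (integrableB measurableT iJ iJI).
by rewrite !RintegralB// Rintegral_prob_cst step2; ring.
Qed.

Lemma gaussian_sin d (Omega : measurableType d) (R : realType)
  (P : probability Omega R) (Y : Omega -> R) (v : R) :
  centered_gaussian P Y v -> centered_gaussian P (fun w => - Y w) v ->
  \int[P]_w sin (Y w) = 0.
Proof.
move=> gY gNY.
have s1 (x : R) : `|sin x| <= 1 + `|x|.
  rewrite (@le_trans _ _ 1) ?lerDl//.
  by rewrite ler_norml sin_geN1 sin_le1.
by have [] := @gaussian_mean _ _ _ P Y v sin gY gNY
  (continuous_measurable_fun (@continuous_sin R)) s1 (fun x => sinN x).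
Qed.

(** The variance [a ^+ 2 + b ^+ 2] makes the expectation of [cos (a X + b Y)] a product, and the one
    of [sin] is 0 by symmetry, so phases only contribute factors [cos c]. A product of two cosines
    is half the sum of two such terms, for [b] and [- b]. *)
Lemma uncorrelated_gaussian_independent d (Omega : measurableType d) (R : realType)
  (P : probability Omega R) (X Y : Omega -> R) (u v : R) :
  (forall a b : R, centered_gaussian P (fun w => a * X w + b * Y w) (a ^+ 2 + b ^+ 2)) ->
  fine (P ([set w | u <= X w] `&` [set w | v <= Y w])) =
  fine (P [set w | u <= X w]) * fine (P [set w | v <= Y w]).
Proof.
move=> g.
have mZ a b : measurable_fun setT (fun w => a * X w + b * Y w) by case: (g a b) => _ [].
have mX : measurable_fun setT X.
  by have := mZ 1 0; under eq_fun do rewrite mul1r mul0r addr0.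
have mY : measurable_fun setT Y.
  by have := mZ 0 1; under eq_fun do rewrite mul1r mul0r add0r.
have cosE a b : \int[P]_w cos (a * X w + b * Y w) = expR (- (a ^+ 2 / 2)) * expR (- (b ^+ 2 / 2)).
  rewrite -expRD.
  pose s := Num.sqrt (a ^+ 2 + b ^+ 2).
  have s2 : s ^+ 2 = a ^+ 2 + b ^+ 2 by rewrite sqr_sqrtr// addr_ge0// sqr_ge0.
  have [s0|s0] := eqVneq s 0.
    move: s2; rewrite s0 expr0n/= => /esym/eqP.
    rewrite paddr_eq0 ?sqr_ge0// !sqrf_eq0 => /andP[/eqP -> /eqP ->].
    under eq_Rintegral do rewrite !mul0r addr0 cos0.
    by rewrite Rintegral_prob_cst expr0n/= mul0r oppr0 addr0 expR0.
  have gs := g (a / s) (b / s).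
  rewrite -(_ : 1 = (a / s) ^+ 2 + (b / s) ^+ 2) in gs; last first.
    by rewrite !expr_div_n -mulrDl -s2 divff// sqrf_eq0.
  rewrite -opprD -mulrDl -s2 -(gaussian_cos s gs).
  by apply: eq_Rintegral => w _; congr cos; field.
have sinE a b : \int[P]_w sin (a * X w + b * Y w) = 0.
  apply: (gaussian_sin (g a b)).
  have := g (- a) (- b); rewrite !sqrrN.
  by under eq_fun do rewrite !mulNr -opprD.
have iC (h : R -> R) a b : continuous h -> (forall x, `|h x| <= 1) ->
    P.-integrable setT (EFin \o (fun w => h (a * X w + b * Y w))).
  move=> ch h1; apply: (@bounded_integrable _ _ _ _ _ 1) => //.
  apply: (@measurableT_comp _ _ _ _ _ _ h) => //; exact: continuous_measurable_fun.
have c1 (x : R) : `|cos x| <= 1 by rewrite ler_norml cos_geN1 cos_le1.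
have s1 (x : R) : `|sin x| <= 1 by rewrite ler_norml sin_geN1 sin_le1.
have cosE3 a b c : \int[P]_w cos (a * X w + b * Y w + c) =
    expR (- (a ^+ 2 / 2)) * expR (- (b ^+ 2 / 2)) * cos c.
  under eq_Rintegral do rewrite cosD.
  have ic := iC _ a b (@continuous_cos R) c1; have isn := iC _ a b (@continuous_sin R) s1.
  rewrite RintegralB//; last 2 first.
  - exact: (integrableZr measurableT (cos c) ic).
  - exact: (integrableZr measurableT (sin c) isn).
  by rewrite !RintegralZr// cosE sinE mul0r subr0.
apply: cos_factor_independent => // a b c e.
have -> : \int[P]_w cos (a * X w + c) = expR (- (a ^+ 2 / 2)) * cos c.
  have := cosE3 a 0 c; under eq_Rintegral do rewrite mul0r addr0.
  by move=> ->; rewrite expr0n/= mul0r oppr0 expR0 mulr1.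
have -> : \int[P]_w cos (b * Y w + e) = expR (- (b ^+ 2 / 2)) * cos e.
  have := cosE3 0 b e; under eq_Rintegral do rewrite mul0r add0r.
  by move=> ->; rewrite expr0n/= mul0r oppr0 expR0 mul1r.
under eq_Rintegral do rewrite cos_mulcos.
have iC2 b' c' : P.-integrable setT (EFin \o (fun w => cos (a * X w + b' * Y w + c'))).
  apply: (iC (fun x => cos (x + c'))) => // x.
  by apply: continuous_comp; [apply: cvgD; [exact: cvg_id|exact: cvg_cst]|exact: continuous_cos].
transitivity (\int[P]_w (2^-1 * cos (a * X w + b * Y w + (c + e)) +
   2^-1 * cos (a * X w + (- b) * Y w + (c - e)))).
  apply: eq_Rintegral => w _; congr (_ * cos _ + _ * cos _); ring.
rewrite RintegralD//; last 2 first.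
- exact: (integrableZl measurableT _ (iC2 b (c + e))).
- exact: (integrableZl measurableT _ (iC2 (- b) (c - e))).
rewrite !RintegralZl// !cosE3 sqrrN cosD cosB.
by field.
Qed.

(** * Gaussian tails *)

Definition gauss_tail {R : realType} (x : R) : R :=
  fine (normal_prob 0 1 `[x, +oo[%classic).

Lemma normal_pdf_le (R : realType) (x : R) :
  normal_pdf 0 1 x <= expR (- (x ^+ 2 / 2)).
Proof.
rewrite normal_pdfE ?oner_eq0// /normal_fun subr0 expr1n mulNr.
have p2 : 1 <= (pi : R) *+ 2 by rewrite -mulr_natr; have := pi_ge2 R; lra.
rewrite ler_piMl ?expR_ge0// /normal_peak expr1n mul1r invf_le1 ?sqrtr_gt0; last first.
  by rewrite (lt_le_trans _ p2).
by rewrite -sqrtr1 ler_wsqrtr.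
Qed.

Lemma cvg_normal_pdf (R : realType) (s : R) : 0 < s ->
  normal_pdf 0 s y @[y --> +oo] --> (0 : R).
Proof.
move=> s0; rewrite normal_pdfE ?gt_eqF//.
rewrite -[X in _ --> X](mulr0 (normal_peak s)).
apply: cvgM; first exact: cvg_cst.
pose c := (Num.sqrt (s ^+ 2 *+ 2))^-1.
have s2 : 0 < s ^+ 2 *+ 2 by rewrite mulrn_wgt0// exprn_gt0.
rewrite (_ : normal_fun 0 s = gauss_fun \o (fun y => y * c)); last first.
  apply/funext => y; rewrite /normal_fun /gauss_fun/= subr0; congr expR.
  by rewrite mulNr exprMn exprVn sqr_sqrtr// ltW.
apply: (cvg_comp _ _ _ cvg_gauss_fun).
apply/gt0_cvgMly; last exact: cvg_id.
by rewrite invr_gt0 sqrtr_gt0.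
Qed.

(** On the tail the density is at most [y / x] times itself, which has the antiderivative
    [- (s ^+ 2 / x) * normal_pdf 0 s y]. *)
Lemma normal_tail_le (R : realType) (s x : R) : 0 < s -> 0 < x ->
  (normal_prob 0 s `[x, +oo[%classic <=
   (s / x * expR (- (x ^+ 2 / (2 * s ^+ 2))))%:E)%E.
Proof.
move=> s0 x0.
have cf : continuous (fun y : R => y / x * normal_pdf 0 s y).
  move=> y; apply: cvgM; last by apply: continuous_normal_pdf; rewrite gt_eqF.
  by apply: cvgM; [exact: cvg_id|exact: cvg_cst].
have dF (y : R) : is_derive y (1:R) (fun y => - (s ^+ 2 / x) * normal_pdf 0 s y)
    (y / x * normal_pdf 0 s y).
  have dn := is_derive_normal_pdf y (lt0r_neq0 s0).
  apply: is_derive_eq; rewrite /GRing.scale/=.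
  by field; rewrite !gt_eqF.
have FTC : (\int[lebesgue_measure]_(y in `[x, +oo[) (y / x * normal_pdf 0 s y)%:E =
    0%:E - (- (s ^+ 2 / x) * normal_pdf 0 s x)%:E)%E.
  apply: (@ge0_continuous_FTC2y _ _ (fun y => - (s ^+ 2 / x) * normal_pdf 0 s y)).
  - move=> y xy; rewrite mulr_ge0 ?normal_pdf_ge0// divr_ge0 ?(ltW x0)//.
    by rewrite (le_trans (ltW x0)).
  - exact: continuous_subspaceT.
  - rewrite -[X in _ --> X](mulr0 (- (s ^+ 2 / x))).
    by apply: cvgM; [exact: cvg_cst|exact: cvg_normal_pdf].
  - by move=> y _; exact: (@ex_derive _ _ _ _ _ _ _ (dF y)).
  - apply: cvg_at_right_filter; apply: cvgM; first exact: cvg_cst.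
    by apply: continuous_normal_pdf; rewrite gt_eqF.
  - by move=> y _; rewrite derive1E; exact: (@derive_val _ _ _ _ _ _ _ (dF y)).
rewrite /normal_prob.
apply: (@le_trans _ _ (\int[lebesgue_measure]_(y in `[x, +oo[) (y / x * normal_pdf 0 s y)%:E)%E).
  apply: ge0_le_integral => //.
  - by move=> y _; rewrite lee_fin normal_pdf_ge0.
  - by apply/measurable_EFinP; apply: measurable_funTS; exact: measurable_normal_pdf.
  - apply/measurable_EFinP; apply: measurable_funTS; exact: continuous_measurable_fun.
  - move=> y /=; rewrite in_itv/= andbT => xy; rewrite lee_fin ler_peMl ?normal_pdf_ge0//.
    by rewrite ler_pdivlMr// mul1r.
rewrite FTC -EFinB lee_fin sub0r mulNr opprK normal_pdfE ?gt_eqF//.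
rewrite /normal_fun subr0 mulNr -[s ^+ 2 *+ 2]mulr_natl mulrA ler_wpM2r ?expR_ge0//.
rewrite mulrAC ler_wpM2r ?invr_ge0 ?(ltW x0)//.
rewrite expr2 -mulrA ler_piMr ?(ltW s0)//.
have s20 : 0 < s ^+ 2 by rewrite exprn_gt0.
have p2 : s ^+ 2 <= s ^+ 2 * pi *+ 2.
  by rewrite -mulr_natr; have := pi_ge2 R; nra.
rewrite /normal_peak ler_pdivrMr ?mul1r; last by rewrite sqrtr_gt0 (lt_le_trans _ p2).
by rewrite -[leLHS]ger0_norm ?(ltW s0)// -sqrtr_sqr ler_wsqrtr.
Qed.

(** The bound increases with the variance, so an upper estimate [V] suffices. This includes the
    degenerate law, a Dirac mass at 0, which does not charge the tail. *)
Lemma gaussian_tail_le d (Omega : measurableType d) (R : realType)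
  (P : probability Omega R) (Y : Omega -> R) (v V x : R) :
  centered_gaussian P Y v -> v <= V -> 0 < V -> 0 < x ->
  fine (P [set w | x <= Y w]) <= Num.sqrt V / x * expR (- (x ^+ 2 / (2 * V))).
Proof.
move=> [v0 [mY YE]] vV V0 x0.
have := YE `[x, +oo[%classic (measurable_itv _).
have -> : Y @^-1` `[x, +oo[%classic = [set w | x <= Y w].
  by apply/seteqP; split => w /=; rewrite in_itv/= andbT.
move=> ->; case: ifPn => [_|vn0].
  rewrite diracE memNset/=; last by rewrite in_itv/= andbT leNgt x0.
  by rewrite mulr_ge0 ?expR_ge0// divr_ge0 ?(ltW x0)// sqrtr_ge0.
have vpos : 0 < v by rewrite lt_neqAle eq_sym vn0.
have s0 : 0 < Num.sqrt v by rewrite sqrtr_gt0.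
have H := normal_tail_le s0 x0.
apply: (@le_trans _ _ (Num.sqrt v / x * expR (- (x ^+ 2 / (2 * Num.sqrt v ^+ 2))))).
  rewrite -lee_fin fineK// fin_num_measure//; exact: measurable_itv.
rewrite sqr_sqrtr//; apply: ler_pM; rewrite ?divr_ge0 ?sqrtr_ge0 ?expR_ge0 ?(ltW x0)//.
  by rewrite ler_wpM2r ?invr_ge0 ?(ltW x0)// ler_wsqrtr.
rewrite ler_expR lerN2 ler_wpM2l ?sqr_ge0// lef_pV2 ?posrE ?mulr_gt0//.
by rewrite ler_pM2l.
Qed.

Lemma standard_gaussian_tail d (Omega : measurableType d) (R : realType)
  (P : probability Omega R) (Y : Omega -> R) (x : R) :
  centered_gaussian P Y 1 -> fine (P [set w | x <= Y w]) = gauss_tail x.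
Proof.
move=> [_ [mY YE]]; have := YE `[x, +oo[%classic (measurable_itv _).
have -> : Y @^-1` `[x, +oo[%classic = [set w | x <= Y w].
  by apply/seteqP; split => w /=; rewrite in_itv/= andbT.
by move=> ->; rewrite oner_eq0 sqrtr1.
Qed.

Lemma standard_gaussian_strict_tail d (Omega : measurableType d) (R : realType)
  (P : probability Omega R) (Y : Omega -> R) (x : R) :
  centered_gaussian P Y 1 -> fine (P [set w | x < Y w]) = gauss_tail x.
Proof.
move=> [_ [mY YE]]; have := YE `]x, +oo[%classic (measurable_itv _).
have -> : Y @^-1` `]x, +oo[%classic = [set w | x < Y w].
  by apply/seteqP; split => w /=; rewrite in_itv/= andbT.
move=> ->; rewrite oner_eq0 sqrtr1 /gauss_tail /normal_prob; congr fine.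
apply: integral_itv_obnd_cbnd; apply/measurable_EFinP; apply: measurable_funTS.
exact: measurable_normal_pdf.
Qed.

Lemma normal_prob_itv_bounds (R : realType) (a b m M : R) : a <= b ->
  (forall x, a <= x -> x <= b -> m <= normal_pdf 0 1 x <= M) ->
  m * (b - a) <= fine (normal_prob 0 1 `[a, b[%classic) <= M * (b - a).
Proof.
move=> ab H.
have fin : normal_prob 0 1 `[a, b[%classic \is a fin_num by apply: fin_num_measure; exact: measurable_itv.
have lE : (lebesgue_measure `[a, b[%classic = (b - a)%:E :> \bar R)%E.
  rewrite lebesgue_measure_itv/= lte_fin; case: ltP => //= ba.
  by rewrite (_ : b = a) ?subrr//; apply/eqP; rewrite eq_le ab ba.
have ic (k : R) : (\int[lebesgue_measure]_(x in `[a, b[%classic) k%:E = (k * (b - a))%:E)%E.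
  by rewrite integral_cst//= lE EFinM.
have ip : lebesgue_measure.-integrable `[a, b[%classic (EFin \o normal_pdf 0 1).
  apply: (integrableS measurableT _ (@subsetT _ _) (integrable_normal_pdf 0 1)).
  exact: measurable_itv.
have ik (k : R) : lebesgue_measure.-integrable `[a, b[%classic (EFin \o cst k).
  apply/integrableP; split; first by apply/measurable_EFinP.
  by rewrite [X in (X < _)%E](_ : _ = (`|k| * (b - a))%:E) ?ltry// -ic.
rewrite -!lee_fin fineK// /normal_prob -!ic; apply/andP; split.
  apply: le_integral => //; [exact: (ik m)|].
  move=> x; rewrite inE/= in_itv/= => /andP[ax xb].
  by rewrite lee_fin; have /andP[] := H x ax (ltW xb).
apply: le_integral => //; [exact: (ik M)|].
move=> x; rewrite inE/= in_itv/= => /andP[ax xb].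
by rewrite lee_fin; have /andP[] := H x ax (ltW xb).
Qed.

Lemma gauss_tail_split (R : realType) (a b : R) : a <= b ->
  gauss_tail a = fine (normal_prob 0 1 `[a, b[%classic) + gauss_tail b.
Proof.
move=> ab; rewrite /gauss_tail -fineD; last 2 first.
- by apply: fin_num_measure; exact: measurable_itv.
- by apply: fin_num_measure; exact: measurable_itv.
congr fine.
have -> : `[a, +oo[%classic = `[a, b[%classic `|` `[b, +oo[%classic :> set R.
  apply/seteqP; split => x /=; rewrite !in_itv/= !andbT.
    by move=> ax; case: (ltP x b) => xb; [left; rewrite ax|right].
  by move=> [/andP[]//|]; exact: le_trans.
apply: measureU; [exact: measurable_itv..|].
rewrite -subset0 => x /=; rewrite !in_itv/= andbT => -[/andP[_ xb] bx].
by move: xb; rewrite ltNge bx.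
Qed.

Lemma gauss_tail_ge0 (R : realType) (x : R) : 0 <= gauss_tail x.
Proof. by rewrite /gauss_tail fine_ge0. Qed.

Lemma gauss_tail_le (R : realType) (x : R) : 0 < x ->
  gauss_tail x <= x^-1 * expR (- (x ^+ 2 / 2)).
Proof.
move=> x0; have := normal_tail_le (@ltr01 R) x0.
rewrite expr1n mulr1 div1r -lee_fin /gauss_tail fineK//.
by apply: fin_num_measure; exact: measurable_itv.
Qed.

(** For [u >= 1] one has [(u + u^-1) ^+ 2 <= u ^+ 2 + 3], so on the interval from [u] to [u + u^-1]
    the density is at least this constant times [expR (- (u ^+ 2 / 2))]. The length [u^-1] of that
    interval supplies the other factor of the tail order. *)
Definition mills_constant {R : realType} : R := normal_peak 1 * expR (- (3 / 2)).

Lemma mills_constant_gt0 (R : realType) : 0 < mills_constant :> R.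
Proof. by rewrite mulr_gt0 ?expR_gt0// normal_peak_gt0// oner_eq0. Qed.

Lemma gauss_tail_ge (R : realType) (u : R) : 1 <= u ->
  mills_constant * (u^-1 * expR (- (u ^+ 2 / 2))) <= gauss_tail u.
Proof.
move=> u1; have u0 : 0 < u by rewrite (lt_le_trans _ u1).
have ui : 0 < u^-1 by rewrite invr_gt0.
have uu : u <= u + u^-1 by rewrite lerDl ltW.
rewrite (gauss_tail_split uu) ler_wpDr ?gauss_tail_ge0//.
pose m := mills_constant * expR (- (u ^+ 2 / 2)).
have bnd x : u <= x -> x <= u + u^-1 -> m <= normal_pdf 0 1 x <= normal_peak 1.
  move=> ux xu; rewrite normal_pdf_ub ?oner_eq0// andbT.
  rewrite normal_pdfE ?oner_eq0// /m /mills_constant -mulrA ler_wpM2l ?normal_peak_ge0//.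
  rewrite /normal_fun -expRD ler_expR subr0 expr1n.
  have ui1 : u^-1 <= 1 by rewrite invf_le1.
  have : x ^+ 2 <= (u + u^-1) ^+ 2 by rewrite lerXn2r// nnegrE ltW// ?addr_gt0// (lt_le_trans u0).
  have -> : (u + u^-1) ^+ 2 = u ^+ 2 + 2 + u^-1 ^+ 2 by field; rewrite gt_eqF.
  have : u^-1 ^+ 2 <= 1 by rewrite exprn_ile1// ltW.
  lra.
have /andP[H _] := normal_prob_itv_bounds uu bnd.
apply: le_trans H; rewrite (_ : u + u^-1 - u = u^-1); last by ring.
by rewrite /m mulrA mulrAC.
Qed.

(** The added mass lies on an interval of length [del] where the density is at most
    [expR 1 * expR (- (u ^+ 2 / 2))], since [(u - del) ^+ 2 >= u ^+ 2 - 2]; the lower bound on the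
    tail turns this into a relative error. *)
Lemma gauss_tail_shift (R : realType) (u del eta : R) :
  1 <= u -> 0 <= del -> u * del <= eta -> eta <= 1 ->
  gauss_tail (u - del) <= (1 + eta * (expR 1 / mills_constant)) * gauss_tail u.
Proof.
move=> u1 d0 udeta eta1; have u0 : 0 < u by rewrite (lt_le_trans _ u1).
have du : del <= u by nra.
have udu : u - del <= u by rewrite lerBlDr lerDl.
have mc := mills_constant_gt0 R.
rewrite (gauss_tail_split udu) mulrDl mul1r addrC lerD2l.
pose M := expR 1 * expR (- (u ^+ 2 / 2)).
have bnd x : u - del <= x -> x <= u -> 0 <= normal_pdf 0 1 x <= M.
  move=> ux xu; rewrite normal_pdf_ge0/= (le_trans (normal_pdf_le _))//.
  rewrite /M -expRD ler_expR.
  have : (u - del) ^+ 2 <= x ^+ 2 by rewrite lerXn2r// nnegrE ?subr_ge0// (le_trans _ ux)// subr_ge0.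
  by nra.
have /andP[_ H] := normal_prob_itv_bounds udu bnd.
apply: le_trans H _; rewrite opprB addrC subrK.
rewrite -mulrA; apply: (@le_trans _ _ (eta * (expR 1 * (u^-1 * expR (- (u ^+ 2 / 2)))))).
  rewrite /M mulrC (mulrCA (expR 1)) !mulrA ler_wpM2r ?expR_ge0// ler_wpM2r ?expR_ge0//.
  by rewrite ler_pdivlMr// mulrC.
rewrite ler_wpM2l//; first by rewrite (le_trans _ udeta)// mulr_ge0// ltW.
rewrite -[leRHS]mulrA ler_wpM2l ?expR_ge0// -ler_pdivrMl ?invr_gt0// invrK.
exact: gauss_tail_ge.
Qed.

(** * Joint tails of a Gaussian pair *)

(** A standard pair with correlation [rho], encoded by the laws of all linear combinations because
    the process hypothesis supplies joint laws in exactly this form. *)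
Definition gaussian_pair d (Omega : measurableType d) (R : realType)
  (P : probability Omega R) (Y Z : Omega -> R) (rho : R) : Prop :=
  forall a b : R, centered_gaussian P (fun w => a * Y w + b * Z w)
    (a ^+ 2 + b ^+ 2 + 2 * a * b * rho).

Section bivariate.
Variables (d : measure_display) (Omega : measurableType d) (R : realType).
Variables (P : probability Omega R) (Y Z : Omega -> R) (rho : R).
Hypothesis YZ : gaussian_pair P Y Z rho.

Let mYZ a b : measurable_fun setT (fun w => a * Y w + b * Z w).
Proof. by case: (YZ a b) => _ []. Qed.

Lemma gaussian_pair_measurablel : measurable_fun setT Y.
Proof. by have := mYZ 1 0; under eq_fun do rewrite mul1r mul0r addr0. Qed.

Lemma gaussian_pair_measurabler : measurable_fun setT Z.
Proof. by have := mYZ 0 1; under eq_fun do rewrite mul1r mul0r add0r. Qed.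

Let mY := gaussian_pair_measurablel.
Let mZ := gaussian_pair_measurabler.

Lemma gaussian_pair_standardl : centered_gaussian P Y 1.
Proof.
have := YZ 1 0; under eq_fun do rewrite mul1r mul0r addr0.
by rewrite (_ : _ + _ + _ = 1)//; ring.
Qed.

Lemma le_fine_probability (A B : set Omega) : measurable A -> measurable B ->
  A `<=` B -> fine (P A) <= fine (P B).
Proof.
by move=> mA mB AB; rewrite fine_le ?fin_num_measure// le_measure ?inE.
Qed.

Lemma measurable_superlevel_set (f : Omega -> R) (x : R) : measurable_fun setT f ->
  measurable [set w | x <= f w].
Proof.
move=> mf; rewrite (_ : [set w | _] = ~` [set w | f w < x]).
  by apply: measurableC; exact: measurable_lt_set.
by apply/seteqP; split => w /=; rewrite ltNge; [move=> ->|case: (_ <= _)%R => // /(_ isT)].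
Qed.

Lemma measurable_sublevel_set (f : Omega -> R) (x : R) : measurable_fun setT f ->
  measurable [set w | f w <= x].
Proof.
move=> mf; rewrite (_ : [set w | _] = ~` [set w | x < f w]).
  by apply: measurableC; exact: measurable_lt_set.
by apply/seteqP; split => w /=; rewrite ltNge; [move=> ->|case: (_ <= _)%R => // /(_ isT)].
Qed.

(* On the event one has [x <= Y + c (Y - Z)] with [x = u2 + c l / u]; the
   variance of the right-hand side barely exceeds 1. *)
Lemma upcrossing_bound (u u2 c l D : R) : 0 < u -> 1 <= c -> 0 <= l -> 0 <= D ->
  u / 2 <= u2 -> u2 <= u -> rho <= 1 -> (1 - rho) * c ^+ 2 <= D / u ^+ 2 -> 8 * D <= u ^+ 2 ->
  fine (P ([set w | Z w <= u2 - l / u] `&` [set w | u2 < Y w])) <=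
  3 / u * expR (- (u2 ^+ 2 / 2) + 2 * D - c * l / 4).
Proof.
move=> u0 c1 l0 D0 uu2 u2u rho1 rc Du.
have c0 : 0 < c by rewrite (lt_le_trans _ c1).
have u20 : 0 < u2 by rewrite (lt_le_trans _ uu2)// divr_gt0.
have uu : 0 < u ^+ 2 by rewrite exprn_gt0.
pose x := u2 + c * l / u.
have lu0 : 0 <= c * l / u by rewrite divr_ge0 ?mulr_ge0 ?(ltW u0) ?(ltW c0).
have x0 : 0 < x by rewrite ltr_wpDr.
pose q := D / u ^+ 2.
have q0 : 0 <= q by rewrite divr_ge0// ltW.
have q8 : 8 * q <= 1 by rewrite /q mulrA ler_pdivrMr// mul1r.
(* The variance equals [1 + 2 * c * (1 + c) * (1 - rho)], at most [1 + 4 * c ^+ 2 * (1 - rho)]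
   because [c >= 1]. *)
pose V := 1 + 4 * q.
have V0 : 0 < V by rewrite /V; lra.
have vV : (1 + c) ^+ 2 + (- c) ^+ 2 + 2 * (1 + c) * (- c) * rho <= V.
  have : 0 <= (1 - rho) * (c * (c - 1)).
    by rewrite mulr_ge0 ?subr_ge0// mulr_ge0 ?subr_ge0// ltW.
  by rewrite /V; move: rc; rewrite -/q; lra.
have T := gaussian_tail_le (YZ (1 + c) (- c)) vV V0 x0.
apply: (@le_trans _ _ (fine (P [set w | x <= (1 + c) * Y w + - c * Z w]))).
  apply: le_fine_probability.
  - by apply: measurableI; [exact: measurable_sublevel_set|exact: measurable_lt_set].
  - exact: measurable_superlevel_set.
  move=> w /= [Zu uY].
  have : c * (u2 - (u2 - l / u)) <= c * (Y w - Z w).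
    by rewrite ler_wpM2l ?(ltW c0)//; lra.
  rewrite opprB addrC subrK /x -mulrA => ?; lra.
apply: (le_trans T).
have x2 : u2 ^+ 2 + c * l <= x ^+ 2.
  have -> : x ^+ 2 = u2 ^+ 2 + 2 * (u2 / u) * (c * l) + (c * l / u) ^+ 2.
    by rewrite /x; field; rewrite gt_eqF.
  have : 2^-1 <= u2 / u by rewrite ler_pdivlMr// mulrC.
  have : 0 <= c * l by rewrite mulr_ge0// ltW.
  by have := sqr_ge0 (c * l / u); nra.
apply: ler_pM; rewrite ?divr_ge0 ?sqrtr_ge0 ?expR_ge0 ?(ltW x0)//.
  have sV : Num.sqrt V <= 3 / 2.
    rewrite -[leRHS]ger0_norm ?divr_ge0// -sqrtr_sqr ler_wsqrtr// /V; lra.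
  apply: (@le_trans _ _ ((3 / 2) / (u / 2))); last first.
    by rewrite (_ : 3 / 2 / (u / 2) = 3 / u)//; field; rewrite gt_eqF.
  apply: ler_pM; rewrite ?sqrtr_ge0 ?invr_ge0 ?(ltW x0)//.
  rewrite lef_pV2 ?posrE ?divr_gt0//.
  by rewrite (le_trans uu2)// lerDl.
rewrite ler_expR.
(* Since [1 / V >= 1 - 4 * q], the exponent loses at most [2 * u2 ^+ 2 * q <= 2 * D], and
   [8 * q <= 1] preserves half of the gain [c * l / 2]. *)
have H : (u2 ^+ 2 + c * l) * (1 - 4 * q) <= x ^+ 2 / V.
  rewrite ler_pdivlMr// -mulrA (le_trans _ x2)// ler_piMr//.
    by rewrite addr_ge0 ?sqr_ge0// mulr_ge0// ltW.
  by rewrite /V; nra.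
have -> : x ^+ 2 / (2 * V) = x ^+ 2 / V / 2 by field; rewrite gt_eqF.
have u2q : u2 ^+ 2 * q <= D.
  rewrite /q mulrC -mulrA ler_piMr// mulrC ler_pdivrMr// mul1r.
  by rewrite lerXn2r// nnegrE ltW.
have cl0 : 0 <= c * l by rewrite mulr_ge0// ltW.
have : c * l * (8 * q) <= c * l by rewrite ler_piMr.
by lra.
Qed.

(** Both values above [u] force the sum above [2 * u], and its variance is at most [4 - 2 * tau].
    The extra decay comes from [1 / (2 - tau) >= 1 / 2 + tau / 4]. *)
Lemma joint_tail_near (u tau : R) : 0 < u -> 0 <= tau <= 1 -> rho <= 1 - tau ->
  fine (P ([set w | u < Y w] `&` [set w | u < Z w])) <=
  u^-1 * expR (- (u ^+ 2 / 2)) * expR (- (tau * u ^+ 2 / 4)).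
Proof.
move=> u0 /andP[t0 t1] rt.
pose V := 4 - 2 * tau.
have V0 : 0 < V by rewrite /V; lra.
have vV : 1 ^+ 2 + 1 ^+ 2 + 2 * 1 * 1 * rho <= V by rewrite /V; lra.
have u20 : 0 < 2 * u by rewrite mulr_gt0.
have T := gaussian_tail_le (YZ 1 1) vV V0 u20.
apply: (@le_trans _ _ (fine (P [set w | 2 * u <= 1 * Y w + 1 * Z w]))).
  apply: le_fine_probability.
  - by apply: measurableI; exact: measurable_lt_set.
  - exact: measurable_superlevel_set.
  by move=> w /= [? ?]; lra.
apply: (le_trans T); rewrite -[leRHS]mulrA -expRD.
apply: ler_pM; rewrite ?divr_ge0 ?sqrtr_ge0 ?expR_ge0 ?(ltW u20)//.
  rewrite invfM mulrA ler_piMl ?invr_ge0 ?(ltW u0)// ler_pdivrMr// mul1r.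
  rewrite -[leRHS]ger0_norm// -sqrtr_sqr ler_wsqrtr// /V; lra.
rewrite ler_expR -opprD lerN2.
have -> : (2 * u) ^+ 2 / (2 * V) = u ^+ 2 / (2 - tau).
  by rewrite /V; field; do ?[apply/andP; split]; rewrite gt_eqF//; lra.
rewrite ler_pdivlMr; last by lra.
by have := sqr_ge0 (tau * u); nra.
Qed.

(** Regression: [W], the normalised [Z - rho * Y], is independent of [Y]. While [Y < 2 * u], the
    term [rho * Y] lowers the level required of [W] by at most [2 * k * u], which [gauss_tail_shift]
    shows to be a small relative change. The event [Y >= 2 * u] is counted apart. *)
Lemma joint_tail_far (u eta : R) : 1 <= u -> eta <= 1 ->
  2 * `|rho| * u ^+ 2 <= eta ->
  fine (P ([set w | u < Y w] `&` [set w | u < Z w])) <=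
  (1 + eta * (expR 1 / mills_constant)) * gauss_tail u ^+ 2 + gauss_tail (2 * u).
Proof.
move=> u1 eta1 ru; have u0 : 0 < u by rewrite (lt_le_trans _ u1).
pose k : R := `|rho|.
have k0 : 0 <= k by exact: normr_ge0.
have u21 : 1 <= u ^+ 2 by rewrite exprn_ege1.
have k2 : 2 * k <= 1 by rewrite -/k in ru; nra.
have rho2 : 0 < 1 - rho ^+ 2.
  rewrite -[rho ^+ 2]ger0_norm ?sqr_ge0// normrX -/k; nra.
pose s := Num.sqrt (1 - rho ^+ 2).
have s0 : 0 < s by rewrite sqrtr_gt0.
have s2 : s ^+ 2 = 1 - rho ^+ 2 by rewrite sqr_sqrtr// ltW.
have s1 : s <= 1 by rewrite -sqrtr1 ler_wsqrtr// lerBlDr lerDl sqr_ge0.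
pose W w := (Z w - rho * Y w) / s.
have gW a b : centered_gaussian P (fun w => a * Y w + b * W w) (a ^+ 2 + b ^+ 2).
  have := YZ (a - b * rho / s) (b / s).
  rewrite (_ : (fun w => _) = (fun w => a * Y w + b * W w)); last first.
    by apply/funext => w; rewrite /W; field; rewrite gt_eqF.
  rewrite (_ : _ + _ + _ = a ^+ 2 + b ^+ 2)//.
  transitivity (a ^+ 2 + b ^+ 2 * (1 - rho ^+ 2) / s ^+ 2).
    by field; rewrite gt_eqF.
  by rewrite -s2 mulfK// gt_eqF// exprn_gt0.
have mW : measurable_fun setT W.
  apply: measurable_funM => //; apply: measurable_funB => //.
  exact: measurable_funM.
have gW1 : centered_gaussian P W 1.
  have := gW 0 1; rewrite expr0n expr1n/= add0r.
  by under eq_fun do rewrite mul0r mul1r add0r.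
have I := uncorrelated_gaussian_independent u (u - 2 * k * u) gW.
have mA : measurable ([set w | u <= Y w] `&` [set w | u - 2 * k * u <= W w]).
  by apply: measurableI; exact: measurable_superlevel_set.
have mB : measurable [set w | 2 * u <= Y w] by exact: measurable_superlevel_set.
apply: (@le_trans _ _ (fine (P (([set w | u <= Y w] `&` [set w | u - 2 * k * u <= W w]) `|`
    [set w | 2 * u <= Y w])))).
  apply: le_fine_probability.
  - by apply: measurableI; exact: measurable_lt_set.
  - exact: measurableU.
  move=> w /= [uY uZ]; have [Y2|Y2] := leP (2 * u) (Y w); [by right|left].
  split; first exact: ltW.
  have rY : rho * Y w <= 2 * k * u.
    rewrite (le_trans (ler_norm _))// normrM -/k (@ger0_norm _ (Y w)) ?(le_trans _ (ltW uY)) ?(ltW u0)//.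
    by rewrite -mulrA mulrCA ler_wpM2l// ltW.
  have z0 : 0 <= Z w - rho * Y w by nra.
  rewrite /W (@le_trans _ _ (Z w - rho * Y w))//; first by nra.
  by rewrite ler_peMr// invf_ge1.
apply: (@le_trans _ _ (fine (P ([set w | u <= Y w] `&` [set w | u - 2 * k * u <= W w])) +
   fine (P [set w | 2 * u <= Y w]))).
  rewrite -fineD ?fin_num_measure// fine_le ?fin_num_measure//.
  - exact: measurableU.
  - by rewrite fin_numD !fin_num_measure.
  - exact: measureU2.
rewrite I !(standard_gaussian_tail _ gaussian_pair_standardl) (standard_gaussian_tail _ gW1).
rewrite lerD2r expr2 mulrA mulrC ler_wpM2r ?gauss_tail_ge0//.
apply: gauss_tail_shift => //; first by rewrite !mulr_ge0// ltW.
by rewrite (_ : u * (2 * k * u) = 2 * k * u ^+ 2)//; ring.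
Qed.

End bivariate.

(** * Correlation of a stationary Gaussian process *)

Section gaussian_process.
Variables (d : measure_display) (Omega : measurableType d) (R : realType).
Variables (P : probability Omega R) (X : R -> Omega -> R) (r : R -> R).
Hypothesis gX : centered_gaussian_process P X.
Hypothesis statX : forall s t : R, 0 <= s -> 0 <= t ->
  covariance P (X s) (X (s + t)) = (r t)%:E.

Lemma process_combination2 (s t a b : R) : 0 <= s -> 0 <= t ->
  exists v, centered_gaussian P (fun w => a * X s w + b * X t w) v.
Proof.
move=> s0 t0.
have [i|v gv] := gX (n := 2) (t := fun i : 'I_2 => if i == ord0 then s else t)
  (fun i : 'I_2 => if i == ord0 then a else b).
  by case: ifP.
by exists v; move: gv; under eq_fun do rewrite !big_ord_recl big_ord0 addr0/=.
Qed.

Lemma process_gaussian (t : R) : 0 <= t -> exists v, centered_gaussian P (X t) v.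
Proof.
move=> t0; have [v gv] := process_combination2 1 0 t0 t0.
by exists v; move: gv; under eq_fun do rewrite mul1r mul0r addr0.
Qed.

Lemma process_measurable (t : R) : 0 <= t -> measurable_fun setT (X t).
Proof. by move=> /process_gaussian[v [_ []]]. Qed.

Lemma process_mean (t : R) : 0 <= t ->
  P.-integrable setT (fun w => (X t w)%:E) /\ \int[P]_w X t w = 0.
Proof.
move=> t0; have [v gv] := process_gaussian t0.
have [v' gv'] : exists v', centered_gaussian P (fun w => - X t w) v'.
  have [v' gv'] := process_combination2 (- 1) 0 t0 t0.
  by exists v'; move: gv'; under eq_fun do rewrite mulN1r mul0r addr0.
have [_ E1] := gaussian_second_moment gv.
have [_ E2] := gaussian_second_moment gv'.
have vv' : v' = v by rewrite -E1 -E2; apply: eq_Rintegral => w _; rewrite sqrrN.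
rewrite vv' in gv'.
apply: (@gaussian_mean _ _ _ P (X t) v id gv gv') => // x.
by rewrite lerDr.
Qed.

Lemma process_product_integrable (s t : R) : 0 <= s -> 0 <= t ->
  P.-integrable setT (fun w => (X s w * X t w)%:E).
Proof.
move=> s0 t0.
have [v /gaussian_second_moment[i1 _]] := process_gaussian s0.
have [v' /gaussian_second_moment[i2 _]] := process_gaussian t0.
have i3 := integrableD measurableT i1 i2.
apply: le_integrable i3 => //.
  apply/measurable_EFinP/measurable_funM; exact: process_measurable.
move=> w _ /=; rewrite lee_fin normrM [leRHS]ger0_norm ?addr_ge0 ?sqr_ge0//.
rewrite -[X s w ^+ 2]ger0_norm ?sqr_ge0// -[X t w ^+ 2]ger0_norm ?sqr_ge0// !normrX.
have := sqr_ge0 (`|X s w| - `|X t w|); have := normr_ge0 (X s w); have := normr_ge0 (X t w).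
by nra.
Qed.

Lemma process_product (s h : R) : 0 <= s -> 0 <= h ->
  \int[P]_w (X s w * X (s + h) w) = r h.
Proof.
move=> s0 h0.
have sh0 : 0 <= s + h by rewrite addr_ge0.
have := statX s0 h0; rewrite covariance.unlock.
have [_ E1] := process_mean s0; have [_ E2] := process_mean sh0.
have F1 : fine 'E_P[X s]%E = 0 by rewrite expectation.unlock; exact: E1.
have F2 : fine 'E_P[X (s + h)]%E = 0 by rewrite expectation.unlock; exact: E2.
rewrite F1 F2 expectation.unlock => H.
rewrite /Rintegral -[RHS]/(fine (r h)%:E) -H; congr fine; apply: eq_integral => w _.
transitivity (((X s w - 0) * (X (s + h) w - 0))%:E) => //.
by rewrite !subr0.
Qed.

Lemma process_pair_variance (s h a b : R) : 0 <= s -> 0 <= h ->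
  centered_gaussian P (fun w => a * X s w + b * X (s + h) w)
    (a ^+ 2 * r 0 + b ^+ 2 * r 0 + 2 * a * b * r h).
Proof.
move=> s0 h0; have sh0 : 0 <= s + h by rewrite addr_ge0.
have [v gv] := process_combination2 a b s0 sh0.
have [_ Ev] := gaussian_second_moment gv.
suff <- : v = a ^+ 2 * r 0 + b ^+ 2 * r 0 + 2 * a * b * r h by [].
rewrite -Ev.
have i11 := process_product_integrable s0 s0.
have i22 := process_product_integrable sh0 sh0.
have i12 := process_product_integrable s0 sh0.
have e11 := process_product s0 (lexx 0); rewrite addr0 in e11.
have e22 := process_product sh0 (lexx 0); rewrite addr0 in e22.
have e12 := process_product s0 h0.
transitivity (\int[P]_w ((a ^+ 2 * (X s w * X s w) + b ^+ 2 * (X (s + h) w * X (s + h) w)) +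
   (2 * a * b) * (X s w * X (s + h) w))).
  by apply: eq_Rintegral => w _; ring.
have j11 := integrableZl measurableT (a ^+ 2) i11.
have j22 := integrableZl measurableT (b ^+ 2) i22.
have j12 := integrableZl measurableT (2 * a * b) i12.
rewrite RintegralD//; last exact: (integrableD measurableT j11 j22).
by rewrite RintegralD// !RintegralZl// e11 e22 e12.
Qed.

Lemma process_correlation_le (h : R) : 0 <= h -> r h <= r 0.
Proof.
move=> h0; have [+ _] := process_pair_variance 1 (- 1) (lexx 0) h0.
by rewrite expr1n sqrrN expr1n; lra.
Qed.

Lemma process_increment_cos (s h : R) : 0 <= s -> 0 <= h ->
  \int[P]_w cos (X (s + h) w - X s w) = expR (- (r 0 - r h)).
Proof.
move=> s0 h0; have sh0 : 0 <= s + h by rewrite addr_ge0.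
pose v := 2 * (r 0 - r h).
have v0 : 0 <= v by rewrite mulr_ge0// subr_ge0 process_correlation_le.
have [vz|vn0] := eqVneq v 0.
  have -> : r 0 - r h = 0 by move: vz; rewrite /v; lra.
  have gY := process_pair_variance (- 1) 1 s0 h0.
  rewrite (_ : _ + _ + _ = 0) in gY; last by move: vz; rewrite /v; lra.
  have [_ [mY YE]] := gY.
  rewrite oppr0 expR0 -[RHS](Rintegral_prob_cst P 1) /Rintegral; congr fine.
  apply: ae_eq_integral => //.
    apply/measurable_EFinP; apply: (@measurableT_comp _ _ _ _ _ _ cos).
      exact: continuous_measurable_fun (@continuous_cos R).
    by apply: measurable_funB; exact: process_measurable.
  exists ((fun w => -1 * X s w + 1 * X (s + h) w) @^-1` (~` [set 0])); split.
  - by rewrite -[_ @^-1` _]setTI; apply: mY => //; apply: measurableC.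
  - have := YE (~` [set 0]) (measurableC (measurable_set1 0)).
    by rewrite eqxx diracE memNset//= => H; exact: H.
  - move=> w /= H Y0; apply: H => _ /=; congr EFin.
    rewrite (_ : _ - _ = -1 * X s w + 1 * X (s + h) w); last by ring.
    by rewrite Y0 cos0.
have vpos : 0 < v by rewrite lt_neqAle eq_sym vn0.
pose q := Num.sqrt v.
have q0 : 0 < q by rewrite sqrtr_gt0.
have q2 : q ^+ 2 = v by rewrite sqr_sqrtr.
have gY := process_pair_variance (- q^-1) q^-1 s0 h0.
rewrite (_ : _ + _ + _ = 1) in gY; last first.
  transitivity (v / q ^+ 2); first by rewrite /v; field; rewrite gt_eqF.
  by rewrite q2 divff.
have -> : - (r 0 - r h) = - (q ^+ 2 / 2) by rewrite q2 /v; field.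
rewrite -(gaussian_cos q gY); apply: eq_Rintegral => w _; congr cos.
by field; rewrite gt_eqF.
Qed.

(** The limit of [r] at [0^'+] says nothing about [r 0]. By path continuity and bounded convergence,
    the expectation of [cos (X h - X 0)] tends to 1; it equals [expR (- (r 0 - r h))], which tends
    to [expR (- (r 0 - 1))]. *)
Lemma process_variance_eq1 (N : set Omega) :
  measurable N -> P N = 0%E ->
  (forall w, ~ N w -> {within `[0, +oo[, continuous (fun s => X s w)}) ->
  (forall eps : R, 0 < eps -> \forall t \near 0^'+, `|r t - 1| <= eps) -> r 0 = 1.
Proof.
move=> mN PN cX r1.
pose h (n : nat) : R := n.+1%:R^-1.
have h0 n : 0 < h n by rewrite invr_gt0.
have hc : h n @[n --> \oo] --> (0 : R) by exact: cvg_harmonic.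
have r1c : r t @[t --> 0^'+] --> (1 : R).
  by apply/cvgrPdist_le => eps eps0; have := r1 _ eps0; apply: filterS => t; rewrite distrC.
have rh : r (h n) @[n --> \oo] --> (1 : R).
  by move/cvg_at_rightP : r1c; apply.
have e1 : expR (- (r 0 - r (h n))) @[n --> \oo] --> expR (- (r 0 - 1)).
  apply: continuous_cvg; first exact: continuous_expR.
  by apply: cvgN; apply: cvgB => //; exact: cvg_cst.
(* The value 1 on [N] makes the convergence hold at every point and leaves the integrals
   unchanged. *)
pose f n w : R := if w \in N then 1 else cos (X (h n) w - X 0 w).
have mf0 n : measurable_fun setT (fun w => cos (X (h n) w - X 0 w)).
  apply: (@measurableT_comp _ _ _ _ _ _ cos).
    exact: continuous_measurable_fun (@continuous_cos R).
  by apply: measurable_funB; apply: process_measurable => //; exact: ltW.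
have mf n : measurable_fun setT (f n).
  apply: measurable_fun_ifT => //.
  apply: (measurable_fun_bool true) => //.
  rewrite setTI (_ : _ @^-1` _ = N)//.
  by apply/seteqP; split => w /=; [exact: set_mem|move=> Nw; exact: mem_set].
have L : \int[P]_w f n w @[n --> \oo] --> \int[P]_w (1 : R).
  apply: (@bounded_cvg_Rintegral _ _ _ _ _ _ 1) => //.
    by move=> n w; rewrite /f; case: ifP => _; rewrite ?normr1// ler_norml cos_geN1 cos_le1.
  move=> w; rewrite /f; case: (boolP (w \in N)) => wN; first exact: cvg_cst.
  rewrite -[X in _ --> X](@cos0 R); apply: continuous_cvg; first exact: continuous_cos.
  rewrite -[X in _ --> X](subrr (X 0 w)); apply: cvgB; last exact: cvg_cst.
  have /continuous_within_itvcyP[_] := cX w (fun H => negP wN (mem_set H)).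
  by move/cvg_at_rightP; apply.
have fE n : \int[P]_w f n w = expR (- (r 0 - r (h n))).
  rewrite -(process_increment_cos (lexx 0) (ltW (h0 n))) add0r /Rintegral; congr fine.
  apply: ae_eq_integral => //; [exact/measurable_EFinP|exact/measurable_EFinP|].
  exists N; split => // w /=; apply: contra_notP => wN _.
  by rewrite /f memNset.
rewrite (funext fE) Rintegral_prob_cst in L.
have : expR (- (r 0 - 1)) = 1 by exact: (cvg_unique _ e1 L).
move/(congr1 (@ln R)); rewrite expRK ln1 => /eqP.
by rewrite oppr_eq0 subr_eq0 => /eqP.
Qed.

Section unit_variance.
Hypothesis r01 : r 0 = 1.

Lemma process_gaussian_pair (s h : R) : 0 <= s -> 0 <= h ->
  gaussian_pair P (X s) (X (s + h)) (r h).
Proof.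
by move=> s0 h0 a b; have := process_pair_variance a b s0 h0; rewrite r01 !mulr1.
Qed.

Lemma process_gaussian_pairC (s h : R) : 0 <= s -> 0 <= h ->
  gaussian_pair P (X (s + h)) (X s) (r h).
Proof.
move=> s0 h0 a b; have := process_pair_variance b a s0 h0; rewrite r01 !mulr1.
rewrite [b ^+ 2 + _]addrC (mulrAC 2 b a).
by under eq_fun do rewrite addrC.
Qed.

(** The difference is the expectation of [X 0] times an increment of variance [2 * (1 - r k)]; a
    product [A * B] is at most [lam / 2 * A ^+ 2 + B ^+ 2 / (2 * lam)] in absolute value. With [lam]
    small this gives continuity of [r] away from 0. *)
Lemma correlation_increment (t k lam : R) : 0 <= t -> 0 <= k -> 0 < lam ->
  `|r (t + k) - r t| <= lam / 2 + (1 - r k) / lam.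
Proof.
move=> t0 k0 lam0; have tk0 : 0 <= t + k by rewrite addr_ge0.
have e1 := process_product (lexx 0) tk0; have e2 := process_product (lexx 0) t0.
rewrite !add0r in e1 e2.
have i1 := process_product_integrable (lexx 0) tk0.
have i2 := process_product_integrable (lexx 0) t0.
have iB := integrableB measurableT i1 i2.
have [j1 f1] := gaussian_second_moment (process_pair_variance (- 1) 1 t0 k0).
have i00 := process_product_integrable (lexx 0) (lexx 0).
have e00 := process_product (lexx 0) (lexx 0); rewrite addr0 in e00.
have m1 := integrableZl measurableT (lam / 2) i00.
have m2 := integrableZl measurableT (2 * lam)^-1 j1.
rewrite -e1 -e2 -RintegralB//.
apply: (le_trans (le_normr_Rintegral measurableT iB)).
have -> : lam / 2 + (1 - r k) / lam = \int[P]_w (lam / 2 * (X 0 w * X 0 w) +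
    (2 * lam)^-1 * (-1 * X t w + 1 * X (t + k) w) ^+ 2).
  rewrite RintegralD// !RintegralZl// f1 e00 r01.
  by field; rewrite gt_eqF.
apply: le_Rintegral => //.
- exact: (integrable_norm iB).
- exact: (integrableD measurableT m1 m2).
move=> w _; rewrite -mulrBr normrM.
rewrite (_ : -1 * X t w + 1 * X (t + k) w = X (t + k) w - X t w); last by ring.
set A := X 0 w; set B := X (t + k) w - X t w.
rewrite -[A * A]ger0_norm -?expr2 ?sqr_ge0// -[B ^+ 2]ger0_norm ?sqr_ge0// !normrX.
have : 0 <= (2 * lam)^-1 * (lam * `|A| - `|B|) ^+ 2.
  by rewrite mulr_ge0 ?sqr_ge0// invr_ge0 mulr_ge0// ltW.
rewrite (_ : (2 * lam)^-1 * (lam * `|A| - `|B|) ^+ 2 =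
  lam / 2 * `|A| ^+ 2 + (2 * lam)^-1 * `|B| ^+ 2 - `|A| * `|B|).
  by rewrite subr_ge0.
by field; rewrite gt_eqF.
Qed.

Hypothesis r1 : forall eps : R, 0 < eps -> \forall t \near 0^'+, `|r t - 1| <= eps.

Lemma correlation_uniform_continuous (eps : R) : 0 < eps ->
  exists2 kap, 0 < kap & forall t k, 0 <= t -> 0 <= k -> k < kap ->
    `|r (t + k) - r t| <= eps.
Proof.
move=> e0; have e20 : 0 < eps ^+ 2 / 2 by rewrite divr_gt0// exprn_gt0.
have [kap /= kap0 H] := r1 e20.
exists kap => // t k t0; rewrite le_eqVlt => /predU1P[<- _|k0 kk].
  by rewrite addr0 subrr normr0 ltW.
apply: le_trans (correlation_increment t0 (ltW k0) e0) _.
have : `|r k - 1| <= eps ^+ 2 / 2.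
  by apply: H => //=; rewrite sub0r normrN gtr0_norm.
rewrite distrC => /(le_trans (ler_norm _)) h.
rewrite {3}(splitr eps) lerD2l ler_pdivrMr// (le_trans h)//.
by rewrite expr2 mulrAC.
Qed.

(** (A2) is only pointwise. Once [ln t >= 1], (A3) bounds [r] by [2^-1] for large [t]; on the
    remaining compact interval the continuous [r] attains its maximum, which is below 1. *)
Lemma correlation_sup (del : R) : 0 < del ->
  (forall t, 0 < t -> r t < 1) -> (fun t => r t * ln t) @ +oo --> (0 : R) ->
  exists2 eta, 0 < eta <= 1 & forall t, del <= t -> r t <= 1 - eta.
Proof.
move=> d0 r_lt1 rln.
have [T0 [T0r T0H]] : \forall t \near +oo, r t <= 2^-1.
  have h2 : (0 : R) < 2^-1 by rewrite invr_gt0.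
  have [M [Mr MH]] := (cvgr0_norm_le _ rln) _ h2.
  exists (Num.max M (expR 1)); split; first by rewrite num_real.
  move=> t; rewrite gt_max => /andP[Mt et].
  have lt1 : 1 <= ln t.
    rewrite -(expRK 1) ler_ln ?posrE ?expR_gt0 ?(ltW et)//.
    by rewrite (lt_trans _ et)// expR_gt0.
  have := MH t Mt; rewrite normrM (@ger0_norm _ (ln t)) ?(le_trans _ lt1)// => h.
  rewrite (le_trans (ler_norm _))// (le_trans _ h)// ler_peMr//.
pose b := Num.max (T0 + 1) del.
have db : del <= b by rewrite le_max lexx orbT.
have cr : {within `[del, b], continuous r}.
  apply: continuous_in_subspaceT => x; rewrite inE/= in_itv/= => /andP[dx _].
  have x0 : 0 < x by rewrite (lt_le_trans d0).
  apply/cvgrPdist_le => eps e0.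
  have [kap k0 H] := correlation_uniform_continuous e0.
  near=> y.
  have y0 : 0 < y by near: y; exact: lt_nbhsr.
  have xy : `|x - y| < kap by near: y; exact: cvgr_dist_lt.
  have [xley|yltx] := leP x y.
    rewrite distrC -{1}(subrKC x y); apply: H; rewrite ?(ltW x0) ?subr_ge0//.
    by rewrite distrC in xy; rewrite (le_lt_trans _ xy)// ler_norm.
  rewrite -{1}(subrKC y x); apply: H; rewrite ?(ltW y0) ?subr_ge0 ?(ltW yltx)//.
  by rewrite (le_lt_trans _ xy)// ler_norm.
have [c /[!in_itv]/= /andP[dc _] cmax] := EVT_max db cr.
have rc : r c < 1 by apply: r_lt1; rewrite (lt_le_trans d0).
exists (Num.min (1 - r c) 2^-1).
  by rewrite lt_min subr_gt0 rc invr_gt0 ltr0n/= ge_min invf_le1// ler1n orbT.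
move=> t dt; have [tb|bt] := leP t b.
  rewrite lerBrDr -lerBrDl ge_min lerD2l lerN2 cmax//.
  by rewrite in_itv/= dt tb.
rewrite lerBrDr -lerBrDl ge_min; apply/orP; right.
have : r t <= 2^-1.
  by apply: T0H; rewrite (lt_trans _ bt)// lt_max ltrDl ltr01.
by lra.
Unshelve. all: end_near. Qed.

End unit_variance.

End gaussian_process.

(** * Chaining over one Pickands step *)

Lemma fine_measure_bigsetU_le d (Omega : measurableType d) (R : realType)
  (P : probability Omega R) (A : nat -> set Omega) (n : nat) (b : nat -> R) :
  (forall i, measurable (A i)) -> (forall i, (i < n)%N -> fine (P (A i)) <= b i) ->
  fine (P (\big[setU/set0]_(i < n) A i)) <= \sum_(i < n) b i.
Proof.
move=> mA; elim: n => [|n IH] Ab; first by rewrite !big_ord0 measure0.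
rewrite !big_ord_recr/=.
have mU : measurable (\big[setU/set0]_(i < n) A i) by exact: bigsetU_measurable.
apply: (@le_trans _ _ (fine (P (\big[setU/set0]_(i < n) A i)) + fine (P (A n)))).
  rewrite -fineD ?fin_num_measure// fine_le ?fin_num_measure//.
  - exact: measurableU.
  - by rewrite fin_numD !fin_num_measure.
  - exact: measureU2.
by rewrite lerD ?Ab// IH// => i ni; rewrite Ab// ltnW.
Qed.

Lemma fine_measureU_le d (Omega : measurableType d) (R : realType)
  (P : probability Omega R) (A B : set Omega) : measurable A -> measurable B ->
  fine (P (A `|` B)) <= fine (P A) + fine (P B).
Proof.
move=> mA mB; rewrite -fineD ?fin_num_measure// fine_le ?fin_num_measure//.
- exact: measurableU.
- by rewrite fin_numD !fin_num_measure.
- exact: measureU2.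
Qed.

Lemma expRN_le_powV (R : realType) (m : nat) (x : R) : 0 < x ->
  expR (- x) <= (m.+1)`!%:R / x ^+ m.+1.
Proof.
move=> x0; rewrite expRN -[leRHS]invrK invfM invrK lef_pV2 ?posrE ?expR_gt0//; last first.
  by rewrite mulr_gt0 ?invr_gt0 ?ltr0n ?fact_gt0// exprn_gt0.
rewrite mulrC (le_trans _ (expR_ge1Dxn m (ltW x0)))//.
by rewrite lerDr.
Qed.

(** The factor [2 ^+ n] counts the new points of a dyadic generation. Bounding the exponential by an
    inverse power of order [m.+1] with [beta ^+ m.+1 <= 4^-1] leaves [2 ^+ n * 4^-1 ^+ n]. *)
Lemma double_exponential_decay (R : realType) (beta : R) : 0 < beta -> beta < 1 ->
  exists2 K, 0 <= K & forall n, 2 ^+ n * expR (- (beta ^- n / 4)) <= K * 2^-1 ^+ n.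
Proof.
move=> b0 b1.
have [m mH] : exists m, beta ^+ m.+1 <= 4^-1.
  have b1' : `|beta| < 1 by rewrite ger0_norm// ltW.
  have h4 : (0 : R) < 4^-1 by rewrite invr_gt0.
  have [m _ H] := cvgr0_norm_le _ (cvg_expr b1') _ h4.
  by exists m; have := H m.+1 (leqnSn m); rewrite ger0_norm// exprn_ge0// ltW.
exists ((m.+1)`!%:R * 4 ^+ m.+1); first by rewrite mulr_ge0// exprn_ge0.
move=> n; have y0 : 0 < beta ^- n / 4 by rewrite divr_gt0// invr_gt0 exprn_gt0.
have H := expRN_le_powV m y0.
rewrite (le_trans (ler_wpM2l _ H)) ?exprn_ge0//.
have -> : 2 ^+ n * ((m.+1)`!%:R / (beta ^- n / 4) ^+ m.+1) =
   (m.+1)`!%:R * 4 ^+ m.+1 * (2 ^+ n * (beta ^+ m.+1) ^+ n).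
  rewrite expr_div_n invfM invrK -exprVn invrK -!exprM (mulnC n).
  by ring.
rewrite ler_wpM2l ?mulr_ge0 ?exprn_ge0//.
rewrite -exprMn lerXn2r ?nnegrE ?mulr_ge0 ?invr_ge0 ?exprn_ge0 ?(ltW b0)//.
by rewrite -ler_pdivlMl// -invfM -natrM.
Qed.

Lemma powR_exprn (R : realType) (x a : R) (n : nat) : 0 <= x ->
  (x ^+ n) `^ a = (x `^ a) ^+ n.
Proof.
by move=> x0; rewrite -(powR_mulrn n x0) -powRrM mulrC powRrM powR_mulrn// powR_ge0.
Qed.

Section chaining.
Variables (d : measure_display) (Omega : measurableType d) (R : realType).
Variables (P : probability Omega R) (X : R -> Omega -> R) (r : R -> R).
Hypothesis gX : centered_gaussian_process P X.
Hypothesis statX : forall s t : R, 0 <= s -> 0 <= t ->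
  covariance P (X s) (X (s + t)) = (r t)%:E.
Hypothesis r01 : r 0 = 1.
Variables (alpha C : R).
Hypothesis alpha0 : 0 < alpha.
Hypothesis C0 : 0 < C.

Definition pickands_step (u : R) : R := u `^ (- (2 / alpha)).

Lemma pickands_step_gt0 u : 0 < u -> 0 < pickands_step u.
Proof. by move=> u0; exact: powR_gt0. Qed.

Lemma pickands_step_pow u : 0 < u -> pickands_step u `^ alpha = u ^- 2.
Proof.
move=> u0; rewrite /pickands_step -powRrM mulNr divfK ?gt_eqF// powRN.
by rewrite (@powR_mulrn _ u 2)// ltW.
Qed.

Lemma pickands_step_le (del : R) : 0 < del ->
  \forall u \near +oo, pickands_step u <= del.
Proof.
move=> d0; near=> u.
have u0 : 0 < u by near: u; exact: nbhs_pinfty_gt.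
have a2 : 0 <= 2 / alpha by rewrite divr_ge0// ltW.
have H : del `^ (- (alpha / 2)) <= u by near: u; exact: nbhs_pinfty_ge.
rewrite /pickands_step powRN -[leRHS]invrK lef_pV2 ?posrE ?invr_gt0 ?powR_gt0//.
have := ge0_ler_powR a2 (powR_ge0 del (- (alpha / 2))) (ltW u0) H.
rewrite -powRrM (_ : - (alpha / 2) * (2 / alpha) = - 1); last first.
  by field; rewrite gt_eqF.
by rewrite powRN powRr1// ltW.
Unshelve. all: end_near. Qed.

Let beta : R := 2^-1 `^ (alpha / 4).

Let beta0 : 0 < beta. Proof. by rewrite powR_gt0. Qed.

Let beta1 : beta < 1.
Proof.
rewrite /beta /powR gt_eqF ?invr_gt0// expR_lt1 pmulr_rlt0 ?divr_gt0//.
by rewrite ln_lt0// invr_gt0 ltr0n/= invf_lt1 ?ltr1n.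
Qed.

Let dyadic_pow (n : nat) u : 0 < u ->
  (pickands_step u / 2 ^+ n) `^ alpha = beta ^+ (4 * n) / u ^+ 2.
Proof.
move=> u0; rewrite powRM ?invr_ge0 ?exprn_ge0//; last by rewrite ltW// pickands_step_gt0.
rewrite pickands_step_pow// mulrC; congr (_ * _).
rewrite -exprVn powR_exprn ?invr_ge0//.
rewrite exprM -(powR_mulrn 4) ?powR_ge0// -powRrM divfK//.
Qed.

Hypothesis rA : \forall t \near 0^'+, 1 - r t <= 2 * C * t `^ alpha.

Definition chain_point (t u : R) (n i : nat) : R :=
  t + i%:R * (pickands_step u / 2 ^+ n).

Definition chain_event (t u lev : R) (n : nat) : set Omega :=
  \big[setU/set0]_(i < (2 ^ n).+1) [set w | lev < X (chain_point t u n i) w].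

Lemma chain_point_ge0 t u n i : 0 <= t -> 0 <= chain_point t u n i.
Proof.
by move=> t0; rewrite addr_ge0// mulr_ge0// divr_ge0 ?powR_ge0// exprn_ge0.
Qed.

Let mpt t u lev n i : 0 <= t -> measurable [set w | lev < X (chain_point t u n i) w].
Proof.
move=> t0; apply: measurable_lt_set => //.
by apply: (process_measurable gX); exact: chain_point_ge0.
Qed.

Lemma chain_event_measurable t u lev n : 0 <= t -> measurable (chain_event t u lev n).
Proof. by move=> t0; apply: bigsetU_measurable => i _; exact: mpt. Qed.

Lemma chain_eventP t u lev n w : chain_event t u lev n w <->
  exists2 i, (i <= 2 ^ n)%N & lev < X (chain_point t u n i) w.
Proof.
rewrite /chain_event -(bigcup_mkord _ (fun i => [set w | lev < X (chain_point t u n i) w])).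
split; first by move=> [i /= i2 H]; exists i.
by move=> [i i2 H]; exists i.
Qed.

(* The level rises to [u] by [beta ^+ n / u] at the [n]-th dyadic generation: the
   total rise is [O(1 / u)], which costs a constant factor in the tail, whereas
   the increments of that generation have standard deviation [O(beta ^+ (2 * n) / u)]. *)
Let B := (1 - beta)^-1.
Let lev (u : R) (n : nat) := u - B * beta ^+ n / u.

Let B0 : 0 < B. Proof. by rewrite invr_gt0 subr_gt0. Qed.

Let beta_le1 n : beta ^+ n <= 1. Proof. by rewrite exprn_ile1// ltW. Qed.

Let lev_low u n : 0 < u -> 2 * B <= u ^+ 2 -> u / 2 <= lev u n.
Proof.
move=> u0 uB; rewrite /lev lerBrDr -lerBrDl (_ : u - u / 2 = u / 2); last by field.
rewrite ler_pdivrMr// (le_trans (_ : _ <= B))//; first by rewrite ler_piMr// ltW.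
by move: uB; rewrite expr2; lra.
Qed.

Let lev_sqr u n : 0 < u -> u ^+ 2 - 2 * B <= lev u n ^+ 2.
Proof.
move=> u0; rewrite (_ : lev u n ^+ 2 = u ^+ 2 - 2 * (B * beta ^+ n) + (B * beta ^+ n / u) ^+ 2).
  have : B * beta ^+ n <= B by rewrite ler_piMr// ltW.
  by have := sqr_ge0 (B * beta ^+ n / u); lra.
by rewrite /lev; field; rewrite gt_eqF.
Qed.

(** An even point of generation [n.+1] already belongs to generation [n], whose level is lower. At
    an odd point, either the left neighbour exceeds its own level, or there is an upcrossing [D i]
    over one fine step. *)
Let chain_inc (u t : R) (n : nat) : 0 < u -> 0 <= t ->
  2 * B <= u ^+ 2 -> 16 * C <= u ^+ 2 ->
  (forall k, 0 < k -> k <= pickands_step u -> 1 - r k <= 2 * C * k `^ alpha) ->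
  fine (P (chain_event t u (lev u n.+1) n.+1)) <=
  fine (P (chain_event t u (lev u n) n)) +
  2 ^+ n * (3 / u * expR (B + 4 * C - u ^+ 2 / 2) * expR (- (beta ^- n / 4))).
Proof.
move=> u0 t0 uB uC rk.
pose D i := [set w | X (chain_point t u n i) w <= lev u n] `&`
            [set w | lev u n.+1 < X (chain_point t u n.+1 (2 * i).+1) w].
have mD i : measurable (D i).
  apply: measurableI; last exact: mpt.
  by apply: measurable_sublevel_set; apply: (process_measurable gX); exact: chain_point_ge0.
have mU : measurable (\big[setU/set0]_(i < 2 ^ n) D i) by exact: bigsetU_measurable.
(* The value [B = (1 - beta)^-1] makes consecutive levels differ by exactly this amount. *)
have levS : lev u n = lev u n.+1 - beta ^+ n / u.
  rewrite /lev /B exprSr; field; rewrite gt_eqF//= gt_eqF// subr_gt0//.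
have levle : lev u n <= lev u n.+1.
  by rewrite levS lerBlDr lerDl divr_ge0 ?exprn_ge0// ltW.
have sub : chain_event t u (lev u n.+1) n.+1 `<=`
    chain_event t u (lev u n) n `|` \big[setU/set0]_(i < 2 ^ n) D i.
  move=> w /chain_eventP[i i2 Hi].
  have iE := odd_double_half i; case/boolP : (odd i) iE => [oi|ei] iE.
  - have [Z|Z] := leP (X (chain_point t u n i./2) w) (lev u n).
      right; rewrite -(bigcup_mkord _ D); exists i./2 => /=.
        rewrite -ltn_double; move: i2; rewrite expnS mul2n -{1}iE.
        by rewrite add1n.
      by split => //=; rewrite mul2n; move: Hi; rewrite -{1}iE.
    left; apply/chain_eventP; exists i./2 => //.
    rewrite -leq_double; move: i2; rewrite expnS mul2n => /(leq_trans _); apply.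
    by rewrite -{2}iE leq_addl.
  - left; apply/chain_eventP; exists i./2.
      rewrite -leq_double; move: i2; rewrite expnS mul2n => /(leq_trans _); apply.
      by rewrite -{2}iE leq_addl.
    apply: (le_lt_trans levle); move: Hi; rewrite -{1}iE add0n.
    congr (_ < X _ w); rewrite /chain_point exprS; congr (_ + _).
    by rewrite -mul2n natrM; field; rewrite expf_neq0.
apply: (le_trans (le_fine_probability P _ _ sub)) => //.
- exact: chain_event_measurable.
- by apply: measurableU => //; exact: chain_event_measurable.
apply: le_trans (fine_measureU_le P _ _) _ => //; first exact: chain_event_measurable.
rewrite lerD2l.
set b := (X in _ <= _ * X).
have Db i : fine (P (D i)) <= b.
  have pt0 := chain_point_ge0 u n i t0.
  pose k := pickands_step u / 2 ^+ n.+1.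
  have k0 : 0 < k by rewrite divr_gt0 ?pickands_step_gt0// exprn_gt0.
  have ptS : chain_point t u n.+1 (2 * i).+1 = chain_point t u n i + k.
    rewrite /chain_point /k exprS -natr1 natrM; field; rewrite expf_neq0//.
  have kh : k <= pickands_step u.
    rewrite ler_pdivrMr ?exprn_gt0// ler_peMr ?powR_ge0//.
    by rewrite exprn_ege1// ler1n.
  have gp := process_gaussian_pairC gX statX r01 pt0 (ltW k0).
  rewrite -ptS in gp.
  have c1 : 1 <= (beta ^- n) ^+ 2.
    by rewrite exprn_ege1// invf_ge1 ?exprn_gt0// exprn_ile1// ltW.
  have rk1 : r k <= 1 by rewrite -r01; exact: (process_correlation_le gX statX (ltW k0)).
  have levup m : lev u m <= u.
    by rewrite /lev lerBlDr lerDl divr_ge0 ?mulr_ge0 ?exprn_ge0 ?(ltW u0) ?(ltW B0) ?(ltW beta0).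
  (* The weight [c = beta ^- (2 * n)] is the largest order that keeps [(1 - r k) * c ^+ 2] of order
     [u ^- 2]; with gap [l = beta ^+ n] the gain [c * l] is [beta ^- n]. *)
  have H := @upcrossing_bound _ _ _ _ _ _ _ gp u (lev u n.+1) ((beta ^- n) ^+ 2) (beta ^+ n) (2 * C).
  rewrite /D levS; apply: le_trans (H _ _ _ _ _ _ _ _ _) _ => //.
  - by rewrite exprn_ge0// ltW.
  - by rewrite mulr_ge0// ltW.
  - exact: lev_low.
  - have := rk k k0 kh; rewrite /k dyadic_pow// -/k => h.
    have bn : beta ^- n = (beta ^+ n)^-1 by [].
    have bn0 : 0 < beta ^+ n by rewrite exprn_gt0.
    rewrite (le_trans (ler_wpM2r (sqr_ge0 _) h))//.
    rewrite mulnS exprD mulnC exprM.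
    rewrite [leLHS](_ : _ = 2 * C / u ^+ 2 * beta ^+ 4); last first.
      by field; rewrite expf_neq0 ?gt_eqF.
    by rewrite ler_piMr// divr_ge0 ?mulr_ge0 ?exprn_ge0 ?(ltW C0)// ltW.
  - by rewrite mulrA (_ : 8 * 2 = 16)//; ring.
  - rewrite /b -[leRHS]mulrA -expRD ler_wpM2l ?divr_ge0 ?(ltW u0)// ler_expR.
    rewrite (_ : (beta ^- n) ^+ 2 * beta ^+ n / 4 = beta ^- n / 4); last first.
      by field; rewrite expf_neq0// gt_eqF.
    by have := lev_sqr n.+1 u0; lra.
have Hb := @fine_measure_bigsetU_le _ _ _ P D (2 ^ n)%N (fun=> b) mD (fun i _ => Db i).
apply: (le_trans Hb).
by rewrite sumr_const card_ord -[b *+ _]mulr_natl natrX.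
Qed.

Lemma chaining_bound : exists2 K, 0 <= K &
  \forall u \near +oo, forall t n, 0 <= t ->
    fine (P (chain_event t u u n)) <= K * (u^-1 * expR (- (u ^+ 2 / 2))).
Proof.
have [K1 K10 K1H] := double_exponential_decay beta0 beta1.
pose M := 3 * expR (B + 4 * C).
exists (4 * expR B + 2 * (M * K1)).
  by rewrite addr_ge0 ?mulr_ge0 ?expR_ge0.
have [del /= del0 rdel] := rA.
near=> u => t n t0.
have u0 : 0 < u by near: u; exact: nbhs_pinfty_gt.
have u1 : 1 <= u by near: u; exact: nbhs_pinfty_ge.
have uu : u <= u ^+ 2 by rewrite expr2 ler_peMr// ltW.
have uB : 2 * B <= u ^+ 2.
  by rewrite (le_trans _ uu)//; near: u; exact: nbhs_pinfty_ge.
have uC : 16 * C <= u ^+ 2.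
  by rewrite (le_trans _ uu)//; near: u; exact: nbhs_pinfty_ge.
have hdel : pickands_step u <= del / 2.
  by near: u; apply: pickands_step_le; rewrite divr_gt0.
have rk k : 0 < k -> k <= pickands_step u -> 1 - r k <= 2 * C * k `^ alpha.
  move=> k0 kh; apply: rdel => //=; rewrite sub0r normrN gtr0_norm//.
  by rewrite (le_lt_trans kh)// (le_lt_trans hdel)// ltr_pdivrMr// ltr_pMr// ltr1n.
pose G := u^-1 * expR (- (u ^+ 2 / 2)).
have G0 : 0 <= G by rewrite mulr_ge0 ?expR_ge0// invr_ge0 ltW.
(* Generation 0 has two points. Each tail costs a factor 2 from [lev u 0 >= u / 2] and [expR B] from
   the lowered level. *)
have A0 : fine (P (chain_event t u (lev u 0) 0)) <= 4 * expR B * G.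
  have l0 : 0 < lev u 0 by rewrite (lt_le_trans _ (lev_low 0 u0 uB))// divr_gt0.
  have D i : fine (P [set w | lev u 0 < X (chain_point t u 0 i) w]) <= 2 * expR B * G.
    have pt0 := chain_point_ge0 u 0 i t0.
    have gp := gaussian_pair_standardl (process_gaussian_pair gX statX r01 pt0 (lexx 0)).
    rewrite (standard_gaussian_strict_tail _ gp) (le_trans (gauss_tail_le l0))//.
    rewrite /G (_ : 2 * expR B * _ = (u / 2)^-1 * expR (B - u ^+ 2 / 2)); last first.
      by rewrite expRD; field; rewrite gt_eqF.
    apply: ler_pM; rewrite ?invr_ge0 ?expR_ge0 ?(ltW l0)//.
      by rewrite lef_pV2 ?posrE ?divr_gt0// lev_low.
    by rewrite ler_expR; have := lev_sqr 0 u0; lra.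
  have Hb := @fine_measure_bigsetU_le _ _ _ P
    (fun i => [set w | lev u 0 < X (chain_point t u 0 i) w]) (2 ^ 0).+1
    (fun=> 2 * expR B * G) (fun i => mpt u (lev u 0) 0 i t0) (fun i _ => D i).
  apply: (le_trans Hb).
  by rewrite sumr_const card_ord expn0 mulr2n; lra.
(* The factor [1 - 2^-1 ^+ m] is the partial geometric sum of the increments, so the bound stays
   uniform in [m] and passes to the union of all dyadic grids. *)
have An m : fine (P (chain_event t u (lev u m) m)) <=
    4 * expR B * G + 2 * (M * K1) * G * (1 - 2^-1 ^+ m).
  elim: m => [|m IH]; first by rewrite expr0 subrr mulr0 addr0.
  apply: (le_trans (chain_inc m u0 t0 uB uC rk)).
  apply: (@le_trans _ _ (4 * expR B * G + 2 * (M * K1) * G * (1 - 2^-1 ^+ m) +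
     M * K1 * G * 2^-1 ^+ m)).
    rewrite lerD// mulrCA (_ : 3 / u * _ = M * G); last first.
      by rewrite /M /G expRD; field; rewrite gt_eqF.
    rewrite [leRHS](_ : _ = M * G * (K1 * 2^-1 ^+ m)); last by ring.
    by rewrite ler_wpM2l// mulr_ge0// /M mulr_ge0 ?expR_ge0.
  by rewrite exprS; lra.
have sub : chain_event t u u n `<=` chain_event t u (lev u n) n.
  move=> w /chain_eventP[i i2 ui]; apply/chain_eventP; exists i => //.
  apply: le_lt_trans ui; rewrite /lev lerBlDr lerDl.
  by rewrite divr_ge0 ?mulr_ge0 ?exprn_ge0 ?(ltW u0) ?(ltW B0) ?(ltW beta0).
apply: (le_trans (le_fine_probability P _ _ sub)); [exact: chain_event_measurable..|].
apply: (le_trans (An n)); rewrite -/G [leRHS]mulrDl lerD2l ler_piMr//.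
have M0 : 0 <= M by rewrite mulr_ge0 ?expR_ge0.
by rewrite mulr_ge0// mulr_ge0// mulr_ge0.
Unshelve. all: end_near. Qed.

End chaining.

(** * Hitting a grid by the second moment *)

Section second_moment_method.
Variables (d : measure_display) (Omega : measurableType d) (R : realType).
Variables (P : probability Omega R) (A : nat -> set Omega).
Hypothesis mA : forall i, measurable (A i).

Let I i : Omega -> R := \1_(A i).

Let mI i : measurable_fun setT (I i). Proof. exact: measurable_indic. Qed.

Let I01 i w : 0 <= I i w <= 1.
Proof. by rewrite /I indicE; case: (_ \in _); rewrite /= ?lexx ler01. Qed.

Let N (m : nat) (w : Omega) : R := \sum_(i < m) I i w.

Let mN m : measurable_fun setT (N m).
Proof. by apply: measurable_sum => i; exact: mI. Qed.

Let Nm m w : 0 <= N m w <= m%:R.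
Proof.
rewrite /N; elim: m => [|m IH]; first by rewrite big_ord0 lexx.
rewrite big_ord_recr/= -natr1; have /andP[i0 i1] := I01 m w.
by have /andP[N0 N1] := IH; rewrite addr_ge0//= lerD.
Qed.

Let bint (f : Omega -> R) (K : R) : measurable_fun setT f ->
  (forall w, 0 <= f w <= K) -> P.-integrable setT (EFin \o f).
Proof.
move=> mf f0; apply: (@bounded_integrable _ _ _ _ _ K) => // w.
by have /andP[? ?] := f0 w; rewrite ger0_norm.
Qed.

Let iN m := bint (mN m) (Nm m).
Let iI i := bint (mI i) (I01 i).

Let EI i : \int[P]_w I i w = fine (P (A i)).
Proof. by rewrite /Rintegral integral_indic// setIT. Qed.

Let NI01 m w : 0 <= N m w * I m w <= m%:R.
Proof.
have /andP[i0 i1] := I01 m w; have /andP[N0 N1] := Nm m w.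
by rewrite mulr_ge0//= (le_trans _ N1)// ler_piMr.
Qed.

Let iNI m : P.-integrable setT (EFin \o (fun w => N m w * I m w)).
Proof. by apply: (bint _ (NI01 m)); exact: measurable_funM. Qed.

Let EN m p : (forall i, fine (P (A i)) = p) -> \int[P]_w N m w = m%:R * p.
Proof.
move=> Ap; elim: m => [|m IH].
  rewrite mul0r -[RHS](Rintegral_prob_cst P 0).
  by apply: eq_Rintegral => w _; rewrite /N big_ord0.
transitivity (\int[P]_w (N m w + I m w)).
  by apply: eq_Rintegral => w _; rewrite /N big_ord_recr.
by rewrite RintegralD// IH EI Ap -natr1 mulrDl mul1r.
Qed.

Let ENI m (b : nat -> R) : (forall i, (i < m)%N -> fine (P (A i `&` A m)) <= b i) ->
  \int[P]_w (N m w * I m w) <= \sum_(i < m) b i.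
Proof.
move=> Ab.
have iII i : P.-integrable setT (EFin \o (fun w => I i w * I m w)).
  apply: (@bint _ 1); first exact: measurable_funM.
  move=> w; have /andP[i0 i1] := I01 i w; have /andP[j0 j1] := I01 m w.
  by rewrite mulr_ge0//= mulr_ile1.
suff H k : (k <= m)%N -> P.-integrable setT (EFin \o (fun w => N k w * I m w)) /\
    \int[P]_w (N k w * I m w) <= \sum_(i < k) b i by have [] := H m (leqnn m).
elim: k => [_|k IH km].
  split.
    apply: (@bint _ 0); first exact: measurable_funM.
    by move=> w; rewrite /N big_ord0 mul0r lexx.
  rewrite big_ord0 -[leRHS](Rintegral_prob_cst P 0).
  by under eq_Rintegral do rewrite /N big_ord0 mul0r.
have [iNk Hk] := IH (ltnW km).
have E : (fun w => N k.+1 w * I m w) = (fun w => N k w * I m w + I k w * I m w).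
  by apply/funext => w; rewrite /N big_ord_recr/= mulrDl.
split; first by rewrite E; exact: (integrableD measurableT iNk (iII k)).
rewrite E RintegralD// big_ord_recr/= lerD//.
apply: le_trans (Ab k km); rewrite /Rintegral -[A k `&` A m]setIT -integral_indic//; last exact: measurableI.
by rewrite (_ : (fun w => _) = EFin \o \1_(A k `&` A m))//; apply/funext => w; rewrite /= indicI.
Qed.

(** Chebyshev's inequality for the number [N] of events that occur. The pair bound is split into
    [q], which depends on the lag and has bounded sums, and a constant [F], meant to be close to
    [p ^+ 2] so that it cancels against the squared mean. *)
Lemma second_moment_method (m : nat) (p F Q : R) (q : nat -> R) :
  (forall i, fine (P (A i)) = p) -> 0 <= F -> 0 <= Q ->
  (forall i j, (i < j)%N -> (j < m)%N -> fine (P (A i `&` A j)) <= q (j - i)%N + F) ->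
  (forall k, \sum_(i < k) q i.+1 <= Q) ->
  (m%:R * p) ^+ 2 * (1 - fine (P (\big[setU/set0]_(i < m) A i))) <=
  m%:R * (p + 2 * Q) + m%:R ^+ 2 * F - (m%:R * p) ^+ 2.
Proof.
move=> Ap F0 Q0 Aq qQ.
have N2b k w : 0 <= N k w ^+ 2 <= k%:R ^+ 2.
  have /andP[N0 N1] := Nm k w.
  by rewrite sqr_ge0/= lerXn2r// nnegrE.
have iN2 k : P.-integrable setT (EFin \o (fun w => N k w ^+ 2)).
  by apply: (bint _ (N2b k)); exact: measurable_funX.
have EN2 k : (k <= m)%N -> \int[P]_w (N k w ^+ 2) <= k%:R * (p + 2 * Q) + k%:R ^+ 2 * F.
  elim: k => [_|k IH km].
    rewrite mul0r expr0n/= mul0r addr0 -[leRHS](Rintegral_prob_cst P 0).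
    by under eq_Rintegral do rewrite /N big_ord0 expr0n.
  have E : (fun w => N k.+1 w ^+ 2) = (fun w => N k w ^+ 2 + (2 * (N k w * I k w) + I k w)).
    apply/funext => w; rewrite /N big_ord_recr/= -/(N k w).
    by rewrite /I indicE; case: (_ \in _); rewrite /=; ring.
  have i2 := integrableZl measurableT 2 (iNI k).
  rewrite E RintegralD//; last exact: (integrableD measurableT i2 (iI k)).
  rewrite RintegralD// RintegralZl// EI Ap.
  have H1 := IH (ltnW km).
  have H2 : \int[P]_w (N k w * I k w) <= Q + k%:R * F.
    apply: le_trans (ENI (b := fun i => q (k - i)%N + F) _) _.
      by move=> i ik; exact: Aq.
    rewrite big_split/= sumr_const card_ord mulr_natl lerD2r.
    apply: le_trans (qQ k); rewrite (reindex_inj rev_ord_inj)/=.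
    by apply: ler_sum => i _; rewrite subKn.
  by rewrite -natr1; nra.
have p0 : 0 <= p by rewrite -(Ap 0%N) fine_ge0.
pose U := \big[setU/set0]_(i < m) A i.
have mU : measurable U by exact: bigsetU_measurable.
pose c := m%:R * p.
have c0 : 0 <= c by rewrite mulr_ge0.
(* [(m p)^2] is at most [(N - m p)^2] where [N = 0], i.e. off the union *)
have E1 : \int[P]_w ((c ^+ 2) * (1 - \1_U w)) <=
    \int[P]_w (N m w ^+ 2 + (c ^+ 2 - 2 * c * N m w)).
  have ic2 : P.-integrable setT (EFin \o (fun=> c ^+ 2)).
    by apply: (@bint _ (c ^+ 2)) => // w; rewrite sqr_ge0 lexx.
  have i1 := integrableB measurableT ic2 (integrableZl measurableT (2 * c) (iN m)).
  apply: le_Rintegral => //.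
  - apply: (@bint _ (c ^+ 2)).
      by apply: measurable_funM => //; apply: measurable_funB => //; exact: measurable_indic.
    move=> w; rewrite indicE; case: (_ \in _); rewrite /= ?subrr ?subr0 ?mulr0 ?mulr1 ?sqr_ge0 ?lexx//.
  - exact: (integrableD measurableT (iN2 m) i1).
  move=> w _; rewrite indicE; case: (boolP (w \in U)) => wU.
    by rewrite subrr mulr0; have := sqr_ge0 (N m w - c); lra.
  suff -> : N m w = 0 by rewrite subr0; lra.
  rewrite /N big1// => i _; rewrite /I indicE memNset// => Aw.
  move/negP: wU; apply; apply/mem_set; rewrite /U -(bigcup_mkord _ A).
  by exists i => //=.
have iU : P.-integrable setT (EFin \o (\1_U : Omega -> R)).
  apply: (@bint _ 1); first exact: measurable_indic.
  by move=> w; rewrite indicE; case: (_ \in _); rewrite /= ?lexx ler01.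
have i11 : P.-integrable setT (EFin \o (fun=> 1 : R)).
  by apply: (@bint _ 1) => // w; rewrite ler01 lexx.
have ic2 : P.-integrable setT (EFin \o (fun=> c ^+ 2)).
  by apply: (@bint _ (c ^+ 2)) => // w; rewrite sqr_ge0 lexx.
have i2c := integrableZl measurableT (2 * c) (iN m).
rewrite RintegralZl// in E1; last exact: (integrableB measurableT i11 iU).
rewrite RintegralB// Rintegral_prob_cst in E1.
rewrite (_ : \int[P]_w \1_U w = fine (P U)) in E1; last first.
  by rewrite /Rintegral integral_indic// setIT.
rewrite RintegralD// in E1; last exact: (integrableB measurableT ic2 i2c).
rewrite RintegralB// Rintegral_prob_cst RintegralZl// (EN m Ap) in E1.
apply: (le_trans E1); rewrite -/c.
by have := EN2 m (leqnn m); lra.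
Qed.

End second_moment_method.

Lemma sum_inv_sqr_le (R : realType) (n : nat) :
  \sum_(i < n.+1) (i.+1%:R ^- 2) <= 2 - (n.+1%:R)^-1 :> R.
Proof.
elim: n => [|n IH]; first by rewrite big_ord_recr big_ord0/= expr1n invr1; lra.
rewrite big_ord_recr/= (le_trans (lerD IH (lexx _)))//.
have n1 : (0 : R) < n.+1%:R by rewrite ltr0n.
have n2 : (0 : R) < n.+2%:R by rewrite ltr0n.
rewrite (_ : n.+1%:R = n.+2%:R - 1) in n1 *; last by rewrite -[n.+2%:R]natr1 addrK.
set x := n.+2%:R in n1 n2 *.
rewrite -subr_ge0 (_ : _ - _ = ((x - 1) * x ^+ 2)^-1).
  by rewrite invr_ge0 mulr_ge0 ?exprn_ge0 ?ltW.
by field; rewrite !gt_eqF.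
Qed.

(** An inverse power of order [m.+1] with [alpha * m.+1%:R >= 2] dominates the exponential and
    reduces the sum to that of inverse squares. *)
Lemma stretched_exponential_summable (R : realType) (kap alpha : R) : 0 < kap -> 0 < alpha ->
  exists2 S, 0 <= S & forall n, \sum_(i < n) expR (- (kap * i.+1%:R `^ alpha)) <= S.
Proof.
move=> k0 a0.
pose m := Num.truncn (2 / alpha).
have am : 2 <= alpha * m.+1%:R.
  by rewrite mulrC -ler_pdivrMr// ltW// truncnS_gt.
pose K := (m.+1)`!%:R / kap ^+ m.+1.
have K0 : 0 <= K by rewrite divr_ge0// exprn_ge0// ltW.
exists (K * 2); first by rewrite mulr_ge0.
case=> [|n]; first by rewrite big_ord0 mulr_ge0.
apply: (@le_trans _ _ (\sum_(i < n.+1) (K * i.+1%:R ^- 2))).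
  apply: ler_sum => i _.
  have i0 : (0 : R) < i.+1%:R by rewrite ltr0n.
  have y0 : 0 < kap * i.+1%:R `^ alpha by rewrite mulr_gt0// powR_gt0.
  rewrite (le_trans (expRN_le_powV m y0))// exprMn invfM mulrA -/K ler_wpM2l//.
  rewrite lef_pV2 ?posrE ?exprn_gt0 ?powR_gt0//.
  rewrite -(powR_mulrn m.+1) ?powR_ge0// -powRrM -(powR_mulrn 2) ?(ltW i0)//.
  by apply: ler_powR => //; rewrite ler1n.
rewrite -mulr_sumr ler_wpM2l// (le_trans (sum_inv_sqr_le R n))//.
by rewrite lerBlDr lerDl invr_ge0.
Qed.

Lemma sum_indicator_le (R : realType) (D : R) (n : nat) : 0 <= D ->
  \sum_(i < n) (i.+1%:R <= D)%R%:R <= D :> R.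
Proof.
move=> D0; elim: n => [|n IH]; first by rewrite big_ord0.
rewrite big_ord_recr/=; case: (leP n.+1%:R D) => nD; last by rewrite addr0.
apply: le_trans nD; rewrite -natr1 lerD2r.
rewrite -[leRHS](_ : \sum_(i < n) 1 = _); last by rewrite sumr_const card_ord.
by apply: ler_sum => i _; rewrite lern1 leq_b1.
Qed.

Section grid_hitting.
Variables (d : measure_display) (Omega : measurableType d) (R : realType).
Variables (P : probability Omega R) (X : R -> Omega -> R) (r : R -> R).
Hypothesis gX : centered_gaussian_process P X.
Hypothesis statX : forall s t : R, 0 <= s -> 0 <= t ->
  covariance P (X s) (X (s + t)) = (r t)%:E.
Hypothesis r01 : r 0 = 1.
Variables (alpha C : R).
Hypothesis alpha0 : 0 < alpha.
Hypothesis C0 : 0 < C.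
Hypothesis r1 : forall eps : R, 0 < eps -> \forall t \near 0^'+, `|r t - 1| <= eps.
Hypothesis rB : \forall t \near 0^'+, C / 2 * t `^ alpha <= 1 - r t.
Hypothesis A2 : forall t : R, 0 < t -> r t < 1.
Hypothesis A3 : (fun t => r t * ln t) @ +oo --> (0 : R).

Lemma correlation_ge_N1 t : 0 <= t -> -1 <= r t.
Proof.
move=> t0; have [+ _] := process_gaussian_pair gX statX r01 (lexx 0) t0 1 1.
by rewrite expr1n; lra.
Qed.

Let gp s k := @process_gaussian_pair _ _ _ _ _ _ gX statX r01 s k.
Let c : R := mills_constant.
Let c0 : 0 < c := mills_constant_gt0 R.

Lemma pickands_step_ge_expR (gap : R) : 0 < gap ->
  \forall u \near +oo, expR (- (gap * u ^+ 2)) <= pickands_step alpha u.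
Proof.
move=> g0; near=> u.
have u0 : 0 < u by near: u; exact: nbhs_pinfty_gt.
rewrite /pickands_step /powR gt_eqF// ler_expR mulNr lerN2.
have lu : ln u <= u by rewrite ltW// ln_sublinear.
have a2 : 0 <= 2 / alpha by rewrite divr_ge0// ltW.
apply: (le_trans (ler_wpM2l a2 lu)); rewrite expr2 mulrA ler_pM2r//.
rewrite -ler_pdivrMl//; near: u; exact: nbhs_pinfty_ge.
Unshelve. all: end_near. Qed.

Ltac lra_goal := clear - gX statX r01 alpha0 C0 r1 rB A2 A3 gp c0; lra.

Lemma grid_hitting (eps : R) : 0 < eps -> exists2 M, 0 < M &
  \forall u \near +oo,
    1 - eps <= fine (P (\big[setU/set0]_(i < Num.truncn (M * (u * expR (u ^+ 2 / 2))))
      [set w | u < X (i%:R * pickands_step alpha u) w])).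
Proof.
move=> e0.
have kap0 : 0 < C / 16 by rewrite divr_gt0.
have [S S0 SH] := stretched_exponential_summable kap0 alpha0.
have [del /= del0 rdel] := rB.
have [gap /andP[gap0 gap1] rgap] := correlation_sup gX statX r01 r1 del0 A2 A3.
pose E : R := expR 1 / c.
have c2 : 0 < c ^+ 2 by exact: exprn_gt0.
have E0 : 0 < E by rewrite divr_gt0 ?expR_gt0.
(* The admissible size of [2 * |r| * u ^+ 2] at far lags: the relative error [z * E] in
   [joint_tail_far] is then at most [eps / 3]. *)
pose z := Num.min 1 (eps / (3 * E)).
have z0 : 0 < z by rewrite lt_min ltr01 divr_gt0// mulr_gt0.
have z1 : z <= 1 by rewrite ge_min lexx.
have zE : z * E <= eps / 3.
  by rewrite -ler_pdivlMr// -mulrA -invfM ge_min lexx orbT.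
have zg : 0 < z * gap / 32 by rewrite divr_gt0// mulr_gt0.
have [t0 [_ rfar]] := cvgr0_norm_le _ A3 _ zg.
(* The fraction is what makes the diagonal and short-lag terms at most [eps / 3] of the squared
   mean. The summand 1 compensates the rounding of [m], since [m%:R * G] is only known to be at
   least [M - 1]. *)
pose M : R := 1 + 3 * (3 + 2 * S) / (c ^+ 2 * eps).
have Mpos : 0 < M.
  by rewrite ltr_pwDl// divr_ge0 ?(mulr_ge0 (ltW c2)) ?(ltW e0)// mulr_ge0// addr_ge0// mulr_ge0.
exists M => //; near=> u.
have u0 : 0 < u by near: u; exact: nbhs_pinfty_gt.
have u1 : 1 <= u by near: u; exact: nbhs_pinfty_ge.
have uu : u <= u ^+ 2 by rewrite expr2 ler_peMr// ltW.
have hE : expR (- (gap / 16 * u ^+ 2)) <= pickands_step alpha u.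
  by near: u; apply: pickands_step_ge_expR; rewrite divr_gt0.
set h := pickands_step alpha u in hE *.
have h0 : 0 < h by exact: pickands_step_gt0.
have ut0 : 16 / gap * t0 <= u by near: u; apply: nbhs_pinfty_ge; exact: num_real.
have uc : 3 / (2 * c ^+ 2 * eps) <= u by near: u; apply: nbhs_pinfty_ge; exact: num_real.
pose G := u^-1 * expR (- (u ^+ 2 / 2)).
have G0 : 0 < G by rewrite mulr_gt0 ?expR_gt0// invr_gt0.
have G1 : G <= 1.
  rewrite /G mulr_ile1 ?invr_ge0 ?expR_ge0 ?(ltW u0) ?invf_le1//.
  by rewrite -expR0 ler_expR oppr_le0 divr_ge0// sqr_ge0.
have GV : u * expR (u ^+ 2 / 2) = G^-1 by rewrite /G expRN invfM !invrK.
set m := Num.truncn _.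
have mM : m%:R * G <= M.
  have y0 : 0 <= M * (u * expR (u ^+ 2 / 2)) by rewrite GV divr_ge0 ?(ltW Mpos) ?(ltW G0).
  by have /andP[+ _] := truncn_itv y0; rewrite -/m {1}GV ler_pdivlMr.
have mM1 : M - 1 <= m%:R * G.
  have : M * (u * expR (u ^+ 2 / 2)) < m.+1%:R by exact: truncnS_gt.
  by rewrite GV ltr_pdivrMr// -natr1 mulrDl mul1r; move: G1; lra_goal.
pose p := gauss_tail u.
have pG : p <= G by exact: gauss_tail_le.
have Gp : c * G <= p by exact: gauss_tail_ge.
have p0 : 0 < p by rewrite (lt_le_trans _ Gp)// mulr_gt0.
have cG2 : (c * G) ^+ 2 <= p ^+ 2.
  by rewrite lerXn2r// nnegrE ltW// mulr_gt0.
pose g2 := gauss_tail (2 * u).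
have g20 : 0 <= g2 by exact: gauss_tail_ge0.
(* The tail at [2 * u] has exponent [- 2 * u ^+ 2], against [- u ^+ 2] for [p ^+ 2]. *)
have g2p : g2 <= eps / 3 * p ^+ 2.
  have H1 : g2 <= (2 * u)^-1 * expR (- ((2 * u) ^+ 2 / 2)).
    by apply: gauss_tail_le; rewrite mulr_gt0.
  have H3 : (2 * u)^-1 * expR (- ((2 * u) ^+ 2 / 2)) = G ^+ 2 * (u / 2 * expR (- u ^+ 2)).
    rewrite (_ : - _ = - (u ^+ 2 / 2) - (u ^+ 2 / 2) - u ^+ 2); last by field.
    by rewrite !expRD /G; field; rewrite gt_eqF.
  have H4 : u / 2 * expR (- u ^+ 2) <= eps / 3 * c ^+ 2.
    have H5 : expR (- u ^+ 2) <= u ^- 2.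
      rewrite expRN lef_pV2 ?posrE ?expR_gt0 ?exprn_gt0//.
      by have := expR_ge1Dx (u ^+ 2); lra_goal.
    have u2 : 0 <= u / 2 by rewrite divr_ge0// ltW.
    apply: (le_trans (ler_wpM2l u2 H5)).
    rewrite (_ : u / 2 * _ = (2 * u)^-1); last by field; rewrite gt_eqF.
    have e3 : 0 < eps / 3 by rewrite divr_gt0.
    rewrite invf_ple ?posrE ?(mulr_gt0 _ u0)//; last first.
      by rewrite mulr_gt0// exprn_gt0.
    rewrite [leLHS](_ : _ = 2 * (3 / (2 * c ^+ 2 * eps))); last by field; rewrite !gt_eqF.
    by rewrite ler_pM2l.
  apply: (le_trans H1); rewrite H3.
  apply: (le_trans (ler_wpM2l (sqr_ge0 G) H4)).
  rewrite (_ : G ^+ 2 * _ = eps / 3 * (c * G) ^+ 2); last by ring.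
  by rewrite ler_wpM2l// divr_ge0// ltW.
(* Few enough lags for the decay [expR (- (gap * u ^+ 2 / 4))] to absorb, yet more than [D] steps,
   each at least [expR (- (gap / 16 * u ^+ 2))], last at least [expR (gap / 16 * u ^+ 2)]. *)
pose D := expR (gap * u ^+ 2 / 8).
pose A i := [set w | u < X (i%:R * h) w].
have ih0 i : 0 <= i%:R * h by rewrite mulr_ge0// ltW.
have mA i : measurable (A i).
  exact: (measurable_lt_set (f := fun=> u) (measurable_cst _) (process_measurable gX (ih0 i))).
have Ap i : fine (P (A i)) = p.
  by rewrite /A (standard_gaussian_strict_tail _ (gaussian_pair_standardl (gp (ih0 i) (lexx 0)))).
pose F : R := (1 + z * E) * p ^+ 2 + g2.
have F0 : 0 <= F by rewrite addr_ge0// mulr_ge0 ?sqr_ge0// addr_ge0// mulr_ge0// ltW.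
pose q k : R := G * expR (- (C / 16 * k%:R `^ alpha)) + G * expR (- (gap * u ^+ 2 / 4)) * (k%:R <= D)%R%:R.
have q10 k : 0 <= G * expR (- (C / 16 * k%:R `^ alpha)).
  by rewrite mulr_ge0 ?expR_ge0// ltW.
have q20 k : 0 <= G * expR (- (gap * u ^+ 2 / 4)) * (k%:R <= D)%R%:R.
  by rewrite mulr_ge0// mulr_ge0 ?expR_ge0// ltW.
have Aq i j : (i < j)%N -> (j < m)%N -> fine (P (A i `&` A j)) <= q (j - i)%N + F.
  move=> ij _; pose k := (j - i)%N.
  have k1 : (1 : R) <= k%:R by rewrite ler1n subn_gt0.
  have k0 : (0 : R) < k%:R by rewrite (lt_le_trans _ k1).
  pose t := k%:R * h.
  have tp : 0 < t by rewrite mulr_gt0.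
  have ijt : j%:R * h = i%:R * h + t by rewrite /t -mulrDl -natrD subnKC// ltnW.
  have gij := gp (ih0 i) (ltW tp); rewrite -ijt in gij.
  have rt1 := correlation_ge_N1 (ltW tp).
  rewrite -/k /q; case: (ltP t del) => tdel.
    have rt : C / 2 * t `^ alpha <= 1 - r t.
      by apply: rdel => //=; rewrite sub0r normrN gtr0_norm.
    (* Half of the available [C / 2] is given up so that [r t >= -1] ensures [tau <= 1]. *)
    have tau : 0 <= C / 4 * t `^ alpha <= 1.
      by rewrite mulr_ge0 ?powR_ge0 ?divr_ge0 ?(ltW C0)//=; move: rt rt1; lra_goal.
    have rtau : r t <= 1 - C / 4 * t `^ alpha.
      have := mulr_ge0 (ltW C0) (powR_ge0 t alpha).
      by move: rt; lra_goal.
    apply: (le_trans (joint_tail_near gij u0 tau rtau)).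
    rewrite -/G (_ : C / 4 * t `^ alpha * u ^+ 2 / 4 = C / 16 * k%:R `^ alpha); last first.
      rewrite /t powRM ?(ltW k0) ?(ltW h0)// pickands_step_pow//.
      by field; rewrite gt_eqF.
    by rewrite -addrA lerDl; apply: addr_ge0.
  case: (leP k%:R D) => kD.
    have tau : 0 <= gap <= 1 by rewrite (ltW gap0).
    apply: (le_trans (joint_tail_near gij u0 tau (rgap _ tdel))).
    by rewrite -/G mulr1 addrAC lerDr addr_ge0.
  have Dh : expR (gap / 16 * u ^+ 2) <= t.
    rewrite (_ : gap / 16 * u ^+ 2 = gap * u ^+ 2 / 8 + - (gap / 16 * u ^+ 2)); last by field.
    by rewrite expRD ler_pM ?expR_ge0// ltW.
  have lnt : gap / 16 * u ^+ 2 <= ln t by rewrite -[leLHS]expRK ler_ln ?posrE ?expR_gt0.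
  have tt0 : t0 < t.
    apply: lt_le_trans Dh; apply: (@lt_le_trans _ _ (1 + gap / 16 * u ^+ 2)); last exact: expR_ge1Dx.
    have g16 : 0 < gap / 16 by rewrite divr_gt0.
    have : gap / 16 * (16 / gap * t0) <= gap / 16 * u by rewrite ler_pM2l.
    rewrite (_ : gap / 16 * (16 / gap * t0) = t0); last by field; rewrite gt_eqF.
    have : gap / 16 * u <= gap / 16 * u ^+ 2 by rewrite ler_pM2l.
    by lra_goal.
  have rl := rfar t tt0; rewrite normrM in rl.
  have lt0 : 0 < ln t by rewrite (lt_le_trans _ lnt)// mulr_gt0 ?exprn_gt0// divr_gt0.
  rewrite (gtr0_norm lt0) in rl.
  (* Here [ln t >= gap / 16 * u ^+ 2], so the bound [z * gap / 32] on [|r t| * ln t] becomes one on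
     [|r t| * u ^+ 2]. *)
  have r2 : 2 * `|r t| * u ^+ 2 <= z.
    have H1 : `|r t| * (gap / 16 * u ^+ 2) <= z * gap / 32.
      by apply: le_trans rl; rewrite ler_wpM2l.
    rewrite -(@ler_pM2r _ (gap / 32)) ?divr_gt0//.
    by move: H1; lra_goal.
  apply: (le_trans (joint_tail_far gij u1 z1 r2)).
  rewrite -/c -/E -/p -/g2 -/F lerDr.
  by apply: addr_ge0; rewrite ?mulr0.
have qQ k : \sum_(i < k) q i.+1 <= G * (S + 1).
  rewrite big_split/= -!mulr_sumr mulrDr lerD//.
    exact: (ler_wpM2l (ltW G0) (SH k)).
  have D0 : 0 <= D by exact: expR_ge0.
  rewrite -[leLHS]mulrA; apply: (ler_wpM2l (ltW G0)).
  apply: (@le_trans _ _ (expR (- (gap * u ^+ 2 / 4)) * D)).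
    by rewrite ler_wpM2l ?expR_ge0// sum_indicator_le.
  rewrite -expRD -[leRHS]expR0 ler_expR.
  by have := mulr_ge0 (ltW gap0) (sqr_ge0 u); lra_goal.
have Q0 : 0 <= G * (S + 1) by rewrite mulr_ge0 ?addr_ge0 ?(ltW G0).
have := second_moment_method mA Ap F0 Q0 Aq qQ.
set x := fine _; rewrite -/(fine _) => H.
have m0 : 0 < m%:R :> R.
  have : 0 < M - 1.
    rewrite /M addrC addKr divr_gt0 ?(mulr_gt0 c2)//.
    by rewrite mulr_gt0// ltr_pwDl// mulr_ge0.
  by move=> /lt_le_trans/(_ mM1); rewrite pmulr_lgt0.
have T1 : m%:R * (p + 2 * (G * (S + 1))) <= eps / 3 * (m%:R * p) ^+ 2.
  have H1 : G * (3 + 2 * S) <= eps / 3 * (c ^+ 2 * G * (M - 1)).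
    rewrite (_ : eps / 3 * _ = G * (3 + 2 * S))// /M.
    by field; rewrite !gt_eqF.
  have H2 : c ^+ 2 * G * (M - 1) <= m%:R * p ^+ 2.
    apply: (@le_trans _ _ (c ^+ 2 * G * (m%:R * G))).
      by rewrite ler_wpM2l// mulr_ge0 ?sqr_ge0// ltW.
    rewrite (_ : c ^+ 2 * G * _ = m%:R * (c * G) ^+ 2); last by ring.
    by rewrite ler_pM2l.
  rewrite (_ : eps / 3 * _ = m%:R * (eps / 3 * (m%:R * p ^+ 2))); last by ring.
  rewrite ler_pM2l//; apply: (@le_trans _ _ (G * (3 + 2 * S))); first by move: pG; lra_goal.
  apply: (le_trans H1); rewrite ler_pM2l// divr_gt0//.
have T2 : m%:R ^+ 2 * F <= (1 + 2 * (eps / 3)) * (m%:R * p) ^+ 2.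
  rewrite exprMn mulrCA ler_wpM2l ?sqr_ge0// /F.
  have zEp : z * E * p ^+ 2 <= eps / 3 * p ^+ 2 by rewrite ler_wpM2r ?sqr_ge0.
  by move: zEp g2p; lra_goal.
have : (m%:R * p) ^+ 2 * (1 - x) <= (m%:R * p) ^+ 2 * eps by move: H T1 T2; lra_goal.
by rewrite ler_pM2l ?exprn_gt0 ?mulr_gt0//; rewrite /x -/h; lra_goal.
Unshelve. all: end_near. Qed.

End grid_hitting.

(** * Slow variation *)

Section slow_variation.
Variables (R : realType) (L : R -> R).
Hypothesis svL : slowly_varying L.
Hypothesis L_noninc : forall x y, x <= y -> L y <= L x.
Hypothesis L_le1 : forall x, L x <= 1.

Lemma slowly_varying_gt0 x : 0 < L x.
Proof.
have [[M [_ MH]] _] := svL.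
have M1 : M < Num.max x (M + 1) by rewrite lt_max ltrDl ltr01 orbT.
by rewrite (lt_le_trans (MH _ M1))// L_noninc// le_max lexx.
Qed.

(** Slow variation is used at the ratio [3^-1] because [n./2] is at least [n / 3] once [n >= 2]. The
    constant [5 / 4] is below [3 / 2], as [karamata_sum] requires, and its square is below 2, as
    [slowly_varying_sqr_lower] requires. *)
Lemma slowly_varying_half : exists N : nat, forall n, (N <= n)%N ->
  L n./2%:R <= 5 / 4 * L n%:R.
Proof.
have [_ sv] := svL.
have h3 : (0 : R) < 3^-1 by rewrite invr_gt0.
have h4 : (1 : R) < 5 / 4 by lra.
have [M [_ MH]] := cvgr_lt _ (sv _ h3) _ h4.
exists (maxn 2 (Num.truncn M).+1) => n; rewrite geq_max => /andP[n2 nM].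
have Mn : M < n%:R.
  by rewrite (lt_le_trans (truncnS_gt M))// ler_nat.
have := MH _ Mn; rewrite ltr_pdivrMr ?slowly_varying_gt0// => /ltW.
apply: le_trans; apply: L_noninc.
have H : (n <= 3 * n./2)%N.
  by have := odd_double_half n; move: n2; case: (odd n) => /=; lia.
have : n%:R <= 3 * n./2%:R :> R by rewrite -natrM ler_nat.
by lra.
Qed.

(** Strong induction by halving: the terms from [m = n./2] on are at most [L m], so the sum is at
    most [(n + 2 * m) * L m <= 2 * n * L m], and [2 * (5 / 4) <= 3]. Below the threshold each term
    is at most 1, whence [n0]. *)
Lemma karamata_sum : exists2 n0 : R, 0 <= n0 &
  forall n : nat, \sum_(j < n) L j%:R <= 3 * n%:R * L n%:R + n0.
Proof.
have [N NH] := slowly_varying_half.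
exists (N%:R) => // n; elim/ltn_ind: n => n IH.
have L0 x := ltW (slowly_varying_gt0 x).
have [nN|Nn] := leqP n N.
  apply: (@le_trans _ _ n%:R).
    rewrite -[leRHS](_ : \sum_(j < n) 1 = _); last by rewrite sumr_const card_ord.
    by apply: ler_sum => j _.
  apply: (@le_trans _ _ N%:R); first by rewrite ler_nat.
  by rewrite lerDr !mulr_ge0.
pose m := n./2.
have mn : (m < n)%N by rewrite /m; have := odd_double_half n; case: (odd n) => /=; lia.
have m2n : (2 * m <= n)%N by rewrite /m; have := odd_double_half n; case: (odd n) => /=; lia.
have H1 : \sum_(j < n) L j%:R <= \sum_(j < m) L j%:R + (n - m)%:R * L m%:R.
  rewrite -(big_mkord xpredT (fun j => L j%:R)) (big_cat_nat (n := m))//=; last exact: ltnW.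
  rewrite big_mkord lerD2l mulr_natl -[leRHS](_ : \sum_(m <= j < n) L m%:R = _); last first.
    by rewrite sumr_const_nat.
  by apply: ler_sum_nat => j /andP[mj _]; rewrite L_noninc// ler_nat.
have H2 := IH m mn.
have H3 := NH n (ltnW Nn); rewrite -/m in H3.
have H4 : 2 * m%:R <= n%:R :> R by rewrite -natrM ler_nat.
rewrite natrB ?(ltnW mn)// in H1.
have Lm := L0 m%:R; have Ln := L0 n%:R.
have n0 : (0 : R) <= n%:R by [].
have m0 : (0 : R) <= m%:R by [].
have H5 : (n%:R + 2 * m%:R) * L m%:R <= 2 * n%:R * L m%:R by rewrite ler_wpM2r//; lra.
have H6 : 2 * n%:R * L m%:R <= 2 * n%:R * (5 / 4 * L n%:R) by rewrite ler_wpM2l// mulr_ge0.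
have H7 : 0 <= n%:R * L n%:R by rewrite mulr_ge0.
by lra.
Qed.

(** Passing from [n./2] to [n] multiplies the first factor by at least 2 and divides the squared one
    by at most [(5 / 4) ^+ 2 < 2], so a lower bound propagates upwards. *)
Lemma slowly_varying_sqr_lower : exists2 c : R, 0 < c &
  forall n : nat, (0 < n)%N -> c <= n%:R * L n%:R ^+ 2.
Proof.
have [N NH] := slowly_varying_half.
pose N1 := maxn N 2.
have L0 x := slowly_varying_gt0 x.
exists (L N1%:R ^+ 2); first by rewrite exprn_gt0.
move=> n; elim/ltn_ind: n => n IH n0.
have n1 : (1 : R) <= n%:R by rewrite ler1n.
have [nN|Nn] := leqP n N1.
  apply: (@le_trans _ _ (L n%:R ^+ 2)); last by rewrite ler_peMl// sqr_ge0.
  by rewrite lerXn2r// ?nnegrE ?(ltW (L0 _))// L_noninc// ler_nat.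
have nN : (N <= n)%N by apply: leq_trans (ltnW Nn); rewrite leq_maxl.
have n2 : (2 < n)%N by apply: leq_ltn_trans Nn; rewrite leq_maxr.
pose m := n./2.
have mn : (m < n)%N by rewrite /m; have := odd_double_half n; case: (odd n) => /=; lia.
have m2n : (2 * m <= n)%N by rewrite /m; have := odd_double_half n; case: (odd n) => /=; lia.
have m0 : (0 < m)%N by rewrite /m; have := odd_double_half n; case: (odd n) => /=; lia.
have H2 := IH m mn m0.
have H3 := NH n nN; rewrite -/m in H3.
have H4 : 2 * m%:R <= n%:R :> R by rewrite -natrM ler_nat.
have H5 : L m%:R ^+ 2 <= (5 / 4 * L n%:R) ^+ 2.
  by rewrite lerXn2r// nnegrE ?mulr_ge0 ?(ltW (L0 _)).
have H6 : 2 * m%:R * L m%:R ^+ 2 <= n%:R * (5 / 4 * L n%:R) ^+ 2.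
  by apply: ler_pM => //; exact: sqr_ge0.
rewrite exprMn in H6.
have H7 : 0 <= n%:R * L n%:R ^+ 2 by rewrite mulr_ge0 ?sqr_ge0.
by lra.
Qed.

(** From [c <= n * L n ^+ 2] follows [c * n <= (n * L n) ^+ 2], which is unbounded. *)
Lemma slowly_varying_mul_pinfty (A : R) : \forall x \near +oo, A <= x * L x.
Proof.
have [c c0 cH] := slowly_varying_sqr_lower.
near=> x.
have x1 : 1 <= x by near: x; exact: nbhs_pinfty_ge.
have x0 : 0 <= x by rewrite (le_trans _ x1).
have xc : 4 * A ^+ 2 / c <= x by near: x; apply: nbhs_pinfty_ge; exact: num_real.
pose n := (Num.truncn x).+1.
have /andP[nx xn] := truncn_itv x0.
have nx1 : n%:R <= x + 1 by rewrite /n -natr1 lerD2r.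
have n2x : n%:R <= 2 * x by rewrite (le_trans nx1)// mulrDl mul1r lerD2l.
have Lx : L n%:R <= L x by rewrite L_noninc// ltW.
have Ln := ltW (slowly_varying_gt0 n%:R).
apply: (@le_trans _ _ (n%:R / 2 * L n%:R)); last first.
  by apply: ler_pM => //; rewrite ler_pdivrMr// mulrC.
have H := cH n isT.
have nc : 4 * A ^+ 2 <= n%:R * c.
  by rewrite -ler_pdivrMr// (le_trans xc)// ltW.
have : 4 * A ^+ 2 <= (n%:R * L n%:R) ^+ 2.
  rewrite (le_trans nc)// exprMn expr2 -mulrA ler_wpM2l//.
rewrite (_ : 4 * A ^+ 2 = (2 * A) ^+ 2); last by rewrite exprMn; ring.
have nL : 0 <= n%:R * L n%:R by rewrite mulr_ge0.
case: (leP A 0) => A0.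
  by move=> _; rewrite (le_trans A0)// mulr_ge0// divr_ge0.
rewrite ler_sqr ?nnegrE ?mulr_ge0// ?(ltW A0)//.
by lra.
Unshelve. all: end_near. Qed.

End slow_variation.

(** * The time scale of the first exceedance *)

Section pickands_scale.
Variables (R : realType) (alpha : R).
Hypothesis alpha0 : 0 < alpha.

Lemma pickands_scaleE (u : R) : 0 < u ->
  u `^ ((alpha - 2) / alpha) * expR (u ^+ 2 / 2) =
  pickands_step alpha u * (u * expR (u ^+ 2 / 2)).
Proof.
move=> u0; rewrite mulrA; congr (_ * _).
rewrite /pickands_step -[X in _ = _ * X](powRr1 (ltW u0)) -powRD; last first.
  by rewrite (gt_eqF u0) implybT.
by congr (_ `^ _); field; rewrite gt_eqF.
Qed.

Lemma pickands_scale_pinfty :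
  (fun u : R => u `^ ((alpha - 2) / alpha) * expR (u ^+ 2 / 2)) @ +oo --> +oo.
Proof.
apply/cvgryPge => A; near=> u.
have u0 : 0 < u by near: u; exact: nbhs_pinfty_gt.
have uA : A <= u by near: u; apply: nbhs_pinfty_ge; exact: num_real.
rewrite pickands_scaleE// (le_trans uA)// mulrCA ler_peMr ?(ltW u0)//.
have h4 : (0 : R) < 4^-1 by rewrite invr_gt0.
have H : expR (- (4^-1 * u ^+ 2)) <= pickands_step alpha u.
  by near: u; exact: pickands_step_ge_expR.
have H2 : 1 <= expR (- (4^-1 * u ^+ 2)) * expR (u ^+ 2 / 2).
  rewrite -expRD -[leLHS]expR0 ler_expR.
  by have := sqr_ge0 u; lra.
by rewrite (le_trans H2)// ler_wpM2r ?expR_ge0.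
Unshelve. all: end_near. Qed.

End pickands_scale.

(** * Path suprema and the random horizon *)

Section path_suprema.
Variables (R : realType) (f : R -> R).
Hypothesis cf : {within `[0, +oo[, continuous f}.

(** Continuity on the compact interval bounds the image, so that [sup] is a true supremum and not
    its default value. *)
Lemma sup_path_gtP (b u : R) : 0 <= b ->
  u < sup (f @` `[0, b]) <-> exists2 s, 0 <= s <= b & u < f s.
Proof.
move=> b0; split=> [|[s s0b us]].
  have ne : (f @` `[0, b]) !=set0.
    by exists (f 0); exists 0 => //=; rewrite in_itv/= lexx b0.
  move=> /(sup_gt ne)[_ [s /= + <-] us].
  by rewrite in_itv/= => sb; exists s.
apply: (lt_le_trans us); apply: ub_le_sup; last by exists s => //=; rewrite in_itv.
have cb : {within `[0, b], continuous f}.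
  apply: continuous_subspaceW cf => x /=; rewrite !in_itv/= andbT.
  by case/andP.
have [c _ cH] := EVT_max b0 cb.
by exists (f c) => _ [x /= x0b <-]; exact: cH.
Qed.

(** An exceedance persists on a nondegenerate interval, taken to the right of [s], or to its left
    when [s = b]. That interval meets the rationals, for measurability, and the dyadic grids, for
    chaining. *)
Lemma path_gt_subinterval (a b s u : R) : 0 <= a -> a < b -> a <= s <= b -> u < f s ->
  exists c d, [/\ a <= c, c < d, d <= b & forall y, c <= y <= d -> u < f y].
Proof.
move=> a0 ab /andP[as_ sb] us.
have s0 : `[0, +oo[%classic s by rewrite /= in_itv/= andbT (le_trans a0).
have := (subspace_continuousP _ _).1 cf s s0.
move=> /cvgr_gt/(_ u us)/nbhs_ballP[del /= del0 H].
have {}H y : 0 <= y -> `|s - y| < del -> u < f y.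
  by move=> y0 yd; apply: (H y yd); rewrite /= in_itv/= andbT.
have d2 : 0 < del / 2 by rewrite divr_gt0.
case: (ltP s b) => sb'.
  exists s, (Num.min (s + del / 2) b); split => //.
  - by rewrite lt_min sb' ltrDl d2.
  - by rewrite ge_min lexx orbT.
  move=> y /andP[sy]; rewrite le_min => /andP[yd yb].
  apply: H; first by rewrite (le_trans _ sy)// (le_trans a0).
  by rewrite distrC ger0_norm ?subr_ge0//; lra.
exists (Num.max (b - del / 2) a), b; split => //.
- by rewrite le_max lexx orbT.
- by rewrite gt_max ab andbT; lra.
move=> y /andP[]; rewrite ge_max => /andP[dy ay] yb.
have sE : s = b by apply/eqP; rewrite eq_le sb sb'.
apply: H; first by rewrite (le_trans a0).
by rewrite sE ger0_norm ?subr_ge0//; lra.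
Qed.

Lemma path_gt_rational (b s u : R) : 0 <= s <= b -> u < f s ->
  exists q : rat, [/\ 0 <= ratr q :> R, ratr q <= b & u < f (ratr q)].
Proof.
move=> /andP[s0 sb] us.
have b0 : 0 <= b by exact: le_trans sb.
(* The horizon may be 0, where no subinterval exists but the only time is rational. *)
move: b0; rewrite le_eqVlt => /orP[/eqP b0|b0].
  exists 0; rewrite raddf0; split => //; first by rewrite b0.
  by have -> : 0 = s by apply/eqP; rewrite eq_le s0 [X in _ <= X]b0 sb.
have ssb : 0 <= s <= b by rewrite s0.
have [c [e [c0 ce eb H]]] := path_gt_subinterval (lexx 0) b0 ssb us.
have [q] := rat_in_itvoo ce; rewrite in_itv/= => /andP[cq qe].
exists q; split; first by rewrite (le_trans c0)// ltW.
  by rewrite (le_trans (ltW qe)).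
by apply: H; rewrite !ltW.
Qed.

Lemma path_gt_dyadic (t h s u : R) : 0 <= t -> 0 < h -> t <= s <= t + h -> u < f s ->
  exists n i, (i <= 2 ^ n)%N /\ u < f (t + i%:R * (h / 2 ^+ n)).
Proof.
move=> t0 h0 ts us.
have tth : t < t + h by rewrite ltrDl.
have [c [e [tc ce eh H]]] := path_gt_subinterval t0 tth ts us.
have x1 : (1 : R) < 2 by rewrite ltr1n.
have [n nH] : exists n, h / (e - c) < 2 ^+ n.
  exists (Num.truncn (h / (e - c))).+1.
  apply: lt_le_trans (truncnS_gt _) _.
  by rewrite -natrX ler_nat ltnW// ltn_expl.
have p2 : (0 : R) < 2 ^+ n by rewrite exprn_gt0.
have hn0 : 0 < h / 2 ^+ n by rewrite divr_gt0.
have hnc : h / 2 ^+ n < e - c.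
  by rewrite ltr_pdivrMr// mulrC -ltr_pdivrMr// subr_gt0.
pose x := (c - t) / (h / 2 ^+ n).
have x0 : 0 <= x by rewrite divr_ge0 ?subr_ge0// ltW.
have /andP[ix xi] := truncn_itv x0.
pose i := (Num.truncn x).+1.
have ci : c <= t + i%:R * (h / 2 ^+ n).
  by rewrite -lerBlDl -ler_pdivrMr// ltW.
have ie : t + i%:R * (h / 2 ^+ n) <= e.
  move: ix; rewrite /x ler_pdivlMr// => ix.
  by rewrite /i -natr1 mulrDl mul1r; lra.
exists n, i; split; last by apply: H; rewrite ci.
rewrite -(ler_nat R) natrX.
have : t + i%:R * (h / 2 ^+ n) <= t + h by exact: le_trans eh.
by rewrite lerD2l mulrA ler_pdivrMr// mulrC ler_pM2l.
Qed.

End path_suprema.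

Lemma measure_bigcup_le d (Omega : measurableType d) (R : realType)
  (P : probability Omega R) (F : nat -> set Omega) (b : R) :
  (forall n, measurable (F n)) -> {homo F : n m / (n <= m)%N >-> n `<=` m} ->
  (forall n, fine (P (F n)) <= b) -> fine (P (\bigcup_n F n)) <= b.
Proof.
move=> mF ndF Fb.
have mU : measurable (\bigcup_n F n) by exact: bigcup_measurable.
have ndF' : {homo F : n m / (n <= m)%N >-> (n <= m)%O}.
  by move=> n m nm; apply/subsetPset; exact: ndF.
have H := @nondecreasing_cvg_mu _ _ _ P F mF mU ndF'.
rewrite -lee_fin fineK ?fin_num_measure// -(cvg_lim _ H)//.
apply: lime_le; first by apply/cvg_ex; eexists; exact: H.
by apply: nearW => n /=; rewrite -[P _]fineK ?fin_num_measure// lee_fin.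
Qed.

Section independence_of_time.
Variables (d : measure_display) (Omega : measurableType d) (R : realType).
Variables (P : probability Omega R) (X : R -> Omega -> R) (T : Omega -> R).
Hypothesis gX : centered_gaussian_process P X.
Hypothesis mT : measurable_fun setT T.
Hypothesis indT : independent_of_process P T X.

Lemma grid_measurable (t : nat -> R) (u : R) (m : nat) : (forall i, 0 <= t i) ->
  measurable (\big[setU/set0]_(i < m) [set w | u < X (t i) w]).
Proof.
move=> t0; apply: bigsetU_measurable => i _.
exact: (measurable_lt_set (f := fun=> u) (measurable_cst _) (process_measurable gX (t0 i))).
Qed.

(** A union of exceedances is not a cylinder, but its complement is: all the values are at most [u].
    Independence is applied there and transferred by complementation. *)
Lemma time_grid_independent (A : set R) (t : nat -> R) (u : R) (m : nat) :
  measurable A -> (forall i, 0 <= t i) ->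
  fine (P (T @^-1` A `&` \big[setU/set0]_(i < m) [set w | u < X (t i) w])) =
  fine (P (T @^-1` A)) * fine (P (\big[setU/set0]_(i < m) [set w | u < X (t i) w])).
Proof.
move=> mA t0; set U := \big[setU/set0]_(i < m) _.
have mU : measurable U by exact: grid_measurable.
have mTA : measurable (T @^-1` A) by rewrite -[_ @^-1` _]setTI; exact: mT.
have UE : ~` U = \bigcap_(i in [set: 'I_m]) (X (t i) @^-1` `]-oo, u]).
  apply/seteqP; split=> [w Uw i _ /=|w Xw].
    rewrite in_itv/= leNgt; apply/negP => ui; apply: Uw.
    by rewrite /U -(bigcup_mkord _ (fun i => [set w | u < X (t i) w])); exists (val i) => /=.
  rewrite /U -(bigcup_mkord _ (fun i => [set w | u < X (t i) w])) => -[i /= im ui].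
  by have := Xw (Ordinal im) I; rewrite /= in_itv/= leNgt ui.
have := @indT m (fun i => t i) (fun=> `]-oo, u]%classic) A (fun i => t0 i)
  (fun=> measurable_itv _) mA.
rewrite -UE probability_setC// => H.
have -> : P (T @^-1` A `&` U) = (P (T @^-1` A) - P (T @^-1` A `&` ~` U))%E.
  have PA : (P (T @^-1` A) < +oo)%E by rewrite ltey_eq fin_num_measure.
  have mUC := measurableC mU.
  by rewrite -measureD// setDE setCK.
rewrite H -(fineK (fin_num_measure P _ mTA)) -(fineK (fin_num_measure P _ mU)).
rewrite -(EFinB 1 (fine _)) -EFinM -EFinB/=.
by ring.
Qed.

End independence_of_time.

(** * Two-sided bounds for an exceedance before the random horizon *)

Section hitting_probability.
Variables (d : measure_display) (Omega : measurableType d) (R : realType).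
Variables (P : probability Omega R) (X : R -> Omega -> R) (r : R -> R).
Variables (T : Omega -> R) (L : R -> R) (N : set Omega).
Hypothesis gX : centered_gaussian_process P X.
Hypothesis statX : forall s t : R, 0 <= s -> 0 <= t ->
  covariance P (X s) (X (s + t)) = (r t)%:E.
Hypothesis mN : measurable N.
Hypothesis PN : P N = 0%E.
Hypothesis cX : forall w, ~ N w -> {within `[0, +oo[, continuous (fun s => X s w)}.
Hypothesis mT : measurable_fun setT T.
Hypothesis T0 : forall w, 0 <= T w.
Hypothesis indT : independent_of_process P T X.
Hypothesis tailT : forall t : R, P [set w | T w > t] = (L t)%:E.

Definition sup_event (u : R) : set Omega :=
  [set w | ~ N w /\ sup ((fun s => X s w) @` `[0, T w]) > u].

Lemma sup_eventP u w :
  sup_event u w <-> ~ N w /\ exists2 s, 0 <= s <= T w & u < X s w.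
Proof.
split=> -[Nw H]; split=> //.
  exact: (sup_path_gtP (cX Nw) u (T0 w)).1 H.
exact: (sup_path_gtP (cX Nw) u (T0 w)).2 H.
Qed.

Let mge (x : R) : measurable [set w | x <= T w].
Proof. exact: measurable_superlevel_set. Qed.

Let mgt (x : R) : measurable [set w | x < T w].
Proof. exact: (measurable_lt_set (f := fun=> x) (measurable_cst _) mT). Qed.

Let mX (t u : R) : 0 <= t -> measurable [set w | u < X t w].
Proof.
by move=> t0; exact: (measurable_lt_set (f := fun=> u) (measurable_cst _) (process_measurable gX t0)).
Qed.

Lemma sup_event_measurable u : measurable (sup_event u).
Proof.
pose F (q : rat) : set Omega := if (0 <= ratr q :> R)
  then [set w | ratr q <= T w] `&` [set w | u < X (ratr q) w] else set0.
have -> : sup_event u = ~` N `&` \bigcup_q F q.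
  apply/seteqP; split=> [w /sup_eventP[Nw [s sT us]]|w [Nw [q _]]].
    split=> //; have [q [q0 qT uq]] := path_gt_rational (cX Nw) sT us.
    by exists q => //; rewrite /F q0.
  rewrite /F; case: ifPn => // q0 [/= qT uq]; apply/sup_eventP; split=> //.
  by exists (ratr q) => //; rewrite q0.
apply: measurableI; first exact: measurableC.
apply: bigcupT_measurable_rat => q; rewrite /F; case: ifPn => // q0.
by apply: measurableI => //; exact: mX.
Qed.

(** [L] is the tail for the strict inequality, so the index drops by one; in the sum over [j] this
    costs the additive 1. *)
Lemma time_ge_le (j : nat) : fine (P [set w | j%:R <= T w]) <= if j is i.+1 then L i%:R else 1.
Proof.
case: j => [|j].
  by rewrite -lee_fin fineK ?fin_num_measure//; exact: probability_le1.
have -> : L j%:R = fine (P [set w | j%:R < T w]) by rewrite tailT.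
by apply: le_fine_probability => // w /=; apply: lt_le_trans; rewrite ltr_nat ltnSn.
Qed.

Lemma sum_time_ge_le (n : nat) :
  \sum_(j < n) fine (P [set w | j%:R <= T w]) <= 1 + \sum_(j < n) L j%:R.
Proof.
have L0 x : 0 <= L x by rewrite -lee_fin -tailT.
case: n => [|n]; first by rewrite !big_ord0 addr0.
rewrite big_ord_recl (le_trans (lerD (time_ge_le 0) (ler_sum _ (fun i _ => time_ge_le (lift ord0 i)))))//=.
by rewrite lerD2l big_ord_recr/= lerDl.
Qed.

Variables (alpha C : R).
Hypothesis alpha0 : 0 < alpha.
Hypothesis C0 : 0 < C.
Hypothesis r01 : r 0 = 1.
Hypothesis rA : \forall t \near 0^'+, 1 - r t <= 2 * C * t `^ alpha.

Lemma chain_event_nondecreasing (t u lev : R) :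
  {homo chain_event X alpha t u lev : n m / (n <= m)%N >-> n `<=` m}.
Proof.
move=> n m nm w /chain_eventP[i i2 H]; apply/chain_eventP.
exists (i * 2 ^ (m - n))%N; first by rewrite -{2}(subnKC nm) expnD leq_mul2r i2 orbT.
suff -> : chain_point alpha t u m (i * 2 ^ (m - n)) = chain_point alpha t u n i by [].
rewrite /chain_point natrM natrX (_ : (2 : R) ^+ m = 2 ^+ n * 2 ^+ (m - n)); last first.
  by rewrite -exprD subnKC.
have : (2 : R) ^+ (m - n) != 0 by rewrite expf_neq0.
have : (2 : R) ^+ n != 0 by rewrite expf_neq0.
by move: (_ ^+ n) (_ ^+ (m - n)) => a b a0 b0; field; rewrite a0 b0.
Qed.

(** Of [s <= T] only [j <= T] is kept, with [j] the integer part of the exceedance time [s]. On each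
    block independence then gives the product of the probability of [j <= T] and the chaining
    bound. *)
Lemma sup_event_upper_bound : exists2 K, 0 <= K &
  \forall u \near +oo, forall n : nat,
    fine (P (sup_event u `&` [set w | T w < n%:R])) <=
    K * (1 + \sum_(j < n) L j%:R) * (pickands_step alpha u * (u * expR (u ^+ 2 / 2)))^-1.
Proof.
have [K K0 KH] := chaining_bound gX statX r01 alpha0 C0 rA.
exists (2 * K); first by rewrite mulr_ge0.
near=> u => n.
have u0 : 0 < u by near: u; exact: nbhs_pinfty_gt.
have Ku : forall t m, 0 <= t ->
    fine (P (chain_event X alpha t u u m)) <= K * (u^-1 * expR (- (u ^+ 2 / 2))).
  by near: u.
have h1 : pickands_step alpha u <= 1 by near: u; exact: pickands_step_le.
set h := pickands_step alpha u in h1 *.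
have h0 : 0 < h by exact: pickands_step_gt0.
pose G := u^-1 * expR (- (u ^+ 2 / 2)).
have G0 : 0 < G by rewrite mulr_gt0 ?expR_gt0// invr_gt0.
have GV : u * expR (u ^+ 2 / 2) = G^-1 by rewrite /G expRN invfM !invrK.
(* Enough blocks of length [h] to cover a unit interval, and at most [2 / h] of them since
   [h <= 1]. *)
pose k := (Num.truncn h^-1).+1.
pose D (j i : nat) := [set w | j%:R <= T w] `&`
  \bigcup_m chain_event X alpha (j%:R + i%:R * h) u u m.
have pt0 j i : 0 <= j%:R + i%:R * h by rewrite addr_ge0// mulr_ge0// ltW.
have mC j i m : measurable (chain_event X alpha (j%:R + i%:R * h) u u m).
  exact: (chain_event_measurable gX).
have mD j i : measurable (D j i).
  by apply: measurableI => //; exact: bigcup_measurable.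
have DP j i : fine (P (D j i)) <= fine (P [set w | j%:R <= T w]) * (K * G).
  rewrite /D setI_bigcupr; apply: measure_bigcup_le.
  - by move=> m; exact: measurableI.
  - move=> m1 m2 m12 w [jT H]; split=> //.
    exact: (chain_event_nondecreasing m12).
  move=> m; have := @time_grid_independent _ _ _ P X T gX mT indT `[j%:R, +oo[%classic
    (chain_point alpha (j%:R + i%:R * h) u m) u (2 ^ m).+1 (measurable_itv _)
    (fun i' => chain_point_ge0 alpha u m i' (pt0 j i)).
  have -> : T @^-1` `[j%:R, +oo[ = [set w | j%:R <= T w].
    by apply/seteqP; split=> w /=; rewrite in_itv/= andbT.
  by move=> ->; rewrite ler_wpM2l//; [exact: fine_ge0|exact: Ku].
have sub : sup_event u `&` [set w | T w < n%:R] `<=`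
    \big[setU/set0]_(j < n) \big[setU/set0]_(i < k) D j i.
  move=> w [/sup_eventP[Nw [s /andP[s0 sT] us]] /= Tn].
  have /andP[js sj] := truncn_itv s0.
  set j := Num.truncn s in js sj.
  have x0 : 0 <= (s - j%:R) / h by rewrite divr_ge0 ?subr_ge0// ltW.
  have /andP[ix xi] := truncn_itv x0.
  set i := Num.truncn _ in ix xi.
  rewrite -(bigcup_mkord _ (fun j => \big[setU/set0]_(i < k) D j i)).
  exists j => /=; first by rewrite -(ltr_nat R) (le_lt_trans js)// (le_lt_trans sT).
  rewrite -(bigcup_mkord _ (fun i => D j i)).
  exists i => /=.
    rewrite -(ltr_nat R) (le_lt_trans ix)//.
    apply: le_lt_trans (truncnS_gt h^-1).
    by rewrite -[leRHS]mul1r ler_pM2r ?invr_gt0// lerBlDl natr1 ltW.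
  split; first by rewrite /= (le_trans js).
  have ts : j%:R + i%:R * h <= s <= j%:R + i%:R * h + h.
    move: ix xi; rewrite ler_pdivlMr// ltr_pdivrMr// -natr1 => ix xi.
    by apply/andP; split; lra.
  have [m [l [lm ul]]] := path_gt_dyadic (cX Nw) (pt0 j i) h0 ts us.
  by exists m => //; apply/chain_eventP; exists l.
have mE : measurable (sup_event u `&` [set w | T w < n%:R]).
  apply: measurableI; first exact: sup_event_measurable.
  exact: (measurable_lt_set (g := fun=> n%:R) mT (measurable_cst _)).
have mUj j : measurable (\big[setU/set0]_(i < k) D j i) by exact: bigsetU_measurable.
have mU : measurable (\big[setU/set0]_(j < n) \big[setU/set0]_(i < k) D j i).
  by apply: bigsetU_measurable.
apply: (le_trans (le_fine_probability P mE mU sub)).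
have Ub j : fine (P (\big[setU/set0]_(i < k) D j i)) <=
    k%:R * (fine (P [set w | j%:R <= T w]) * (K * G)).
  have := @fine_measure_bigsetU_le _ _ _ P (D j) k (fun=> _) (mD j) (fun i _ => DP j i).
  by rewrite sumr_const card_ord mulr_natl.
have := @fine_measure_bigsetU_le _ _ _ P (fun j => \big[setU/set0]_(i < k) D j i) n (fun j => _)
   mUj (fun j _ => Ub j).
move=> /le_trans; apply.
rewrite -mulr_sumr -mulr_suml GV invfM invrK.
have kh : k%:R <= 2 * h^-1.
  have hi : 1 <= h^-1 by rewrite -[leLHS]invr1 lef_pV2 ?posrE.
  have /andP[+ _] := truncn_itv (le_trans ler01 hi).
  by rewrite /k -natr1; lra.
have S1 := sum_time_ge_le n.
have S0 : 0 <= \sum_(j < n) fine (P [set w | j%:R <= T w]).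
  by apply: sumr_ge0 => j _; exact: fine_ge0.
have KG0 : 0 <= K * G by rewrite mulr_ge0// ltW.
apply: (@le_trans _ _ ((2 * h^-1) * ((1 + \sum_(j < n) L j%:R) * (K * G)))).
  by apply: ler_pM => //; [exact: mulr_ge0|rewrite ler_wpM2r].
by rewrite le_eqVlt; apply/orP; left; apply/eqP; ring.
Unshelve. all: end_near. Qed.

Hypothesis r1 : forall eps : R, 0 < eps -> \forall t \near 0^'+, `|r t - 1| <= eps.
Hypothesis rB : \forall t \near 0^'+, C / 2 * t `^ alpha <= 1 - r t.
Hypothesis A2 : forall t : R, 0 < t -> r t < 1.
Hypothesis A3 : (fun t => r t * ln t) @ +oo --> (0 : R).

(** When [T] exceeds [M] times the scale, the whole grid of [grid_hitting] lies before [T]; the two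
    events are independent, and [N] costs nothing. *)
Lemma sup_event_lower_bound (eps : R) : 0 < eps -> exists2 M, 0 < M &
  \forall u \near +oo,
    L (M * (pickands_step alpha u * (u * expR (u ^+ 2 / 2)))) * (1 - eps) <=
    fine (P (sup_event u)).
Proof.
move=> e0.
have [M M0 MH] := grid_hitting gX statX r01 alpha0 C0 r1 rB A2 A3 e0.
exists M => //; near=> u.
have u0 : 0 < u by near: u; exact: nbhs_pinfty_gt.
have : 1 - eps <= fine (P (\big[setU/set0]_(i < Num.truncn (M * (u * expR (u ^+ 2 / 2))))
      [set w | u < X (i%:R * pickands_step alpha u) w])).
  by near: u.
set h := pickands_step alpha u; set m := Num.truncn _; set U := \big[_/_]_(i < m) _ => UH.
have h0 : 0 < h by exact: pickands_step_gt0.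
have ih0 i : 0 <= i%:R * h by rewrite mulr_ge0// ltW.
set x := M * _.
have L0 : 0 <= L x by rewrite -lee_fin -tailT.
have mU : measurable U by exact: (grid_measurable gX u m ih0).
have Tx : T @^-1` `]x, +oo[ = [set w | x < T w].
  by apply/seteqP; split=> w /=; rewrite in_itv/= andbT.
have := @time_grid_independent _ _ _ P X T gX mT indT `]x, +oo[%classic
    (fun i => i%:R * h) u m (measurable_itv _) ih0.
rewrite -/U Tx tailT /= => H.
apply: (@le_trans _ _ (L x * fine (P U))); first by rewrite ler_wpM2l.
rewrite -H.
have mI : measurable ([set w | x < T w] `&` U) by exact: measurableI.
have mE := sup_event_measurable u.
have sub : [set w | x < T w] `&` U `<=` sup_event u `|` N.
  move=> w [/= xT Uw]; have [Nw|Nw] := pselect (N w); [by right|left].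
  apply/sup_eventP; split=> //.
  move: Uw; rewrite /U -(bigcup_mkord _ (fun i => [set w | u < X (i%:R * h) w])).
  move=> [i /= im ui]; exists (i%:R * h) => //; rewrite ih0/= (le_trans _ (ltW xT))//.
  rewrite /x [_ * (u * _)]mulrC mulrA ler_pM2r//.
  apply: (@le_trans _ _ m%:R); first by rewrite ler_nat ltnW.
  have y0 : 0 <= M * (u * expR (u ^+ 2 / 2)).
    by rewrite mulr_ge0 ?(ltW M0)// mulr_ge0 ?expR_ge0// ltW.
  by have /andP[] := truncn_itv y0.
apply: (le_trans (le_fine_probability P mI (measurableU _ _ mE mN) sub)).
apply: (le_trans (fine_measureU_le P mE mN)).
by rewrite PN/= addr0.
Unshelve. all: end_near. Qed.

End hitting_probability.

(** * Comparison with the slowly varying tail, and conclusion *)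

(** The purely analytic end of the argument. The upper bound leaves the cut-off [x] free; it is
    taken as [del * mu u], small enough for the Karamata term and still harmless for [L]. *)
Lemma slow_variation_ratio (R : realType) (L mu E : R -> R) (K : R) :
  slowly_varying L -> (forall x y, x <= y -> L y <= L x) -> (forall x, L x <= 1) ->
  mu @ +oo --> +oo -> 0 <= K ->
  (\forall u \near +oo, forall (x : R) (n : nat), x < n%:R ->
     E u <= L x + K * (1 + \sum_(j < n) L j%:R) * (mu u)^-1) ->
  (forall eps, 0 < eps -> exists2 M, 0 < M &
     \forall u \near +oo, L (M * mu u) * (1 - eps) <= E u) ->
  (fun u => E u / L (mu u)) @ +oo --> (1 : R).
Proof.
move=> svL Ln L1 muoo K0 HU HL.
have L0 := slowly_varying_gt0 svL Ln.
have [n0 n00 HS] := karamata_sum svL Ln L1.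
have [_ sv] := svL.
have ratio lam : 0 < lam -> (fun u => L (lam * mu u) / L (mu u)) @ +oo --> (1 : R).
  by move=> lam0; exact: (cvg_comp _ _ muoo (sv lam lam0)).
apply/cvgrPdist_le => eps0 eps00.
pose eps := Num.min eps0 1.
have e0 : 0 < eps by rewrite lt_min eps00 ltr01.
have e1 : eps <= 1 by rewrite ge_min lexx orbT.
have ee : eps <= eps0 by rewrite ge_min lexx.
have e4 : 0 < eps / 4 by rewrite divr_gt0.
have e2 : 0 < eps / 2 by rewrite divr_gt0.
have [M M0 HM] := HL _ e2.
(* Karamata's 3 doubles to 6 when [del * m] is rounded up to an integer, and [6 * K * del] has to be
   at most [eps / 4]; adding 1 to [K] avoids division by 0. *)
pose del := eps / (24 * (K + 1)).
have K1 : 0 < K + 1 by rewrite ltr_wpDl.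
have del0 : 0 < del by rewrite divr_gt0// mulr_gt0.
have Kdel : 6 * K * del <= eps / 4.
  rewrite /del mulrA ler_pdivrMr ?mulr_gt0//.
  by have := mulr_ge0 K0 (ltW e0); nra.
near=> u.
have R1 : L (del * mu u) / L (mu u) <= 1 + eps / 4.
  by near: u; apply: (cvgr_le _ (ratio _ del0)); rewrite ltrDl.
have R2 : 1 - eps / 2 <= L (M * mu u) / L (mu u).
  by near: u; apply: (cvgr_ge _ (ratio _ M0)); rewrite gtrBl.
have mu1 : del^-1 <= mu u.
  by near: u; move/cvgryPge : muoo; exact.
(* This makes the additive constants, divided by [mu u], at most [eps / 4 * L (mu u)]. *)
have muL : 4 * (K * (1 + n0)) / eps <= mu u * L (mu u).
  by near: u; exact: (muoo _ (slowly_varying_mul_pinfty svL Ln (4 * (K * (1 + n0)) / eps))).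
have Hu : forall (x : R) (n : nat), x < n%:R ->
     E u <= L x + K * (1 + \sum_(j < n) L j%:R) * (mu u)^-1 by near: u.
have Hl : L (M * mu u) * (1 - eps / 2) <= E u by near: u.
set m := mu u in R1 R2 mu1 muL Hu Hl *.
have m0 : 0 < m by rewrite (lt_le_trans _ mu1)// invr_gt0.
have Lm := L0 m.
rewrite distrC ler_distl; apply/andP; split.
  rewrite ler_pdivlMr//; apply: le_trans Hl.
  rewrite ler_pdivlMr// in R2.
  apply: (@le_trans _ _ ((1 - eps / 2) * L m * (1 - eps / 2))); last first.
    by rewrite ler_wpM2r//; lra.
  rewrite mulrAC ler_pM2r//.
  by have := sqr_ge0 eps; nra.
rewrite ler_pdivrMr// in R1.
rewrite ler_pdivrMr//.
pose n := (Num.truncn (del * m)).+1.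
have dm0 : 0 <= del * m by rewrite mulr_ge0// ltW.
have /andP[nd dn] := truncn_itv dm0.
have dn' : del * m < n%:R := dn.
have dm1 : 1 <= del * m by rewrite mulrC -ler_pdivrMr// mul1r.
have n2 : n%:R <= 2 * (del * m) by rewrite /n -natr1; lra.
have H1 := Hu _ _ dn'.
have Lnd : L n%:R <= L (del * m) by rewrite Ln// ltW.
have H2 : 3 * n%:R * L n%:R <= 6 * (del * m) * L (del * m).
  by apply: ler_pM => //; rewrite ?(ltW (L0 _))//; lra.
have H3 := HS n.
have H4 : K * (1 + \sum_(j < n) L j%:R) * m^-1 <=
    K * (1 + n0) / m + 6 * K * del * L (del * m).
  rewrite [leRHS](_ : _ = K * (1 + n0 + 6 * (del * m) * L (del * m)) * m^-1); last first.
    by field; rewrite gt_eqF.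
  by rewrite ler_wpM2r ?invr_ge0 ?(ltW m0)// ler_wpM2l//; lra.
have H5 : K * (1 + n0) / m <= eps / 4 * L m.
  rewrite ler_pdivrMr// -mulrA.
  by move: muL; rewrite ler_pdivrMr//; lra.
have H6 : 6 * K * del * L (del * m) <= eps / 4 * L (del * m).
  by rewrite ler_wpM2r// ltW.
have H7 : (1 + eps / 4) * L (del * m) <= (1 + eps / 4) * ((1 + eps / 4) * L m).
  by rewrite ler_wpM2l//; lra.
have H8 : E u <= ((1 + eps / 4) * (1 + eps / 4) + eps / 4) * L m by lra.
apply: (le_trans H8); rewrite ler_pM2r//.
by nra.
Unshelve. all: end_near. Qed.

Theorem theorem3p3 (d : measure_display) (Omega : measurableType d) (R : realType)
  (P : probability Omega R) (X : R -> Omega -> R) (r : R -> R)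
  (alpha C : R) (T : Omega -> R) (L : R -> R) (N : set Omega) :
  (* centered Gaussian process *)
  centered_gaussian_process P X ->
  (* stationarity: Cov(X(s), X(s+t)) = r(t) for all s, t >= 0 *)
  (forall s t : R, 0 <= s -> 0 <= t ->
     covariance P (X s) (X (s + t)) = (r t)%:E) ->
  (* almost surely continuous sample paths: continuous outside the null set N *)
  measurable N -> P N = 0%E ->
  (forall w, ~ N w -> {within `[0, +oo[, continuous (fun s => X s w)}) ->
  (* (A1) *)
  0 < alpha -> alpha <= 2 -> 0 < C ->
  (forall eps : R, 0 < eps -> \forall t \near 0^'+,
     `| r t - (1 - C * t `^ alpha) | <= eps * t `^ alpha) ->
  (* (A2) *)
  (forall t : R, 0 < t -> r t < 1) ->
  (* (A3) *)
  (fun t => r t * ln t) @ +oo --> (0 : R) ->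
  (* T nonnegative, independent of X, with slowly varying tail L *)
  measurable_fun setT T -> (forall w, 0 <= T w) ->
  independent_of_process P T X ->
  slowly_varying L ->
  (forall t : R, P [set w | T w > t] = (L t)%:E) ->
  (fun u : R =>
     fine (P [set w | ~ N w /\
                 sup ((fun s => X s w) @` `[0, T w]) > u])
     / L (u `^ ((alpha - 2) / alpha) * expR (u ^+ 2 / 2)))
  @ +oo --> (1 : R).
Proof.
move=> gX statX mN PN cX alpha0 _ C0 A1 A2 A3 mT T0 indT svL tailT.
(* (A1) with tolerance [C] gives the upper estimate for chaining; with tolerance [C / 2] it gives
   the lower one, [rB], for the second moment. *)
have rA : \forall t \near 0^'+, 1 - r t <= 2 * C * t `^ alpha.
  by apply: filterS (A1 _ C0) => t; rewrite ler_norml => /andP[]; lra.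
have C2 : 0 < C / 2 by rewrite divr_gt0.
have rB : \forall t \near 0^'+, C / 2 * t `^ alpha <= 1 - r t.
  by apply: filterS (A1 _ C2) => t; rewrite ler_norml => /andP[]; lra.
have r1 (eps : R) : 0 < eps -> \forall t \near 0^'+, `|r t - 1| <= eps.
  move=> e0; pose x := eps / (2 * C).
  have x0 : 0 < x by rewrite divr_gt0// mulr_gt0.
  near=> t.
  have t0 : 0 < t by near: t; exact: nbhs_right_gt.
  have tx : t <= x `^ alpha^-1 by near: t; apply: nbhs_right_le; exact: powR_gt0.
  have H1 : 1 - r t <= 2 * C * t `^ alpha by near: t.
  have H2 : C / 2 * t `^ alpha <= 1 - r t by near: t.
  have H3 : t `^ alpha <= x.
    rewrite (_ : x = (x `^ alpha^-1) `^ alpha); last first.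
      by rewrite -powRrM mulVf ?gt_eqF// powRr1// ltW.
    by rewrite ge0_ler_powR ?nnegrE ?powR_ge0 ?(ltW alpha0) ?(ltW t0).
  have H4 : 2 * C * t `^ alpha <= eps.
    by rewrite mulrC -ler_pdivlMr// mulr_gt0.
  have H5 : 0 <= C / 2 * t `^ alpha by rewrite mulr_ge0 ?powR_ge0// ltW.
  by rewrite distrC ger0_norm; lra.
have r01 : r 0 = 1 := process_variance_eq1 gX statX mN PN cX r1.
have mgt (x : R) : measurable [set w | x < T w].
  exact: (measurable_lt_set (f := fun=> x) (measurable_cst _) mT).
have Lni (x y : R) : x <= y -> L y <= L x.
  move=> xy; have -> : L y = fine (P [set w | y < T w]) by rewrite tailT.
  have -> : L x = fine (P [set w | x < T w]) by rewrite tailT.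
  by apply: le_fine_probability => // w /=; exact: le_lt_trans.
have L1 (x : R) : L x <= 1.
  by rewrite -lee_fin -tailT; exact: probability_le1.
have [K K0 HK] := sup_event_upper_bound gX statX mN cX mT T0 indT tailT alpha0 C0 r01 rA.
apply: (@slow_variation_ratio _ L _ (fun u => fine (P (sup_event X T N u))) K
  svL Lni L1 (pickands_scale_pinfty alpha0) K0).
  near=> u => x n xn.
  have u0 : 0 < u by near: u; exact: nbhs_pinfty_gt.
  have mE := sup_event_measurable gX mN cX mT T0 u.
  have mTn : measurable [set w | T w < n%:R].
    exact: (measurable_lt_set (g := fun=> n%:R) mT (measurable_cst _)).
  have H : forall n : nat, fine (P (sup_event X T N u `&` [set w | T w < n%:R])) <=
    K * (1 + \sum_(j < n) L j%:R) * (pickands_step alpha u * (u * expR (u ^+ 2 / 2)))^-1.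
    by near: u.
  rewrite pickands_scaleE//; apply: le_trans (lerD (lexx (L x)) (H n)).
  have -> : L x = fine (P [set w | x < T w]) by rewrite tailT.
  have mI := measurableI _ _ mE mTn.
  apply: le_trans (fine_measureU_le P (mgt x) mI).
  apply: le_fine_probability => //; first exact: measurableU.
  (* Either [T] exceeds the cut-off [x], or [T <= x < n] and the block bound applies. *)
  move=> w Ew; case: (ltP x (T w)) => xT; [by left|right].
  by split=> //=; rewrite (le_lt_trans xT).
move=> eps e0.
have [M M0 HM] := sup_event_lower_bound gX statX mN PN cX mT T0 indT tailT alpha0 C0 r01 r1 rB A2 A3 e0.
exists M => //; near=> u.
have u0 : 0 < u by near: u; exact: nbhs_pinfty_gt.
by rewrite pickands_scaleE//; near: u.
Unshelve. all: end_near. Qed.
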